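(* Let $r,s\ge2$. Every local proper holomorphic map from $\mathbb B^{r,s,t}$ to $\mathbb B^{r,s',t'}$ is quasi-standard (standard when $t'=0$).
   Context: Let $r,s,t\ge 0$ be integers with $n=r+s+t>0$. $\mathbb C^{r,s,t}$ denotes $\mathbb C^n$ equipped with the (possibly degenerate, indefinite) Hermitian form $\langle z,w\rangle_{r,s,t}=\sum_{j=1}^{r}z_j\bar w_j-\sum_{j=r+1}^{r+s}z_j\bar w_j$, and $\mathbb P^{r,s,t}$ is its projectivization. A point $[z]$ is positive or null according as $\langle z,z\rangle_{r,s,t}>0$ or $=0$. The generalized ball $\mathbb B^{r,s,t}$ is the set of positive points and $\partial\mathbb B^{r,s,t}$ the set of null points. A local proper holomorphic map from $\mathbb B^{r,s,t}$ to $\mathbb B^{r',s',t'}$ is a holomorphic map $f:U\to\mathbb P^{r',s',t'}$ on a connected open set $U\subset\mathbb P^{r,s,t}$ with $U\cap\partial\mathbb B^{r,s,t}\ne\varnothing$, $f(U\cap\mathbb B^{r,s,t})\subset\mathbb B^{r',s',t'}$ and $f(U\cap\partial\mathbb B^{r,s,t})\subset\partial\mathbb B^{r',s',t'}$. A complex linear subspace $H$ (or $\mathbb PH$) is a null space if the form vanishes identically on $H$. $f$ is standard if it is induced by a linear isometry $\mathbb C^{r,s,t}\to\mathbb C^{r',s',t'}$ (a linear map $L$ with $\langle Lu,Lv\rangle_{r',s',t'}=\langle u,v\rangle_{r,s,t}$); null if $f(U)$ is contained in a null space. $f$ is quasi-standard if either $f$ is standard, or there is a decomposition $\mathbb C^{r',s',t'}=A\oplus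 B$ into nonzero subspaces with $\langle a,b\rangle_{r',s',t'}=0$ for all $a\in A,b\in B$ such that $\pi_A\circ f$ is standard and $\pi_B\circ f$ is null, where $\pi_A:\mathbb P^{r',s',t'}\dashrightarrow\mathbb PA$, $\pi_B:\mathbb P^{r',s',t'}\dashrightarrow\mathbb PB$ are induced by the linear projections, and $\mathbb PA,\mathbb PB$ carry the restricted forms. *)

(* Defs.v *)
From mathcomp Require Import all_boot all_order all_algebra.
From mathcomp Require Import reals complex.

Set Implicit Arguments.
Unset Strict Implicit.
Unset Printing Implicit Defensive.

Import Order.TTheory GRing.Theory Num.Theory.
Local Open Scope ring_scope.

Section GenBall.
Variable R : realType.
Local Notation C := (complex R).

Definition hform (r s t : nat) (z w : 'rV[C]_(r + s + t)) : C :=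
  \sum_(j < r + s + t | (j < r)%N) z 0 j * (w 0 j)^*
  - \sum_(j < r + s + t | (r <= j < r + s)%N) z 0 j * (w 0 j)^*.

Definition vnorm (n : nat) (h : 'rV[C]_n) : C := \sum_(j < n) `|h 0 j|.

Definition is_open (n : nat) (V : 'rV[C]_n -> Prop) : Prop :=
  forall z, V z -> exists delta : C, 0 < delta /\
    forall w, vnorm (w - z) < delta -> V w.

Definition is_connected (n : nat) (U : 'rV[C]_n -> Prop) : Prop :=
  forall P : 'rV[C]_n -> Prop, (forall z, P z -> U z) -> is_open P ->
    is_open (fun z => U z /\ ~ P z) ->
    (forall z, ~ P z) \/ (forall z, U z -> P z).

Definition holo_on (n m : nat) (V : 'rV[C]_n -> Prop) (F : 'rV[C]_n -> 'rV[C]_m)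
  : Prop :=
  forall z, V z -> exists D : 'M[C]_(n, m), forall eps : C, 0 < eps ->
    exists delta : C, 0 < delta /\ forall h : 'rV[C]_n, vnorm h < delta ->
      vnorm (F (z + h) - F z - h *m D) <= eps * vnorm h.

(* x and y span the same complex line (represent the same projective point
   when y != 0). *)
Definition prop_vec (m : nat) (x y : 'rV[C]_m) : Prop :=
  exists mu : C, mu != 0 /\ x = mu *: y.

(* A subset of P^{n-1} is represented by its cone in C^n \ {0}. *)
Definition conic (n : nat) (U : 'rV[C]_n -> Prop) : Prop :=
  ~ U 0 /\ forall z (lam : C), U z -> lam != 0 -> U (lam *: z).

(* A holomorphic map U -> P^{m-1}, U a (conic) open set of C^n \ {0}
   representing an open set of P^{n-1}: f z is a nonzero homogeneous
   representative of the image of [z], well defined on lines, and locally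
   [f] = [F] for a holomorphic nowhere-vanishing F. *)
Definition proj_holo (n m : nat) (U : 'rV[C]_n -> Prop)
  (f : 'rV[C]_n -> 'rV[C]_m) : Prop :=
  (forall z, U z -> f z != 0) /\
  (forall z (lam : C), U z -> lam != 0 -> prop_vec (f (lam *: z)) (f z)) /\
  (forall z, U z -> exists V : 'rV[C]_n -> Prop,
     is_open V /\ V z /\ (forall w, V w -> U w) /\
     exists F : 'rV[C]_n -> 'rV[C]_m, holo_on V F /\
       forall w, V w -> prop_vec (F w) (f w)).

Definition local_proper (r s t r' s' t' : nat) (U : 'rV[C]_(r + s + t) -> Prop)
  (f : 'rV[C]_(r + s + t) -> 'rV[C]_(r' + s' + t')) : Prop :=
  is_open U /\ conic U /\ is_connected U /\
  (exists z, U z /\ hform z z = 0) /\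
  proj_holo U f /\
  (forall z, U z -> 0 < hform z z -> 0 < hform (f z) (f z)) /\
  (forall z, U z -> hform z z = 0 -> hform (f z) (f z) = 0).

Definition lin_isometry (r s t r' s' t' : nat) (L : 'M[C]_(r + s + t, r' + s' + t'))
  : Prop :=
  forall u v, hform (u *m L) (v *m L) = hform u v.

Definition standard (r s t r' s' t' : nat) (U : 'rV[C]_(r + s + t) -> Prop)
  (f : 'rV[C]_(r + s + t) -> 'rV[C]_(r' + s' + t')) : Prop :=
  exists L : 'M[C]_(r + s + t, r' + s' + t'),
    lin_isometry L /\ forall z, U z -> prop_vec (f z) (z *m L).

Definition null_space (r' s' t' : nat) (H : 'M[C]_(r' + s' + t')) : Prop :=
  forall u v : 'rV[C]_(r' + s' + t'), (u <= H)%MS -> (v <= H)%MS ->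
    hform u v = 0.

Definition null_map (n r' s' t' : nat) (U : 'rV[C]_n -> Prop)
  (f : 'rV[C]_n -> 'rV[C]_(r' + s' + t')) : Prop :=
  exists H : 'M[C]_(r' + s' + t'), null_space H /\
    forall z, U z -> (f z <= H)%MS.

(* Quasi-standard: standard, or C^{r',s',t'} = A (+) B orthogonally with
   A, B nonzero, pi_A o f standard (as a map into PA with the restricted
   form, on its domain of definition, which is nonempty) and pi_B o f null
   (its image lies in a null subspace of B). *)
Definition quasi_standard (r s t r' s' t' : nat) (U : 'rV[C]_(r + s + t) -> Prop)
  (f : 'rV[C]_(r + s + t) -> 'rV[C]_(r' + s' + t')) : Prop :=
  standard U f \/
  exists A B : 'M[C]_(r' + s' + t'),
    A != 0 /\ B != 0 /\ (A + B == 1%:M)%MS /\ mxdirect (A + B) /\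
        (forall a b, (a <= A)%MS -> (b <= B)%MS -> hform a b = 0) /\
        (exists L : 'M[C]_(r + s + t, r' + s' + t'),
           [/\ (L <= A)%MS,
               lin_isometry L,
               (exists z, U z /\ f z *m proj_mx A B != 0) &
               forall z, U z -> f z *m proj_mx A B != 0 ->
                 prop_vec (f z *m proj_mx A B) (z *m L)]) /\
        (exists H : 'M[C]_(r' + s' + t'),
           [/\ (H <= B)%MS, null_space H &
               forall z, U z -> (f z *m proj_mx B A <= H)%MS]).

End GenBall.

(* Main.v *)
Require Import Defs.
From mathcomp Require Import all_boot all_order all_algebra.
From mathcomp Require Import reals complex.
From mathcomp Require Import boolp classical_sets ring lra.
Import Order.TTheory GRing.Theory Num.Theory.
Local Open Scope ring_scope.

(** Modulo the radical of the target, let F be a holomorphic local lift of the map near a null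
    point. Polarization along analytic curves that are null for real parameters shows that F
    preserves orthogonality. Since source and target have the same number [r] of positive squares,
    F maps three points of a null plane to dependent vectors; complexifying null planes, it maps
    lines to lines. Differentiate F at a negative point [z0]: for [x] orthogonal to [z0] the
    functional [h |-> <dF h, F x>] vanishes on the orthogonal complement of [x], hence is a
    multiple of [<h, x>]. This singles out a normalization of F which respects linear relations,
    i.e. is linear. The identity theorem propagates this linear map to the whole connected domain,
    and testing it on orthogonal positive vectors shows that it is a multiple of an isometry.

    The identity theorem needs no integration: a discrete Goursat argument bounds [g w] by twice
    the maximum of [|g|] on the boundary of a square around [w]. *)

Set Implicit Arguments.
Unset Strict Implicit.

(** * Complex differentiable functions of one variable *)

Section Modulus.
Variable R : realType.
Local Notation C := (complex R).

(** The lift is determined only up to a scalar function, so the intermediate statements have to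
    survive rescaling: orthogonality, vanishing of determinants of pairings, parallelism. Each
    becomes the vanishing of a holomorphic function of one complex parameter once the second
    argument of the form is frozen or reflected. The identity theorem is therefore needed in one
    variable only, and every configuration is put on a curve controlled for [nm l < 30]. Inertia is
    used sharply: modulo the radical, [r + 1] mutually orthogonal vectors of nonnegative square in
    the target are dependent. A negative point [z0] leaves room for [r] positive vectors in its
    orthogonal complement, and their images form a test family: a null vector orthogonal to all of
    them vanishes. The price is twofold. The derivative at a given negative point may be degenerate,
    and then the point has to be moved. Moreover linearity gives the isometry only against vectors
    orthogonal to [z0]; the value [<z0 L, z0 L>] is recovered separately, from an orthogonal pair of
    vectors outside that hyperplane. *)

Definition nm (z : C) : R := complex.Re `|z|.

Lemma nmE (z : C) : `|z| = (nm z)%:C%C.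
Proof. by rewrite /nm normc_def. Qed.

Lemma nm_ge0 z : 0 <= nm z.
Proof. by rewrite -(ler0c (nm z)) -nmE normr_ge0. Qed.

Lemma nm0 : nm 0 = 0. Proof. by rewrite /nm normr0. Qed.
Lemma nm1 : nm 1 = 1. Proof. by rewrite /nm normr1. Qed.
Lemma nmN z : nm (- z) = nm z. Proof. by rewrite /nm normrN. Qed.
Lemma nmB z w : nm (z - w) = nm (w - z). Proof. by rewrite /nm distrC. Qed.

Lemma nm_eq0 z : nm z = 0 -> z = 0.
Proof. by move=> h; apply/eqP; rewrite -normr_eq0 nmE h. Qed.

Lemma nm_gt0 z : z != 0 -> 0 < nm z.
Proof. by move=> h; rewrite lt_neqAle nm_ge0 andbT eq_sym; apply: contra h => /eqP/nm_eq0->. Qed.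

Lemma nmM z w : nm (z * w) = nm z * nm w.
Proof. by apply: (@complexI R); rewrite -nmE normrM !nmE rmorphM. Qed.

Lemma nmX z k : nm (z ^+ k) = nm z ^+ k.
Proof. by elim: k => [|k IH]; rewrite ?expr0 ?nm1 // !exprS nmM IH. Qed.

Lemma nmV z : nm z^-1 = (nm z)^-1.
Proof. by apply: (@complexI R); rewrite -nmE normfV !nmE fmorphV. Qed.

Lemma nmD z w : nm (z + w) <= nm z + nm w.
Proof. by rewrite -lecR -nmE rmorphD /= -!nmE ler_normD. Qed.

Lemma nmDB z w : nm (z - w) <= nm z + nm w.
Proof. by rewrite -(nmN w); exact: nmD. Qed.

Lemma nm_conj z : nm z^* = nm z.
Proof. by rewrite /nm norm_conjC. Qed.

Lemma nm_real (x : R) : nm x%:C%C = `|x|.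
Proof. by rewrite /nm normc_def /= expr0n addr0 sqrtr_sqr. Qed.

Lemma nm_i : nm 'i = 1. Proof. by rewrite /nm normCi. Qed.

Lemma nm_sum (I : Type) (r : seq I) (P : pred I) (F : I -> C) :
  nm (\sum_(i <- r | P i) F i) <= \sum_(i <- r | P i) nm (F i).
Proof.
elim/big_rec2: _ => [|i x y _ h]; first by rewrite nm0.
by apply: (le_trans (nmD _ _)); rewrite lerD2l.
Qed.

Lemma Im_le_nm z : `|complex.Im z| <= nm z.
Proof.
rewrite /nm normc_def /= -sqrtr_sqr ler_sqrt; last by rewrite addr_ge0 ?sqr_ge0.
by rewrite lerDr sqr_ge0.
Qed.

Lemma Re_le_nm z : `|complex.Re z| <= nm z.
Proof.
rewrite /nm normc_def /= -sqrtr_sqr ler_sqrt; last by rewrite addr_ge0 ?sqr_ge0.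
by rewrite lerDl sqr_ge0.
Qed.

Lemma complexRI (z : C) : z = (complex.Re z)%:C%C + 'i * (complex.Im z)%:C%C.
Proof. exact: complexE. Qed.

Lemma ImRI (x y : R) : complex.Im (x%:C%C + 'i * y%:C%C : C) = y.
Proof. by rewrite /=; ring. Qed.

Lemma ReRI (x y : R) : complex.Re (x%:C%C + 'i * y%:C%C : C) = x.
Proof. by rewrite /=; ring. Qed.

Lemma nm_RI (x y : R) : nm (x%:C%C + 'i * y%:C%C : C) <= `|x| + `|y|.
Proof. by apply: (le_trans (nmD _ _)); rewrite nmM nm_i mul1r !nm_real. Qed.

End Modulus.

(** * Compactness of the square by bisection *)

Section Bisection.
Variable R : realType.

Lemma half_pow_small (e : R) : 0 < e -> exists k, (2^-1) ^+ k < e :> R.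
Proof.
move=> e0; have e0' : 0 <= e^-1 by rewrite invr_ge0 ltW.
exists (Num.bound e^-1); have := archi_boundP e0'; set k := Num.bound _ => hk.
have : k%:R < 2 ^+ k :> R by rewrite -natrX ltr_nat ltn_expl.
move=> h2; rewrite exprVn -[e]invrK ltf_pV2 ?posrE ?invr_gt0 ?exprn_gt0 //.
exact: lt_trans h2.
Qed.

(* A Cousin-type lemma: a property of subsquares of the unit square which is inherited
   from the four quarters and holds for all small squares around each point holds for
   the unit square. *)
Lemma square_bisection (P : R -> R -> R -> Prop) :
  (forall s t l, 0 < l -> P s t (l / 2) -> P (s + l / 2) t (l / 2) ->
     P s (t + l / 2) (l / 2) -> P (s + l / 2) (t + l / 2) (l / 2) -> P s t l) ->
  (forall x y, 0 <= x <= 1 -> 0 <= y <= 1 -> exists2 d, 0 < d &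
     forall s t l, 0 < l -> l < d -> s <= x <= s + l -> t <= y <= t + l ->
       0 <= s -> s + l <= 1 -> 0 <= t -> t + l <= 1 -> P s t l) ->
  P 0 0 1.
Proof.
move=> Hsub Hloc; apply: contrapT => nP.
pose bad (q : R * R * R) := 0 < q.2 /\ ~ P q.1.1 q.1.2 q.2.
pose step (q q' : R * R * R) := bad q ->
  [/\ bad q', q'.2 = q.2 / 2,
      q.1.1 <= q'.1.1 /\ q'.1.1 + q'.2 <= q.1.1 + q.2 &
      q.1.2 <= q'.1.2 /\ q'.1.2 + q'.2 <= q.1.2 + q.2].
(* [step] is vacuous on squares that are not bad, so a total choice function exists and can be
   iterated. *)
have /choice[f Hf] : forall q, exists q', step q q'.
  move=> -[[s t] l]; rewrite /step /bad /=.
  case: (EM (0 < l /\ ~ P s t l)) => [[l0 nPl]|]; last by move=> h; exists (s, t, l).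
  have l20 : 0 < l / 2 by rewrite divr_gt0.
  have := Hsub s t l l0.
  case: (EM (P s t (l / 2))) => [h1|h1]; last by exists (s, t, l / 2) => /=; split=> //; lra.
  case: (EM (P (s + l / 2) t (l / 2))) => [h2|h2];
    last by exists (s + l / 2, t, l / 2) => /=; split=> //; lra.
  case: (EM (P s (t + l / 2) (l / 2))) => [h3|h3];
    last by exists (s, t + l / 2, l / 2) => /=; split=> //; lra.
  case: (EM (P (s + l / 2) (t + l / 2) (l / 2))) => [h4|h4];
    last by exists (s + l / 2, t + l / 2, l / 2) => /=; split=> //; lra.
  by move=> /(_ h1 h2 h3 h4).
pose q k := iter k f (0, 0, 1).
have badq k : bad (q k).
  elim: k => [|k IH]; first by split => /=.
  by have [] := Hf (q k) IH.
have lq k : (q k).2 = (2^-1) ^+ k.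
  elim: k => [|k IH]; first by rewrite expr0.
  by have [_ h _ _] := Hf (q k) (badq k); rewrite /q iterS -/(q k) h IH exprSr.
have mono k j : [/\ (q k).1.1 <= (q (j + k)%N).1.1,
   (q (j + k)%N).1.1 + (q (j + k)%N).2 <= (q k).1.1 + (q k).2,
   (q k).1.2 <= (q (j + k)%N).1.2 &
   (q (j + k)%N).1.2 + (q (j + k)%N).2 <= (q k).1.2 + (q k).2].
  elim: j => [|j [i1 i2 i3 i4]]; first by rewrite add0n.
  have [_ _ [h1 h2] [h3 h4]] := Hf (q (j + k)%N) (badq _).
  rewrite addSn /q iterS -/(q (j + k)%N); split; lra.
have bnd j k : (q j).1.1 <= (q k).1.1 + (q k).2 /\ (q j).1.2 <= (q k).1.2 + (q k).2.
  have [hj|/ltnW hk] := leqP j k.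
    have := mono j (k - j)%N; rewrite subnK // => -[h1 _ h3 _].
    have [h _] := badq k; split; lra.
  have := mono k (j - k)%N; rewrite subnK // => -[_ h2 _ h4].
  have [h _] := badq j; split; lra.
pose X := [set x | exists k, x = (q k).1.1]%classic.
pose Y := [set x | exists k, x = (q k).1.2]%classic.
have X0 : (X !=set0)%classic by exists (q 0%N).1.1; exists 0%N.
have Y0 : (Y !=set0)%classic by exists (q 0%N).1.2; exists 0%N.
have ubX k : (ubound X ((q k).1.1 + (q k).2))%classic by move=> _ [j ->]; have [] := bnd j k.
have ubY k : (ubound Y ((q k).1.2 + (q k).2))%classic by move=> _ [j ->]; have [] := bnd j k.
(* Left ends never exceed right ends, even across different stages, so the suprema lie in all the
   nested squares. *)
pose x := sup X; pose y := sup Y.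
have hx k : (q k).1.1 <= x <= (q k).1.1 + (q k).2.
  apply/andP; split; last exact: ge_sup.
  by apply: ub_le_sup; [exists ((q 0%N).1.1 + (q 0%N).2) | exists k].
have hy k : (q k).1.2 <= y <= (q k).1.2 + (q k).2.
  apply/andP; split; last exact: ge_sup.
  by apply: ub_le_sup; [exists ((q 0%N).1.2 + (q 0%N).2) | exists k].
have := hx 0%N; have := hy 0%N; rewrite /= add0r => hy0 hx0.
have [d d0 Hd] := Hloc x y hx0 hy0.
have [k hk] := half_pow_small d0.
have [l0 nPk] := badq k; apply: nPk.
have := mono 0%N k; rewrite addn0 /= !add0r => -[m1 m2 m3 m4].
by apply: Hd => //; rewrite ?lq.
Qed.

End Bisection.

(** * Limits and complex derivatives at a point *)

Section Limits.
Variable R : realType.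
Local Notation C := (complex R).

(** The value at [h = 0] is tested too, so this is continuity at 0 with [f 0 = l], which is what
    Caratheodory's derivative requires. *)
Definition tends (f : C -> C) (l : C) := forall e : R, 0 < e ->
  exists2 d : R, 0 < d & forall h, nm h < d -> nm (f h - l) < e.

Lemma tends_cst c : tends (fun=> c) c.
Proof. by move=> e e0; exists 1 => // h _; rewrite subrr nm0. Qed.

Lemma tends_id : tends id 0.
Proof. by move=> e e0; exists e => // h; rewrite subr0. Qed.

Lemma tendsD f g l m : tends f l -> tends g m -> tends (fun h => f h + g h) (l + m).
Proof.
move=> hf hg e e0; have e20 : 0 < e / 2 by lra.
have [d1 d10 h1] := hf _ e20; have [d2 d20 h2] := hg _ e20.
exists (Num.min d1 d2) => [|h]; first by rewrite lt_min d10.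
rewrite lt_min => /andP[/h1 k1 /h2 k2].
rewrite (_ : _ - _ = (f h - l) + (g h - m)); last by ring.
by apply: le_lt_trans (nmD _ _) _; lra.
Qed.

Lemma tendsM f g l m : tends f l -> tends g m -> tends (fun h => f h * g h) (l * m).
Proof.
move=> hf hg e e0; set K := nm l + nm m + 1.
have K0 : 0 < K by rewrite /K; have := nm_ge0 l; have := nm_ge0 m; lra.
have e20 : 0 < Num.min 1 (e / K) by rewrite lt_min ltr01 divr_gt0.
have [d1 d10 h1] := hf _ e20; have [d2 d20 h2] := hg _ e20.
exists (Num.min d1 d2) => [|h]; first by rewrite lt_min d10.
rewrite lt_min => /andP[/h1 k1 /h2 k2].
move: k1 k2; rewrite !lt_min => /andP[a1 a2] /andP[b1 b2].
rewrite (_ : _ - _ = ((f h - l) * (g h - m) + l * (g h - m)) + (f h - l) * m); last by ring.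
apply: le_lt_trans (nmD _ _) _.
apply: (@le_lt_trans _ _ (nm ((f h - l) * (g h - m)) + nm (l * (g h - m)) + nm ((f h - l) * m))).
  by rewrite lerD2r nmD.
rewrite !nmM; move: a1 a2 b1 b2; move: (nm_ge0 (f h - l)) (nm_ge0 (g h - m)).
move: (nm (f h - l)) (nm (g h - m)) => x y x0 y0 a1 a2 b1 b2.
have hE : e / K * K = e by rewrite divfK // gt_eqF.
rewrite -hE /K; have := nm_ge0 l; have := nm_ge0 m.
move: a2 b2; set E := e / _; move=> a2 b2; move: (nm l) (nm m) => p q q0 p0.
have s1 : x * y <= x by rewrite ler_piMr // ltW.
have s2 : p * y <= p * E by rewrite ler_wpM2l // ltW.
have s3 : x * q <= E * q by rewrite ler_wpM2r // ltW.
by rewrite !mulrDr mulr1 ![E * _]mulrC; rewrite ![E * _]mulrC in s3 *; lra.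
Qed.

Lemma tends_conj f l : tends f l -> tends (fun h => (f h^*)^*) l^*.
Proof.
move=> hf e e0; have [d d0 hd] := hf e e0; exists d => // h hh.
by rewrite -rmorphB nm_conj; apply: hd; rewrite nm_conj.
Qed.

Lemma tendsV f l : l != 0 -> tends f l -> tends (fun h => (f h)^-1) l^-1.
Proof.
move=> l0 hf e e0; have n0 := nm_gt0 l0.
have e20 : 0 < Num.min (nm l / 2) (e * (nm l * nm l / 2)).
  by rewrite lt_min divr_gt0 //= mulr_gt0 // divr_gt0 // mulr_gt0.
have [d d0 hd] := hf _ e20; exists d => // h /hd; rewrite lt_min => /andP[a1 a2].
have f0 : nm l / 2 < nm (f h).
  have := nmD (l - f h) (f h); rewrite subrK [nm (l - f h)]nmB; lra.
have fn0 : f h != 0 by apply: contraTneq f0 => ->; rewrite nm0 -leNgt divr_ge0 // ltW.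
rewrite (_ : _ - _ = (l - f h) / (f h * l)); last by field; apply/andP.
rewrite nmM nmV nmM nmB ltr_pdivrMr; last by rewrite mulr_gt0 // nm_gt0.
apply: lt_trans a2 _; rewrite ltr_pM2l // mulrAC ltr_pM2r //.
Qed.

(* Derivatives in Caratheodory's form: [g (a + h) = g a + q h * h] with [q] continuous at 0. *)
Definition is_cd (g : C -> C) (a d : C) :=
  exists2 q : C -> C, tends q d & forall h, g (a + h) = g a + q h * h.

Definition cdiff g a := exists d, is_cd g a d.

Lemma is_cdP g a d : is_cd g a d <-> forall e : R, 0 < e ->
  exists2 dl : R, 0 < dl & forall h, nm h < dl -> nm (g (a + h) - g a - d * h) <= e * nm h.
Proof.
split=> [[q hq Hq] e e0|H].
  have [dl d0 hd] := hq e e0; exists dl => // h /hd/ltW k.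
  by rewrite Hq (_ : _ - _ = (q h - d) * h); [rewrite nmM ler_wpM2r ?nm_ge0|ring].
(* The difference quotient; its value at 0 must be [d], because [tends] also looks at [h = 0]. *)
exists (fun h => if h == 0 then d else (g (a + h) - g a) / h); last first.
  move=> h; case: eqP => [->|/eqP h0]; first by rewrite !addr0 mulr0 addr0.
  by rewrite divfK // [RHS]addrC subrK.
move=> e e0; have e20 : 0 < e / 2 by lra.
have [dl d0 hd] := H _ e20; exists dl => // h /hd; case: eqP => [->|/eqP h0 k].
  by rewrite subrr nm0.
rewrite (_ : _ - d = (g (a + h) - g a - d * h) / h); last by field.
have n0 := nm_gt0 h0; rewrite nmM nmV ltr_pdivrMr //.
by apply: (le_lt_trans k); rewrite ltr_pM2r //; lra.
Qed.

Lemma is_cd_eq g a d d' : is_cd g a d -> d = d' -> is_cd g a d'.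
Proof. by move=> + <-. Qed.

Lemma is_cd_tends g a d : is_cd g a d -> tends (fun h => g (a + h)) (g a).
Proof.
move=> [q hq Hq] e e0; have [dl d0 hd] := tendsM hq tends_id e0.
exists dl => // h /hd; rewrite Hq mulr0 subr0 /=.
by rewrite (_ : _ - _ = q h * h) //; ring.
Qed.

Lemma is_cd_local g f a d r : 0 < r -> (forall h, nm h < r -> f (a + h) = g (a + h)) ->
  is_cd g a d -> is_cd f a d.
Proof.
move=> r0 hr /is_cdP H; apply/is_cdP => e /H[dl d0 hd].
exists (Num.min r dl) => [|h]; first by rewrite lt_min r0.
rewrite lt_min => /andP[h1 h2]; rewrite hr //.
by have := hr 0; rewrite nm0 addr0 => -> //; apply: hd.
Qed.

Lemma is_cd_cst c a : is_cd (fun=> c) a 0.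
Proof. by exists (fun=> 0); [exact: tends_cst|move=> h; rewrite mul0r addr0]. Qed.

Lemma is_cd_id a : is_cd id a 1.
Proof. by exists (fun=> 1); [exact: tends_cst|move=> h; rewrite mul1r]. Qed.

Lemma is_cdD f g a d e : is_cd f a d -> is_cd g a e ->
  is_cd (fun z => f z + g z) a (d + e).
Proof.
move=> [p hp Hp] [q hq Hq]; exists (fun h => p h + q h); first exact: tendsD.
by move=> h; rewrite Hp Hq; ring.
Qed.

Lemma is_cdM f g a d e : is_cd f a d -> is_cd g a e ->
  is_cd (fun z => f z * g z) a (d * g a + f a * e).
Proof.
move=> hf hg; have := is_cd_tends hg; move: hf hg => [p hp Hp] [q hq Hq] hga.
exists (fun h => p h * g (a + h) + f a * q h).
  by apply: tendsD; apply: tendsM => //; exact: tends_cst.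
by move=> h; rewrite Hp Hq; ring.
Qed.

Lemma is_cd_conj f a d : is_cd f a^* d -> is_cd (fun z => (f z^*)^*) a d^*.
Proof.
move=> [p hp Hp]; exists (fun h => (p h^*)^*); first exact: tends_conj.
by move=> h; rewrite rmorphD Hp rmorphD rmorphM /= conjCK.
Qed.

Lemma is_cdV f a d : f a != 0 -> is_cd f a d ->
  is_cd (fun z => (f z)^-1) a (- d / f a ^+ 2).
Proof.
move=> fa0 hf; have hc := is_cd_tends hf; have [p hp Hp] := hf.
have [dl dl0 hd] := hc _ (nm_gt0 fa0).
have hx h : nm h < dl -> f (a + h) != 0.
  by move=> /hd; apply: contraTneq => ->; rewrite sub0r nmN ltxx.
have H1 : tends (fun h => - p h * ((f (a + h))^-1 / f a)) (- d / f a ^+ 2).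
  rewrite (_ : - d / f a ^+ 2 = -1 * d * ((f a)^-1 / f a)); last by rewrite expr2 invfM mulN1r.
  rewrite (_ : (fun h => _) = (fun h => (-1 * p h) * ((f (a + h))^-1 / f a))).
    exact: tendsM (tendsM (tends_cst _) hp) (tendsM (tendsV fa0 hc) (tends_cst _)).
  by apply: funext => h; rewrite mulN1r.
apply/is_cdP => e /H1[dl' dl'0 hd']; exists (Num.min dl dl') => [|h]; first by rewrite lt_min dl0.
rewrite lt_min => /andP[/hx h1 /hd' /ltW h2].
rewrite (_ : _ - _ = (- p h * ((f (a + h))^-1 / f a) - - d / f a ^+ 2) * h).
  by rewrite nmM ler_wpM2r ?nm_ge0.
have E : p h * h = f (a + h) - f a by rewrite Hp; ring.
rewrite mulrBl; congr (_ - _); rewrite mulrAC mulNr E; field; exact/andP.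
Qed.

Lemma cdiff_cst c a : cdiff (fun=> c) a. Proof. by exists 0; exact: is_cd_cst. Qed.
Lemma cdiff_id a : cdiff id a. Proof. by exists 1; exact: is_cd_id. Qed.
Lemma cdiffD f g a : cdiff f a -> cdiff g a -> cdiff (fun z => f z + g z) a.
Proof. by move=> [d hd] [e he]; exists (d + e); exact: is_cdD. Qed.
Lemma cdiffM f g a : cdiff f a -> cdiff g a -> cdiff (fun z => f z * g z) a.
Proof. by move=> [d hd] [e he]; eexists; exact: is_cdM hd he. Qed.
Lemma cdiffN f a : cdiff f a -> cdiff (fun z => - f z) a.
Proof.
move=> h; rewrite (_ : (fun _ => _) = (fun z => -1 * f z)).
  by apply: cdiffM => //; exact: cdiff_cst.
by apply: funext => z; rewrite mulN1r.
Qed.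
Lemma cdiffB f g a : cdiff f a -> cdiff g a -> cdiff (fun z => f z - g z) a.
Proof. by move=> hf hg; apply: cdiffD => //; exact: cdiffN. Qed.
Lemma cdiffX f a k : cdiff f a -> cdiff (fun z => f z ^+ k) a.
Proof.
move=> hf; elim: k => [|k IH].
  by rewrite (_ : (fun _ => _) = (fun=> 1)); [exact: cdiff_cst|apply: funext => z; rewrite expr0].
rewrite (_ : (fun _ => _) = (fun z => f z * f z ^+ k)); first exact: cdiffM.
by apply: funext => z; rewrite exprS.
Qed.
Lemma cdiffV f a : f a != 0 -> cdiff f a -> cdiff (fun z => (f z)^-1) a.
Proof. by move=> h [d hd]; eexists; exact: is_cdV h hd. Qed.
Lemma cdiff_conj f a : cdiff f a^* -> cdiff (fun z => (f z^*)^*) a.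
Proof. by move=> [d hd]; eexists; exact: is_cd_conj hd. Qed.
Lemma cdiff_sum (I : Type) (r : seq I) (P : pred I) (F : I -> C -> C) a :
  (forall i, P i -> cdiff (F i) a) -> cdiff (fun z => \sum_(i <- r | P i) F i z) a.
Proof.
move=> hF; elim: r => [|i r IH].
  by rewrite (_ : (fun _ => _) = (fun=> 0)); [exact: cdiff_cst|apply: funext => z; rewrite big_nil].
rewrite (_ : (fun _ => _) =
  (fun z => (if P i then F i z else 0) + \sum_(j <- r | P j) F j z)); last first.
  by apply: funext => z; rewrite big_cons; case: (P i); rewrite ?add0r.
apply: cdiffD => //; case hi: (P i); last exact: cdiff_cst.
exact: hF.
Qed.

Lemma cdiff_bounded g a : cdiff g a ->
  exists2 r, 0 < r & exists M, forall h, nm h < r -> nm (g (a + h)) <= M.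
Proof.
move=> [d /is_cd_tends hg]; have [r r0 hr] := hg 1 ltr01; exists r => //.
exists (nm (g a) + 1) => h /hr k.
have := nmD (g (a + h) - g a) (g a); rewrite subrK; lra.
Qed.

End Limits.

(** * Trapezoidal sums and a discrete Goursat lemma *)

Section Goursat.
Variable R : realType.
Local Notation C := (complex R).

Lemma realCD (x y : R) : (x + y)%:C%C = x%:C%C + y%:C%C :> C. Proof. exact: rmorphD. Qed.
Lemma realCM (x y : R) : (x * y)%:C%C = x%:C%C * y%:C%C :> C. Proof. exact: rmorphM. Qed.
Lemma realC_half (x : R) : (x / 2)%:C%C = x%:C%C / 2 :> C.
Proof. by rewrite realCM fmorphV rmorph_nat. Qed.

Lemma realCN (x : R) : (- x)%:C%C = - x%:C%C :> C. Proof. exact: rmorphN. Qed.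
Lemma realC0 : 0%:C%C = 0 :> C. Proof. by []. Qed.
Lemma realC1 : 1%:C%C = 1 :> C. Proof. by []. Qed.
Lemma nm2 : nm (2 : C) = 2.
Proof. by rewrite -[2 in LHS](rmorph_nat (real_complex R)) nm_real ger0_norm. Qed.

(* Trapezoidal sums on 2^n equal pieces take the place of contour integrals. *)
Fixpoint edge (g : C -> C) n (a b : C) : C :=
  if n is n'.+1 then edge g n' a ((a + b) / 2) + edge g n' ((a + b) / 2) b
  else (g a + g b) / 2 * (b - a).

(** Counterclockwise boundary of the square with corner [c] and side vector [u]. A complex [u]
    includes the rotated squares that surround a common corner. *)
Definition sq g n (c u : C) : C :=
  edge g n c (c + u) + edge g n (c + u) (c + u + 'i * u) +
  edge g n (c + u + 'i * u) (c + 'i * u) + edge g n (c + 'i * u) c.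

Lemma edgeN g n a b : edge g n b a = - edge g n a b.
Proof.
elim: n a b => [|n IH] a b /=; first by field.
by rewrite (addrC b a) (IH _ b) (IH a); ring.
Qed.

Lemma edge_lin f g k h n a b : (forall z, h z = f z + k * g z) ->
  edge h n a b = edge f n a b + k * edge g n a b.
Proof.
move=> E; elim: n a b => [|n IH] a b /=; first by rewrite !E; field.
by rewrite !IH; ring.
Qed.

(** The trapezoidal rule is exact on affine functions, at every depth. *)
Lemma edge_affine g p q n a b : (forall z, g z = p + q * z) ->
  edge g n a b = p * (b - a) + q * (b ^+ 2 - a ^+ 2) / 2.
Proof.
move=> E; elim: n a b => [|n IH] a b /=; first by rewrite !E; field.
by rewrite !IH; field.
Qed.

(** All nodes arise from the end points by taking midpoints, so a bound on a midpoint-closed set is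
    enough. *)
Lemma edge_bound (P : C -> Prop) g M n a b :
  (forall x y, P x -> P y -> P ((x + y) / 2)) -> (forall z, P z -> nm (g z) <= M) ->
  P a -> P b -> nm (edge g n a b) <= M * nm (b - a).
Proof.
move=> Pm PM; elim: n a b => [|n IH] a b Pa Pb /=.
  rewrite nmM ler_wpM2r ?nm_ge0 // nmM nmV.
  rewrite nm2 ler_pdivrMr //; have := nmD (g a) (g b); have := PM _ Pa; have := PM _ Pb; lra.
apply: le_trans (nmD _ _) _; have Pc := Pm _ _ Pa Pb.
apply: le_trans (lerD (IH _ _ Pa Pc) (IH _ _ Pc Pb)) _.
have -> : (a + b) / 2 - a = (b - a) / 2 by field.
have -> : b - (a + b) / 2 = (b - a) / 2 by field.
rewrite nmM nmV nm2; lra.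
Qed.

(** The recursion of [edge] is exactly the halving of a side, so the subdivision holds without error
    term and the inner edges cancel in pairs. *)
Lemma sqS g n c u : sq g n.+1 c u = sq g n c (u / 2) + sq g n (c + u / 2) (u / 2) +
  sq g n (c + 'i * (u / 2)) (u / 2) + sq g n (c + u / 2 + 'i * (u / 2)) (u / 2).
Proof.
rewrite /sq /=.
have -> : (c + (c + u)) / 2 = c + u / 2 by field.
have -> : (c + u + (c + u + 'i * u)) / 2 = c + u + 'i * (u / 2) by field.
have -> : (c + u + 'i * u + (c + 'i * u)) / 2 = c + u / 2 + 'i * u by field.
have -> : (c + 'i * u + c) / 2 = c + 'i * (u / 2) by field.
have -> : c + u / 2 + u / 2 = c + u by field.
have -> : c + 'i * (u / 2) + u / 2 = c + u / 2 + 'i * (u / 2) by field.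
have -> : c + u / 2 + 'i * (u / 2) + u / 2 = c + u + 'i * (u / 2) by field.
have -> : c + u / 2 + 'i * (u / 2) + 'i * (u / 2) = c + u / 2 + 'i * u by field.
have -> : c + u + 'i * (u / 2) + 'i * (u / 2) = c + u + 'i * u by field.
have -> : c + 'i * (u / 2) + 'i * (u / 2) = c + 'i * u by field.
rewrite (edgeN g n (c + u / 2 + 'i * (u / 2)) (c + u / 2)).
rewrite (edgeN g n (c + 'i * (u / 2)) (c + u / 2 + 'i * (u / 2))).
rewrite (edgeN g n (c + u / 2 + 'i * u) (c + u / 2 + 'i * (u / 2))).
rewrite (edgeN g n (c + u / 2 + 'i * (u / 2)) (c + u + 'i * (u / 2))).
by ring.
Qed.

Lemma sq_lin f g k h n c u : (forall z, h z = f z + k * g z) ->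
  sq h n c u = sq f n c u + k * sq g n c u.
Proof. by move=> E; rewrite /sq !(edge_lin _ _ _ E); ring. Qed.

Lemma sq_affine g p q n c u : (forall z, g z = p + q * z) -> sq g n c u = 0.
Proof. by move=> E; rewrite /sq !(edge_affine _ _ _ E); field. Qed.

Definition insq (c u z : C) := exists s t : R,
  [/\ 0 <= s <= 1, 0 <= t <= 1 & z = c + u * (s%:C%C + 'i * t%:C%C)].

Lemma insq_mid c u x y : insq c u x -> insq c u y -> insq c u ((x + y) / 2).
Proof.
move=> [s [t [/andP[s0 s1] /andP[t0 t1] ->]]] [s' [t' [/andP[s0' s1'] /andP[t0' t1'] ->]]].
exists ((s + s') / 2), ((t + t') / 2); split; [lra|lra|].
by rewrite !realC_half !realCD; field.
Qed.

Lemma sq_bound g M n c u : (forall z, insq c u z -> nm (g z) <= M) ->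
  nm (sq g n c u) <= 4 * (M * nm u).
Proof.
move=> hM.
have i0 : insq c u c by exists 0, 0; split; rewrite ?lexx ?ler01 // ?realC0 ?realC1; ring.
have i1 : insq c u (c + u) by exists 1, 0; split; rewrite ?lexx ?ler01 // ?realC0 ?realC1; ring.
have i2 : insq c u (c + u + 'i * u).
  by exists 1, 1; split; rewrite ?lexx ?ler01 // ?realC0 ?realC1; ring.
have i3 : insq c u (c + 'i * u) by exists 0, 1; split; rewrite ?lexx ?ler01 // ?realC0 ?realC1; ring.
have B a b v : insq c u a -> insq c u b -> nm v = nm u -> b - a = v ->
    nm (edge g n a b) <= M * nm u.
  by move=> ha hb <- <-; apply: edge_bound ha hb; [exact: insq_mid|].
have nI : nm ('i * u) = nm u by rewrite nmM nm_i mul1r.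
have b1 := B c (c + u) u i0 i1 erefl ltac:(ring).
have b2 := B (c + u) (c + u + 'i * u) ('i * u) i1 i2 nI ltac:(ring).
have b3 := B (c + u + 'i * u) (c + 'i * u) (- u) i2 i3 (nmN u) ltac:(ring).
have b4 := B (c + 'i * u) c (- ('i * u)) i3 i0 (etrans (nmN _) nI) ltac:(ring).
have E (a b d e : C) : nm (a + b + d + e) <= nm a + nm b + nm d + nm e.
  apply: le_trans (nmD _ _) _; rewrite lerD2r.
  by apply: le_trans (nmD _ _) _; rewrite lerD2r; exact: nmD.
apply: le_trans (E _ _ _ _) _; lra.
Qed.

Lemma nm4 (a b c d : C) : nm (a + b + c + d) <= nm a + nm b + nm c + nm d.
Proof.
apply: le_trans (nmD _ _) _; rewrite lerD2r.
by apply: le_trans (nmD _ _) _; rewrite lerD2r; exact: nmD.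
Qed.

(** Near a point [g] is affine up to a small multiple of the distance. The affine part contributes
    nothing, and the rest is at most [e * l ^+ 2] on a subsquare of relative side [l]. This bound
    adds up exactly over four quarters, as the bisection demands; passing to quarters costs one
    level of depth, hence the threshold [N]. *)
Lemma goursat g c u : (forall z, insq c u z -> cdiff g z) ->
  forall e, 0 < e -> exists N, forall n, (N <= n)%N -> nm (sq g n c u) <= e.
Proof.
move=> hg e e0.
pose cc (s t : R) := c + u * (s%:C%C + 'i * t%:C%C).
pose P s t (l : R) := exists N, forall n, (N <= n)%N ->
   nm (sq g n (cc s t) (u * l%:C%C)) <= e * l ^+ 2.
suff : P 0 0 1.
  move=> [N hN]; exists N => n /hN.
  have -> : cc 0 0 = c by rewrite /cc !realC0; ring.
  by rewrite realC1 expr1n !mulr1.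
apply: square_bisection.
  move=> s t l l0 [N1 h1] [N2 h2] [N3 h3] [N4 h4].
  exists (maxn (maxn N1 N2) (maxn N3 N4)).+1 => -[//|n]; rewrite ltnS !geq_max.
  move=> /andP[/andP[/h1 k1 /h2 k2] /andP[/h3 k3 /h4 k4]].
  rewrite sqS; have -> : u * l%:C%C / 2 = u * (l / 2)%:C%C by rewrite realC_half mulrA.
  have -> : cc s t + u * (l / 2)%:C%C = cc (s + l / 2) t by rewrite /cc realCD; ring.
  have -> : cc s t + 'i * (u * (l / 2)%:C%C) = cc s (t + l / 2) by rewrite /cc realCD; ring.
  have -> : cc (s + l / 2) t + 'i * (u * (l / 2)%:C%C) = cc (s + l / 2) (t + l / 2).
    by rewrite /cc !realCD; ring.
  by apply: le_trans (nm4 _ _ _ _) _; lra.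
move=> x y hx hy; have [d /is_cdP hd] : cdiff g (cc x y) by apply: hg; exists x, y.
(* The 8 is made of four sides of length [l * nm u] and the bound [2 * l * nm u] for the distance to
   [cc x y]; the 1 keeps [K] positive. *)
pose K := 8 * nm u ^+ 2 + 1.
have K0 : 0 < K by rewrite /K; have := sqr_ge0 (nm u); lra.
have [dl dl0 Hdl] := hd (e / K) (divr_gt0 e0 K0).
have U0 : 0 < 2 * nm u + 1 by have := nm_ge0 u; lra.
exists (dl / (2 * nm u + 1)); first exact: divr_gt0.
move=> s t l l0; rewrite ltr_pdivlMr // => ll /andP[x1 x2] /andP[y1 y2] s0 s1 t0 t1.
exists 0%N => n _.
pose er z := g z - (g (cc x y) - d * cc x y) - d * z.
have hE z : g z = er z + 1 * ((g (cc x y) - d * cc x y) + d * z) by rewrite /er; ring.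
rewrite (sq_lin _ _ _ hE).
rewrite (@sq_affine (fun z => (g (cc x y) - d * cc x y) + d * z) (g (cc x y) - d * cc x y) d) //.
rewrite mulr0 addr0.
have B z : insq (cc s t) (u * l%:C%C) z -> nm (er z) <= e / K * (nm u * (2 * l)).
  move=> [s' [t' [/andP[a1 a2] /andP[b1 b2] zE]]].
  have dz : z - cc x y = u * ((s + l * s' - x)%:C%C + 'i * (t + l * t' - y)%:C%C).
    by rewrite zE /cc !realCD !realCM !realCN; ring.
  have c1 : 0 <= l * s' <= l by rewrite mulr_ge0 ?ler_piMr //; exact: ltW.
  have c2 : 0 <= l * t' <= l by rewrite mulr_ge0 ?ler_piMr //; exact: ltW.
  have ndz : nm (z - cc x y) <= nm u * (2 * l).
    rewrite dz nmM ler_wpM2l ?nm_ge0 //.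
    apply: le_trans (nm_RI _ _) _.
    have : `|s + l * s' - x| <= l by rewrite ler_norml; lra.
    have : `|t + l * t' - y| <= l by rewrite ler_norml; lra.
    lra.
  have := Hdl (z - cc x y).
  have -> : cc x y + (z - cc x y) = z by ring.
  have -> : g z - g (cc x y) - d * (z - cc x y) = er z by rewrite /er; ring.
  have ek : 0 <= e / K by rewrite divr_ge0 // ltW.
  move=> H; apply: le_trans (H _) _; first by apply: le_lt_trans ndz _; lra.
  by rewrite ler_wpM2l.
apply: le_trans (sq_bound n B) _.
rewrite nmM nm_real (ger0_norm (ltW l0)).
have hK : e = e / K * K by rewrite divfK // gt_eqF.
rewrite [in X in _ <= X]hK /K; have : 0 <= e / K * l ^+ 2 by rewrite mulr_ge0 ?sqr_ge0 // divr_ge0 // ltW.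
rewrite -/K; set E := e / K; move=> h; rewrite /K.
suff -> : E * (8 * nm u ^+ 2 + 1) * l ^+ 2 = 4 * (E * (nm u * (2 * l)) * (nm u * l)) + E * l ^+ 2.
  by rewrite lerDl.
by ring.
Qed.

(** A bounded singularity at the corner is harmless. After [J] halvings only the quarter at [w]
    escapes [goursat], and its sum is at most a constant times its side [nm u / 2 ^+ J]. *)
Lemma sq_corner g w M r : 0 < r -> (forall z, nm (z - w) < r -> nm (g z) <= M) ->
  forall u, (forall z, insq w u z -> z != w -> cdiff g z) ->
  forall e, 0 < e -> exists N, forall n, (N <= n)%N -> nm (sq g n w u) <= e.
Proof.
move=> r0 hM.
have M0 : 0 <= M by apply: le_trans (hM w _); rewrite ?nm_ge0 // subrr nm0.
have key J : forall u, (forall z, insq w u z -> z != w -> cdiff g z) ->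
   forall e th, 0 < th -> (exists N, forall n, (N <= n)%N ->
     nm (sq g n w (u / 2 ^+ J)) <= e) ->
   exists N, forall n, (N <= n)%N -> nm (sq g n w u) <= e + J%:R * th.
  elim: J => [|J IH] u hu e th th0.
    by rewrite expr0 divr1 mul0r addr0.
  have sub z : insq w (u / 2) z -> insq w u z.
    move=> [s [t [hs ht ->]]]; exists (s / 2), (t / 2); split; [lra|lra|].
    by rewrite !realC_half; field.
  rewrite exprS invfM mulrA => /IH -/(_ (fun z h => hu z (sub z h)) th th0) [N0 h0].
  have u0 : u = 0 \/ u != 0 by case: eqVneq; [left|right].
  case: u0 => [uE|u0].
    exists 0%N => n _; rewrite uE /sq !mulr0 !addr0.
    have -> : edge g n w w = 0.
      apply: nm_eq0; apply/eqP; rewrite eq_le nm_ge0 andbT.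
      have := @edge_bound (fun z => z = w) g (nm (g w)) n w w.
      rewrite subrr nm0 mulr0; apply=> //; last by move=> z ->.
      by move=> x y -> ->; field.
    rewrite !addr0 nm0; have := h0 N0 (leqnn _); rewrite uE mul0r => /(le_trans (nm_ge0 _)).
    rewrite -natr1; lra.
  have th3 : 0 < th / 3 by lra.
  have i0 : 'i != 0 :> C by rewrite neq0Ci.
  have g1 (a b : R) : 0 <= a <= 1 -> 0 <= b <= 1 -> (0 < a) || (0 < b) ->
     exists N, forall n, (N <= n)%N ->
       nm (sq g n (w + u / 2 * (a%:C%C + 'i * b%:C%C)) (u / 2)) <= th / 3.
    move=> ha hb hab; apply: goursat => // z [s [t [hs ht zE]]].
    have zE' : z = w + u * (((a + s) / 2)%:C%C + 'i * ((b + t) / 2)%:C%C).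
      by rewrite zE !realC_half !realCD; field.
    apply: hu; first by exists ((a + s) / 2), ((b + t) / 2); split; [lra|lra|].
    rewrite zE' -subr_eq0 addrAC subrr add0r mulf_neq0 //.
    apply/eqP => h0'; have := congr1 (@complex.Re R) h0'; have := congr1 (@complex.Im R) h0'.
    rewrite ImRI ReRI /=; case/orP: hab; lra.
  have [N1 h1] := g1 1 0 ltac:(lra) ltac:(lra) ltac:(by rewrite ltr01).
  have [N2 h2] := g1 0 1 ltac:(lra) ltac:(lra) ltac:(by rewrite ltr01 orbT).
  have [N3 h3] := g1 1 1 ltac:(lra) ltac:(lra) ltac:(by rewrite ltr01).
  exists (maxn (maxn N0 N1) (maxn N2 N3)).+1 => -[//|n]; rewrite ltnS !geq_max.
  move=> /andP[/andP[/h0 k0 /h1 k1] /andP[/h2 k2 /h3 k3]].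
  rewrite sqS; apply: le_trans (nm4 _ _ _ _) _.
  move: k1 k2 k3; rewrite !realC1 !realC0 !mulr0 !addr0 !add0r !mulr1.
  rewrite mulrDr mulr1 addrA -!['i * _]mulrC => k1 k2 k3.
  rewrite -natr1; lra.
move=> u hu e e0.
pose B := 4 * (M * nm u); have B0 : 0 <= B by rewrite /B !mulr_ge0 ?nm_ge0.
(* The first bound puts the last corner square into the disc where [M] applies, the second brings
   its sum below [e / 2]. *)
have d0 : 0 < Num.min (r / (2 * nm u + 1)) (e / 2 / (B + 1)).
  have := nm_ge0 u; rewrite lt_min; move=> h; apply/andP; split; apply: divr_gt0; lra.
have [J hJ] := half_pow_small d0.
move: hJ; rewrite lt_min => /andP[j1 j2].
rewrite ltr_pdivlMr in j1; last by have := nm_ge0 u; lra.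
rewrite ltr_pdivlMr in j2; last by lra.
have nJ : nm (u / 2 ^+ J) = nm u * (2^-1) ^+ J.
  by rewrite nmM nmV nmX nm2 exprVn.
have J0 : 0 < (2^-1) ^+ J :> R by rewrite exprn_gt0 // invr_gt0.
have th0 : 0 < e / 2 / (J%:R + 1) by apply: divr_gt0; [lra|rewrite ltr_wpDl].
have := key J u hu (e / 2) _ th0; case.
  exists 0%N => n _.
  apply: (@le_trans _ _ (4 * (M * nm (u / 2 ^+ J)))).
    apply: sq_bound => z [s [t [/andP[s0 s1] /andP[t0 t1] ->]]]; apply: hM.
    rewrite addrAC subrr add0r nmM nJ.
    have b2 : nm (s%:C%C + 'i * t%:C%C) <= 2.
      by apply: le_trans (nm_RI _ _) _; rewrite !ger0_norm //; lra.
    apply: (@le_lt_trans _ _ (nm u * 2^-1 ^+ J * 2)).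
      by rewrite ler_wpM2l // mulr_ge0 ?nm_ge0 // ltW.
    by move: j1 J0; set x := _ ^+ J; move: (nm u) => v; lra.
  rewrite nJ; move: j2 J0; rewrite /B; set x := _ ^+ J; lra.
move=> N hN; exists N => n /hN h; apply: le_trans h _.
suff : J%:R * (e / 2 / (J%:R + 1)) <= e / 2 by lra.
rewrite mulrA ler_pdivrMr; last by rewrite ltr_wpDl.
by move: (J%:R : R) => j; lra.
Qed.

End Goursat.

(** * A crude Cauchy estimate *)

Section Cauchy.
Variable R : realType.
Local Notation C := (complex R).
Implicit Types (g h : C -> C) (w u z : C).

(** The two edges that do not meet the corner [w]. For [u], ['i * u], [- u], [- ('i * u)] they make
    up the boundary of a square centred at [w], while the edges through [w] cancel. *)
Definition outer g n w u :=
  edge g n (w + u) (w + u + 'i * u) + edge g n (w + u + 'i * u) (w + 'i * u).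

Lemma ii : 'i * 'i = -1 :> C. Proof. by rewrite -expr2 sqrCi. Qed.

Lemma four_quadrants g n w u :
  sq g n w u + sq g n w ('i * u) + sq g n w (- u) + sq g n w (- ('i * u)) =
  outer g n w u + outer g n w ('i * u) + outer g n w (- u) + outer g n w (- ('i * u)).
Proof.
rewrite /sq /outer.
have -> : 'i * ('i * u) = - u by rewrite mulrA ii mulN1r.
have -> : 'i * (- u) = - ('i * u) by rewrite mulrN.
have -> : 'i * - ('i * u) = u by rewrite mulrN mulrA ii mulN1r opprK.
rewrite (edgeN g n w (w + 'i * u)) (edgeN g n w (w - u)) (edgeN g n w (w - 'i * u)).
by rewrite (edgeN g n w (w + u)); ring.
Qed.

Lemma ReV (x y : R) : complex.Re ((x%:C%C + 'i * y%:C%C : C)^-1) = x / (x ^+ 2 + y ^+ 2).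
Proof.
by rewrite /= !(mul0r, mulr0, mul1r, subr0, sub0r, addr0, add0r).
Qed.

Lemma ImV (x y : R) : complex.Im ((x%:C%C + 'i * y%:C%C : C)^-1) = - (y / (x ^+ 2 + y ^+ 2)).
Proof.
by rewrite /= !(mul0r, mulr0, mul1r, subr0, sub0r, addr0, add0r).
Qed.

Lemma ImM_i (x : R) (z : C) : complex.Im ('i * x%:C%C * z) = x * complex.Re z.
Proof. by case: z => a b /=; ring. Qed.

Lemma ImM_r (x : R) (z : C) : complex.Im (x%:C%C * z) = x * complex.Im z.
Proof. by case: z => a b /=; ring. Qed.

Lemma ImD (a b : C) : complex.Im (a + b) = complex.Im a + complex.Im b.
Proof. by case: a; case: b. Qed.
Lemma ReD (a b : C) : complex.Re (a + b) = complex.Re a + complex.Re b.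
Proof. by case: a; case: b. Qed.

Lemma inv_half (s : R) : 0 <= s <= 1 -> 2^-1 <= 1 / (1 + s ^+ 2).
Proof.
move=> /andP[s0 s1]; rewrite div1r lef_pV2 ?posrE //; have := sqr_ge0 s; last by lra.
by have := mulr_ile1 s0 s0 s1 s1; rewrite -expr2; lra.
Qed.

(** The winding number enters only through a lower bound: with [z = w + u (1 + i x)] the form
    [dz / (z - w)] has imaginary part [dx / (1 + x ^ 2)], at least [dx / 2] on the unit interval,
    and trapezoidal sums inherit this. *)
Lemma edge_inv1 n w u (s t : R) : u != 0 -> 0 <= s -> s <= t -> t <= 1 ->
  (t - s) / 2 <= complex.Im (edge (fun z => (z - w)^-1) n
     (w + u * (1 + 'i * s%:C%C)) (w + u * (1 + 'i * t%:C%C))).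
Proof.
move=> u0; elim: n s t => [|n IH] s t s0 st t1 /=.
  have E (x : R) : (w + u * (1 + 'i * x%:C%C) - w)^-1 = u^-1 * (1%:C%C + 'i * x%:C%C)^-1.
    by rewrite addrAC subrr add0r invfM realC1.
  rewrite !E.
  have -> : w + u * (1 + 'i * t%:C%C) - (w + u * (1 + 'i * s%:C%C)) = u * ('i * (t - s)%:C%C).
    by rewrite realCD realCN; ring.
  set p := (1%:C%C + 'i * s%:C%C)^-1; set q := (1%:C%C + 'i * t%:C%C)^-1.
  have -> : (u^-1 * p + u^-1 * q) / 2 * (u * ('i * (t - s)%:C%C)) = 'i * ((t - s) / 2)%:C%C * (p + q).
    by rewrite realC_half; field.
  rewrite ImM_i ReD !ReV expr1n.
  have h1 := @inv_half s ltac:(lra); have h2 := @inv_half t ltac:(lra).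
  rewrite -[X in X <= _]mulr1; apply: ler_wpM2l; lra.
have -> : (w + u * (1 + 'i * s%:C%C) + (w + u * (1 + 'i * t%:C%C))) / 2 =
    w + u * (1 + 'i * ((s + t) / 2)%:C%C) by rewrite realC_half realCD; field.
rewrite ImD; have := IH s ((s + t) / 2) s0; have := IH ((s + t) / 2) t; lra.
Qed.

Lemma edge_inv2 n w u (s t : R) : u != 0 -> 0 <= s -> s <= t -> t <= 1 ->
  (t - s) / 2 <= complex.Im (edge (fun z => (z - w)^-1) n
     (w + u * (t%:C%C + 'i)) (w + u * (s%:C%C + 'i))).
Proof.
move=> u0; elim: n s t => [|n IH] s t s0 st t1 /=.
  have E (x : R) : (w + u * (x%:C%C + 'i) - w)^-1 = u^-1 * (x%:C%C + 'i * 1%:C%C)^-1.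
    by rewrite addrAC subrr add0r invfM realC1 mulr1.
  rewrite !E.
  have -> : w + u * (s%:C%C + 'i) - (w + u * (t%:C%C + 'i)) = - (u * (t - s)%:C%C).
    by rewrite realCD realCN; ring.
  set p := (t%:C%C + 'i * _)^-1; set q := (s%:C%C + 'i * _)^-1.
  have -> : (u^-1 * p + u^-1 * q) / 2 * (- (u * (t - s)%:C%C)) = (- ((t - s) / 2))%:C%C * (p + q).
    by rewrite realCN realC_half; field.
  rewrite ImM_r ImD !ImV expr1n.
  have h1 := @inv_half s ltac:(lra); have h2 := @inv_half t ltac:(lra).
  rewrite (addrC (t ^+ 2)) (addrC (s ^+ 2)) -opprD mulrNN.
  rewrite -[X in X <= _]mulr1; apply: ler_wpM2l; lra.
have -> : (w + u * (t%:C%C + 'i) + (w + u * (s%:C%C + 'i))) / 2 =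
    w + u * (((s + t) / 2)%:C%C + 'i) by rewrite realC_half realCD; field.
rewrite ImD; have := IH s ((s + t) / 2) s0; have := IH ((s + t) / 2) t; lra.
Qed.

(** A quarter turn: the sums approximate [pi / 2] in the imaginary part. The coarser bound 1 is the
    source of the factor 2 in [cauchy_bound]. *)
Lemma outer_inv n w u : u != 0 -> 1 <= complex.Im (outer (fun z => (z - w)^-1) n w u).
Proof.
move=> u0; rewrite /outer ImD.
have := @edge_inv1 n w u 0 1 u0 (lexx _) ler01 (lexx _).
have := @edge_inv2 n w u 0 1 u0 (lexx _) ler01 (lexx _).
rewrite realC0 realC1 mulr0 addr0 add0r !mulr1 mulrDr mulr1.
by rewrite [u * 'i]mulrC addrA; lra.
Qed.

Lemma outer_lin (f g h : C -> C) k n w u : (forall z, h z = f z + k * g z) ->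
  outer h n w u = outer f n w u + k * outer g n w u.
Proof. by move=> E; rewrite /outer !(edge_lin _ _ _ E); ring. Qed.

Lemma outer_bound g M n w u :
  (forall z, nm u <= nm (z - w) <= 2 * nm u -> nm (g z) <= M) ->
  nm (outer g n w u) <= 2 * (M * nm u).
Proof.
move=> hM; apply: le_trans (nmD _ _) _.
have nI : nm ('i * u) = nm u by rewrite nmM nm_i mul1r.
pose P1 z := exists2 t : R, 0 <= t <= 1 & z = w + u * (1 + 'i * t%:C%C).
pose P2 z := exists2 t : R, 0 <= t <= 1 & z = w + u * (t%:C%C + 'i).
have m1 x y : P1 x -> P1 y -> P1 ((x + y) / 2).
  move=> [s hs ->] [t ht ->]; exists ((s + t) / 2); first by lra.
  by rewrite realC_half realCD; field.
have m2 x y : P2 x -> P2 y -> P2 ((x + y) / 2).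
  move=> [s hs ->] [t ht ->]; exists ((s + t) / 2); first by lra.
  by rewrite realC_half realCD; field.
have b1 z : P1 z -> nm (g z) <= M.
  move=> [t ht ->]; apply: hM; rewrite addrAC subrr add0r nmM.
  have l1 : 1 <= nm (1 + 'i * t%:C%C).
    by have := Re_le_nm (1%:C%C + 'i * t%:C%C); rewrite ReRI normr1.
  have l2 : nm (1 + 'i * t%:C%C) <= 2.
    by have := nm_RI 1 t; rewrite normr1 realC1 ger0_norm; lra.
  have u0 := nm_ge0 u; rewrite mulrC; apply/andP; split.
    by rewrite ler_peMl.
  by rewrite ler_wpM2r.
have b2 z : P2 z -> nm (g z) <= M.
  move=> [t ht ->]; apply: hM; rewrite addrAC subrr add0r nmM.
  have l1 : 1 <= nm (t%:C%C + 'i).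
    by have := Im_le_nm (t%:C%C + 'i * 1%:C%C); rewrite ImRI normr1 realC1 mulr1.
  have l2 : nm (t%:C%C + 'i) <= 2.
    by have := nm_RI t 1; rewrite normr1 realC1 mulr1 ger0_norm; lra.
  have u0 := nm_ge0 u; rewrite mulrC; apply/andP; split.
    by rewrite ler_peMl.
  by rewrite ler_wpM2r.
have p0 : P1 (w + u) by exists 0; [lra|rewrite realC0; ring].
have p1 : P1 (w + u + 'i * u) by exists 1; [lra|rewrite realC1; ring].
have q1 : P2 (w + u + 'i * u) by exists 1; [lra|rewrite realC1; ring].
have q0 : P2 (w + 'i * u) by exists 0; [lra|rewrite realC0; ring].
have := edge_bound n m1 b1 p0 p1; have := edge_bound n m2 b2 q1 q0.
have -> : w + u + 'i * u - (w + u) = 'i * u by ring.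
have -> : w + 'i * u - (w + u + 'i * u) = - u by ring.
rewrite nmN nI; lra.
Qed.

(** The quotient [(h z - h w) / (z - w)] is bounded at [w], so its sums around [w] become small.
    Hence the boundary sum of [h z / (z - w)], of modulus at most [8 * M], is nearly [h w] times
    that of [1 / (z - w)], of modulus at least 4. *)
Lemma cauchy_bound h w (a M : R) : 0 < a ->
  (forall z, nm (z - w) <= 2 * a -> cdiff h z) ->
  (forall z, a <= nm (z - w) <= 2 * a -> nm (h z) <= M) -> nm (h w) <= 2 * M.
Proof.
move=> a0 hd hM.
(* With [0^-1 = 0] the quotient [k] takes the value 0 at [w]; only its boundedness matters there. *)
pose v z := (z - w)^-1; pose k z := (h z - h w) / (z - w).
pose hv z := h z / (z - w).
have kE z : k z = hv z + (- h w) * v z by rewrite /k /hv /v; ring.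
have M0 : 0 <= M.
  apply: le_trans (hM (w + a%:C%C) _); rewrite ?nm_ge0 //.
  by rewrite addrAC subrr add0r nm_real gtr0_norm //; lra.
pose u : C := a%:C%C.
have nu : nm u = a by rewrite nm_real gtr0_norm.
have un0 : u != 0 by apply: contraTneq a0 => E; rewrite -nu E nm0 ltxx.
have [d hdw] : cdiff h w by apply: hd; rewrite subrr nm0; lra.
have [r r0 hr] : exists2 r, 0 < r & forall z, nm (z - w) < r -> nm (k z) <= nm d + 1.
  have [q hq Hq] := hdw; have [r r0 hr] := hq _ ltr01; exists r => // z /hr hz.
  rewrite /k; have [->|zw] := eqVneq z w.
    by rewrite subrr mul0r nm0; have := nm_ge0 d; lra.
  have := Hq (z - w); rewrite addrC subrK => ->.
  rewrite addrAC subrr add0r mulfK ?subr_eq0 //.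
  by have := nmD (q (z - w) - d) d; rewrite subrK; lra.
have kd u' : nm u' = a -> forall z, insq w u' z -> z != w -> cdiff k z.
  move=> nu' z [s [t [/andP[s0 s1] /andP[t0 t1] zE]]] zw.
  apply: cdiffM; last by apply: cdiffV; [rewrite subr_eq0|apply: cdiffB; [exact: cdiff_id|exact: cdiff_cst]].
  apply: cdiffB; last exact: cdiff_cst.
  apply: hd; rewrite zE addrAC subrr add0r nmM nu' mulrC ler_wpM2r ?(ltW a0) //.
  by apply: le_trans (nm_RI _ _) _; rewrite !ger0_norm //; lra.
have nI : nm ('i * u) = a by rewrite nmM nm_i mul1r.
rewrite leNgt; apply/negP => hlt.
(* Four errors [e] amount to half of the excess [4 * (nm (h w) - 2 * M)], which gives the
   contradiction. *)
pose e := (nm (h w) - 2 * M) / 2.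
have e0 : 0 < e by rewrite /e; lra.
have [N1 h1] := sq_corner r0 hr (kd u nu) e0.
have [N2 h2] := sq_corner r0 hr (kd _ nI) e0.
have [N3 h3] := sq_corner r0 hr (kd (- u) (etrans (nmN _) nu)) e0.
have [N4 h4] := sq_corner r0 hr (kd (- ('i * u)) (etrans (nmN _) nI)) e0.
pose n := (N1 + N2 + N3 + N4)%N.
have k1 := h1 n ltac:(by rewrite /n -!addnA leq_addr).
have k2 := h2 n ltac:(by rewrite /n -addnA addnAC leq_addl).
have k3 := h3 n ltac:(by rewrite /n addnAC leq_addl).
have k4 := h4 n ltac:(by rewrite /n leq_addl).
have K := nm4 (sq k n w u) (sq k n w ('i * u)) (sq k n w (- u)) (sq k n w (- ('i * u))).
move: K; rewrite four_quadrants !(outer_lin _ _ _ kE).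
set B1 := outer v n w u; set B2 := outer v n w ('i * u).
set B3 := outer v n w (- u); set B4 := outer v n w (- ('i * u)).
set A1 := outer hv n w u; set A2 := outer hv n w ('i * u).
set A3 := outer hv n w (- u); set A4 := outer hv n w (- ('i * u)) => K.
have b1 : 1 <= complex.Im B1 by exact: outer_inv.
have b2 : 1 <= complex.Im B2 by apply: outer_inv; rewrite mulf_neq0 ?neq0Ci.
have b3 : 1 <= complex.Im B3 by apply: outer_inv; rewrite oppr_eq0.
have b4 : 1 <= complex.Im B4 by apply: outer_inv; rewrite oppr_eq0 mulf_neq0 ?neq0Ci.
have B : 4 <= nm (B1 + B2 + B3 + B4).
  have := Im_le_nm (B1 + B2 + B3 + B4).
  rewrite (ImD (B1 + B2 + B3)) (ImD (B1 + B2)) (ImD B1) ger0_norm; lra.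
have HA u' : nm u' = a -> nm (outer hv n w u') <= 2 * M.
  move=> nu'; have := @outer_bound hv (M / a) n w u'; rewrite nu' divfK ?gt_eqF // => -> //.
  move=> z hz; rewrite nmM nmV.
  rewrite ler_pdivrMr; last by lra.
  apply: le_trans (hM z hz) _; rewrite mulrAC ler_pdivlMr // ler_wpM2l //; lra.
have A : nm (A1 + A2 + A3 + A4) <= 8 * M.
  apply: le_trans (nm4 _ _ _ _) _.
  have := HA _ nu; have := HA _ nI; have := HA (- u) (etrans (nmN _) nu).
  have := HA (- ('i * u)) (etrans (nmN _) nI); rewrite -/A1 -/A2 -/A3 -/A4; lra.
have E : h w * (B1 + B2 + B3 + B4) = (A1 + A2 + A3 + A4) -
   (A1 + - h w * B1 + (A2 + - h w * B2) + (A3 + - h w * B3) + (A4 + - h w * B4)) by ring.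
have := congr1 (@nm R) E; rewrite nmM => E'.
have hB : nm (h w) * 4 <= nm (h w) * nm (B1 + B2 + B3 + B4) by rewrite ler_wpM2l ?nm_ge0.
have := nmDB (A1 + A2 + A3 + A4)
   (A1 + - h w * B1 + (A2 + - h w * B2) + (A3 + - h w * B3) + (A4 + - h w * B4)).
rewrite /e in k1 k2 k3 k4; lra.
Qed.

End Cauchy.

(** * Identity theorems in one variable *)

Section Identity.
Variable R : realType.
Local Notation C := (complex R).
Implicit Types (g : C -> C) (c w u z : C).

Lemma cdiff_local g (f : C -> C) (a : C) (r : R) : 0 < r -> (forall h, nm h < r -> f (a + h) = g (a + h)) ->
  cdiff g a -> cdiff f a.
Proof. by move=> r0 hr [d hd]; exists d; exact: is_cd_local r0 hr hd. Qed.

(** Differentiability gives local bounds, and bisection replaces compactness: a bound on each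
    quarter gives one on the square. *)
Lemma bounded_on_square g c u : (forall z, insq c u z -> cdiff g z) ->
  exists M, forall z, insq c u z -> nm (g z) <= M.
Proof.
move=> hg; pose cc (s t : R) := c + u * (s%:C%C + 'i * t%:C%C).
pose P s t (l : R) := exists M, forall s' t', s <= s' <= s + l -> t <= t' <= t + l ->
  nm (g (cc s' t')) <= M.
suff [M hM] : P 0 0 1.
  exists M => z [s [t [hs ht ->]]]; apply: hM; lra.
apply: square_bisection.
  move=> s t l l0 [M1 h1] [M2 h2] [M3 h3] [M4 h4].
  exists (Num.max (Num.max M1 M2) (Num.max M3 M4)) => s' t' hs ht.
  have [a1|/ltW a1] := lerP s' (s + l / 2); have [a2|/ltW a2] := lerP t' (t + l / 2);
    rewrite !le_max.
  - by rewrite h1 //; lra.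
  - by rewrite h3 ?orbT //; lra.
  - by rewrite h2 ?orbT //; lra.
  - by rewrite h4 ?orbT //; lra.
move=> x y hx hy; have [r r0 [M hM]] : exists2 r, 0 < r &
    exists M, forall h, nm h < r -> nm (g (cc x y + h)) <= M.
  by apply: cdiff_bounded; apply: hg; exists x, y.
have U0 : 0 < 2 * nm u + 1 by have := nm_ge0 u; lra.
exists (r / (2 * nm u + 1)) => [|s t l l0]; first exact: divr_gt0.
rewrite ltr_pdivlMr // => hl hxs hyt _ _ _ _.
exists M => s' t' hs ht.
have -> : cc s' t' = cc x y + u * ((s' - x)%:C%C + 'i * (t' - y)%:C%C).
  by rewrite /cc !realCD !realCN; ring.
apply: hM; rewrite nmM.
have b : nm ((s' - x)%:C%C + 'i * (t' - y)%:C%C) <= 2 * l.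
  apply: le_trans (nm_RI _ _) _.
  have : `|s' - x| <= l by rewrite ler_norml; lra.
  have : `|t' - y| <= l by rewrite ler_norml; lra.
  lra.
by apply: le_lt_trans (ler_wpM2l (nm_ge0 u) b) _; lra.
Qed.

(* The Cauchy estimate applied to [g z / (z - c) ^+ k] on a square centred at [w] gives
   [|g w| <= 2 M (2/3)^k] for all k. *)
Lemma cdiff_continuation g c w (e : R) : 0 < e -> (forall z, nm (z - c) < e -> g z = 0) ->
  nm (w - c) <= 2 -> (forall z, nm (z - w) <= 20 -> cdiff g z) -> g w = 0.
Proof.
move=> e0 gc hwc hd.
have [->|wc] := eqVneq w c; first by apply: gc; rewrite subrr nm0.
have [M hM] : exists M, forall z, nm (z - w) <= 10 -> nm (g z) <= M.
  (* The square of half side 10 contains the disc of radius 10 and lies in the disc of radius 20;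
     this is the 20 of the hypothesis. *)
  have [|M hM] := @bounded_on_square g (w - 10%:R%:C%C - 'i * 10%:R%:C%C) 20%:R%:C%C.
    move=> z [s [t [/andP[s0 s1] /andP[t0 t1] ->]]]; apply: hd.
    have -> : w - 10%:R%:C%C - 'i * 10%:R%:C%C + 20%:R%:C%C * (s%:C%C + 'i * t%:C%C) - w =
       (20 * s - 10)%:C%C + 'i * (20 * t - 10)%:C%C by rewrite !realCD !realCM !realCN; ring.
    apply: le_trans (nm_RI _ _) _.
    have : `|20 * s - 10| <= 10 by rewrite ler_norml; lra.
    have : `|20 * t - 10| <= 10 by rewrite ler_norml; lra.
    lra.
  exists M => z hz; apply: hM.
  have := Re_le_nm (z - w); have := Im_le_nm (z - w).
  set x := complex.Re (z - w); set y := complex.Im (z - w) => hy hx.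
  exists ((x + 10) / 20), ((y + 10) / 20).
  have hx' := le_trans hx hz; have hy' := le_trans hy hz.
  move: hx' hy'; rewrite !ler_norml => /andP[x1 x2] /andP[y1 y2].
  split; [lra|lra|].
  have E : z = w + (x%:C%C + 'i * y%:C%C) by rewrite -complexRI; ring.
  have T (v : R) : 20%:R%:C%C * ((v + 10) / 20)%:C%C = v%:C%C + 10%:R%:C%C :> C.
    by rewrite -realCM -realCD; congr (_%:C)%C; field.
  rewrite {1}E mulrDr [20%:R%:C%C * ('i * _)]mulrCA !T; ring.
have M0 : 0 <= M by apply: le_trans (hM w _); rewrite ?nm_ge0 // subrr nm0.
(* For [nm (z - w) >= 5] one has [nm (z - c) >= 3], against [nm (w - c) <= 2]: hence the ratio
   2/3. *)
have key k : nm (g w) <= 2 * M * (2 / 3) ^+ k.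
  pose h z := g z * (z - c)^-1 ^+ k.
  (* The pole at [c] is invisible, since [g] vanishes in a whole disc around it. *)
  have hcd z : nm (z - w) <= 2 * 5 -> cdiff h z.
    move=> hz; have [zc|cz] := ltrP (nm (z - c)) e.
      apply: (@cdiff_local (fun=> 0) h z (e - nm (z - c))); [lra| |exact: cdiff_cst].
      move=> v hv; rewrite /h gc ?mul0r //.
      have -> : z + v - c = (z - c) + v by ring.
      by apply: le_lt_trans (nmD _ _) _; lra.
    have zc : z != c by apply: contraTneq cz => ->; rewrite subrr nm0 -ltNge.
    apply: cdiffM; first by apply: hd; lra.
    apply: cdiffX; apply: cdiffV; first by rewrite subr_eq0.
    by apply: cdiffB; [exact: cdiff_id|exact: cdiff_cst].
  have hb z : 5 <= nm (z - w) <= 2 * 5 -> nm (h z) <= M * 3^-1 ^+ k.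
    move=> /andP[z1 z2]; rewrite /h nmM nmX nmV.
    have z3 : 3 <= nm (z - c).
      have := nmD (z - c) (c - w); rewrite [nm (c - w)]nmB.
      have -> : z - c + (c - w) = z - w by ring.
      lra.
    apply: ler_pM; rewrite ?exprn_ge0 ?invr_ge0 ?nm_ge0 //; first by apply: hM; lra.
    apply: lerXn2r; rewrite ?nnegrE ?invr_ge0 ?nm_ge0 //.
    by rewrite lef_pV2 ?posrE //; lra.
  have := @cauchy_bound _ h w 5 _ ltac:(lra) hcd hb.
  have n0 : 0 < nm (w - c) by apply: nm_gt0; rewrite subr_eq0.
  rewrite /h nmM nmX nmV [(nm (w - c))^-1 ^+ k]exprVn ler_pdivrMr ?exprn_gt0 // => H.
  apply: le_trans H _; rewrite -!mulrA ler_wpM2l // ler_wpM2l // exprMn mulrC.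
  rewrite ler_wpM2r ?exprn_ge0 ?invr_ge0 //.
  by apply: lerXn2r; rewrite ?nnegrE // nm_ge0.
apply: nm_eq0; apply/eqP; rewrite eq_le nm_ge0 andbT leNgt; apply/negP => h.
have h' : 0 < nm (g w) / (2 * M + 1) by apply: divr_gt0 => //; lra.
have [k hk] := half_pow_small h'; rewrite ltr_pdivlMr in hk; last by lra.
(* Even exponents, because 4/9 is below 1/2 and the powers of 1/2 are known to become small. *)
have := key (2 * k)%N; rewrite exprM.
have hp : ((2 / 3) ^+ 2) ^+ k <= 2^-1 ^+ k :> R.
  by apply: lerXn2r; rewrite ?nnegrE ?exprn_ge0 ?divr_ge0 ?invr_ge0 //; rewrite expr2; lra.
have : 0 <= 2^-1 ^+ k :> R by rewrite exprn_ge0 // invr_ge0.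
have := ler_wpM2l (_ : 0 <= 2 * M) hp => /(_ ltac:(lra)).
move: hk; set A := 2^-1 ^+ k; set B := (_ ^+ 2) ^+ k; lra.
Qed.

(** The continuation needs a disc of radius 20 around a point of modulus 1; 30 leaves a margin, and
    later curves are estimated for [nm l < 30] for this reason. *)
Lemma zero_on_disc g (e : R) : 0 < e -> (forall z, nm z < e -> g z = 0) ->
  (forall z, nm z < 30 -> cdiff g z) -> g 1 = 0.
Proof.
move=> e0 g0 hd; apply: (@cdiff_continuation g 0 1 e e0).
- by move=> z; rewrite subr0; exact: g0.
- by rewrite subr0 nm1; lra.
- move=> z hz; apply: hd; have := nmD (z - 1) 1; rewrite subrK nm1; lra.
Qed.

(* Extended by zero to the lower half plane, [g] stays complex differentiable, because its
   derivative vanishes along the real axis. *)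
Lemma zero_on_reals g : (forall x : R, nm x%:C%C < 30 -> g x%:C%C = 0) ->
  (forall z, nm z < 30 -> cdiff g z) -> g 'i = 0.
Proof.
move=> g0 hd.
pose f z := if 0 < complex.Im z then g z else 0.
have -> : g 'i = f 'i by rewrite /f /= ltr01.
(* The disc of radius 1 around [- 'i] lies in the lower half plane, where [f] is 0, and its centre
   is at the admissible distance 2 from ['i]. *)
apply: (@cdiff_continuation f (- 'i) 'i 1 ltr01).
- move=> z hz; rewrite /f ltNge; suff -> : complex.Im z <= 0 by [].
  have := le_lt_trans (Im_le_nm _) hz; rewrite opprK ImD /= ltr_norml; lra.
- by rewrite opprK; apply: le_trans (nmD _ _) _; rewrite nm_i; lra.
move=> z hz; have {}hz : nm z < 30.
  by have := nmD (z - 'i) 'i; rewrite subrK nm_i; lra.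
have [zp|zn|z0] := ltrgtP 0 (complex.Im z).
- apply: (@cdiff_local g f z _ zp); last exact: hd.
  move=> h hh; rewrite /f ImD ifT //.
  by have := le_lt_trans (Im_le_nm _) hh; rewrite ltr_norml; lra.
- have zn' : 0 < - complex.Im z by lra.
  apply: (@cdiff_local (fun=> 0) f z _ zn'); last exact: cdiff_cst.
  move=> h hh; rewrite /f ImD ifF //; apply/negbTE; rewrite -leNgt.
  by have := le_lt_trans (Im_le_nm _) hh; rewrite ltr_norml; lra.
have zE : z = (complex.Re z)%:C%C.
  by rewrite [LHS]complexRI -z0 realC0 mulr0 addr0.
move: (complex.Re z) zE => x zE.
have [d hgd] := hd _ hz.
have gz : g z = 0 by rewrite zE g0 // -zE.
have d0 : d = 0.
  apply: contrapT => /eqP/nm_gt0 dn; have [q hq Hq] := hgd.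
  have [r r0 hr] := hq _ dn.
  pose y := Num.min (r / 2) ((30 - nm z) / 2).
  have y0 : 0 < y by rewrite /y lt_min; apply/andP; split; lra.
  have y1 : y <= r / 2 by rewrite /y ge_min lexx.
  have y2 : y <= (30 - nm z) / 2 by rewrite /y ge_min lexx orbT.
  have ny : nm y%:C%C = y by rewrite nm_real gtr0_norm.
  have yn : y%:C%C != 0 :> C by apply/eqP => E; move: ny; rewrite E nm0; lra.
  have := Hq y%:C%C; rewrite {1}zE -realCD g0; last first.
    by rewrite realCD -zE; have := nmD z y%:C%C; rewrite ny; lra.
  rewrite gz add0r => /esym/eqP; rewrite mulf_eq0 (negbTE yn) orbF => /eqP qy.
  by have := hr y%:C%C; rewrite ny qy sub0r nmN ltxx => h; have : false by apply: h; lra.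
exists 0; apply/is_cdP => e e0; move/is_cdP: hgd => /(_ e e0)[dl dl0 hdl].
exists dl => // h /hdl; rewrite d0 gz /f mul0r !subr0 -z0 ltxx subr0.
by case: ifP => // _ _; rewrite nm0 mulr_ge0 ?nm_ge0 // ltW.
Qed.

(** Bisection in place of the mean value theorem: the oscillation on a square of relative side [l]
    is at most [e * l]. Two points are compared through the common corner of the four quarters, each
    at the cost [e * (l / 2)]. *)
Lemma zero_derivative g (r : R) : 0 < r -> (forall z, nm z < r -> is_cd g z 0) ->
  forall z, nm z <= r / 4 -> g z = g 0.
Proof.
move=> r0 hg.
pose rho : R := r / 4.
pose cc (s t : R) : C := (2 * rho * s - rho)%:C%C + 'i * (2 * rho * t - rho)%:C%C.
have rho0 : 0 < rho by rewrite /rho; lra.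
have key e : 0 < e -> forall s t s' t', 0 <= s <= 1 -> 0 <= t <= 1 -> 0 <= s' <= 1 ->
   0 <= t' <= 1 -> nm (g (cc s t) - g (cc s' t')) <= e.
  move=> e0; pose P s t (l : R) := forall s1 t1 s2 t2, s <= s1 <= s + l -> t <= t1 <= t + l ->
    s <= s2 <= s + l -> t <= t2 <= t + l -> nm (g (cc s1 t1) - g (cc s2 t2)) <= e * l.
  suff H : P 0 0 1 by move=> s t s' t' *; rewrite -[e]mulr1; apply: H; lra.
  apply: square_bisection.
    move=> s t l l0 h1 h2 h3 h4 s1 t1 s2 t2 a1 b1 a2 b2.
    have mid s' t' : s <= s' <= s + l -> t <= t' <= t + l ->
       nm (g (cc s' t') - g (cc (s + l / 2) (t + l / 2))) <= e * (l / 2).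
      move=> a b.
      have [c1|/ltW c1] := lerP s' (s + l / 2); have [c2|/ltW c2] := lerP t' (t + l / 2).
      - by apply: h1; lra.
      - by apply: h3; lra.
      - by apply: h2; lra.
      - by apply: h4; lra.
    have := mid _ _ a1 b1; have := mid _ _ a2 b2; rewrite nmB.
    set m := g (cc (_ + _) _) => k1 k2.
    have := nmD (g (cc s1 t1) - m) (m - g (cc s2 t2)).
    have -> : g (cc s1 t1) - m + (m - g (cc s2 t2)) = g (cc s1 t1) - g (cc s2 t2) by ring.
    lra.
  move=> x y hx hy.
  have hc : nm (cc x y) < r.
    apply: le_lt_trans (nm_RI _ _) _.
    have : `|2 * rho * x - rho| <= rho.
      have : 0 <= rho * x <= rho by rewrite mulr_ge0 ?ler_piMr ?(ltW rho0) //; lra.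
      by rewrite ler_norml; lra.
    have : `|2 * rho * y - rho| <= rho.
      have : 0 <= rho * y <= rho by rewrite mulr_ge0 ?ler_piMr ?(ltW rho0) //; lra.
      by rewrite ler_norml; lra.
    rewrite /rho; lra.
  have E0 : 0 < e / (8 * rho) by apply: divr_gt0 => //; lra.
  have /is_cdP/(_ _ E0)[dl dl0 hdl] := hg _ hc.
  exists (dl / (4 * rho)) => [|s t l l0 hl hxs hyt _ _ _ _]; first by apply: divr_gt0; lra.
  rewrite ltr_pdivlMr in hl; last by lra.
  have loc s' t' : s <= s' <= s + l -> t <= t' <= t + l ->
      nm (g (cc s' t') - g (cc x y)) <= e / 2 * l.
    move=> hs ht; pose h : C := (2 * rho * (s' - x))%:C%C + 'i * (2 * rho * (t' - y))%:C%C.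
    have hE : cc s' t' = cc x y + h.
      rewrite /cc /h.
      have -> : 2 * rho * s' - rho = 2 * rho * x - rho + 2 * rho * (s' - x) by ring.
      have -> : 2 * rho * t' - rho = 2 * rho * y - rho + 2 * rho * (t' - y) by ring.
      by rewrite !(realCD (_ - rho)); ring.
    have nh : nm h <= 4 * rho * l.
      have nrho v : `|2 * rho * v| = 2 * rho * `|v| by rewrite normrM gtr0_norm //; lra.
      apply: le_trans (nm_RI _ _) _; rewrite !nrho.
      have : `|s' - x| <= l by rewrite ler_norml; lra.
      have : `|t' - y| <= l by rewrite ler_norml; lra.
      move=> q1 q2; have := ler_wpM2l (ltW rho0) q1; have := ler_wpM2l (ltW rho0) q2; lra.
    have := hdl h; rewrite hE mul0r subr0 => H; apply: le_trans (H _) _; first by lra.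
    have := ler_wpM2l (ltW E0) nh.
    have -> : e / (8 * rho) * (4 * rho * l) = e / 2 * l by field; rewrite gt_eqF.
    by [].
  move=> s1 t1 s2 t2 a1 b1 a2 b2.
  have := loc _ _ a1 b1; have := loc _ _ a2 b2; rewrite nmB => k1 k2.
  have := nmD (g (cc s1 t1) - g (cc x y)) (g (cc x y) - g (cc s2 t2)).
  set m := g (cc x y) in k1 k2 *.
  have -> : g (cc s1 t1) - m + (m - g (cc s2 t2)) = g (cc s1 t1) - g (cc s2 t2) by ring.
  lra.
move=> z hz.
have ex v : nm v <= rho -> exists s t, [/\ 0 <= s <= 1, 0 <= t <= 1 & v = cc s t].
  move=> hv; have := le_trans (Re_le_nm v) hv; have := le_trans (Im_le_nm v) hv.
  rewrite !ler_norml => /andP[y1 y2] /andP[x1 x2].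
  exists ((complex.Re v + rho) / (2 * rho)), ((complex.Im v + rho) / (2 * rho)).
  split.
  - apply/andP; split; first by apply: divr_ge0; lra.
    by rewrite ler_pdivrMr; lra.
  - apply/andP; split; first by apply: divr_ge0; lra.
    by rewrite ler_pdivrMr; lra.
  rewrite [LHS]complexRI /cc; congr (_%:C%C + 'i * _%:C%C); field; rewrite gt_eqF //.
have [s [t [hs ht ->]]] := ex z hz.
have [s' [t' [hs' ht' ->]]] := ex 0 ltac:(by rewrite nm0 ltW).
apply/eqP; rewrite -subr_eq0; apply/eqP/nm_eq0/eqP; rewrite eq_le nm_ge0 andbT leNgt.
apply/negP => h; have := key (nm (g (cc s t) - g (cc s' t')) / 2) ltac:(lra) s t s' t' hs ht hs' ht'.
lra.
Qed.

End Identity.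

(** * Holomorphic maps and Hermitian forms *)

Section Vectors.
Variable R : realType.
Local Notation C := (complex R).

Definition vn (n : nat) (h : 'rV[C]_n) : R := \sum_j nm (h 0 j).

Lemma vnormE n (h : 'rV[C]_n) : vnorm h = (vn h)%:C%C.
Proof. by rewrite /vnorm /vn rmorph_sum /=; apply: eq_bigr => j _; rewrite nmE. Qed.

Lemma vn_ge0 n (h : 'rV[C]_n) : 0 <= vn h.
Proof. by apply: sumr_ge0 => j _; exact: nm_ge0. Qed.

Lemma vn0 n : vn (0 : 'rV[C]_n) = 0.
Proof. by rewrite /vn big1 // => j _; rewrite mxE nm0. Qed.

Lemma vnN n (h : 'rV[C]_n) : vn (- h) = vn h.
Proof. by apply: eq_bigr => j _; rewrite mxE nmN. Qed.

Lemma vnC n (h k : 'rV[C]_n) : vn (h - k) = vn (k - h).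
Proof. by rewrite -vnN opprB. Qed.

Lemma vnD n (h k : 'rV[C]_n) : vn (h + k) <= vn h + vn k.
Proof. by rewrite -big_split; apply: ler_sum => j _; rewrite mxE nmD. Qed.

Lemma vnZ n (a : C) (h : 'rV[C]_n) : vn (a *: h) = nm a * vn h.
Proof. by rewrite mulr_sumr; apply: eq_bigr => j _; rewrite mxE nmM. Qed.

Lemma nm_le_vn n (h : 'rV[C]_n) j : nm (h 0 j) <= vn h.
Proof. by rewrite /vn (bigD1 j) //= lerDl sumr_ge0 // => i _; exact: nm_ge0. Qed.

Lemma vn_triangle n (a b c : 'rV[C]_n) : vn (a - c) <= vn (a - b) + vn (b - c).
Proof. by have := vnD (a - b) (b - c); rewrite addrA subrK. Qed.

Lemma is_open_ball n (V : 'rV[C]_n -> Prop) z : is_open V -> V z ->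
  exists2 rho : R, 0 < rho & forall w, vn (w - z) < rho -> V w.
Proof.
move=> oV /oV[d [d0 hd]]; exists (complex.Re d); first by move: d0; rewrite ltcE => /andP[].
move=> w hw; apply: hd; rewrite vnormE ltcE /= hw andbT.
by move: d0; rewrite ltcE => /andP[].
Qed.

Definition fd n m (F : 'rV[C]_n -> 'rV[C]_m) z (D : 'M[C]_(n, m)) :=
  forall e : R, 0 < e -> exists2 d : R, 0 < d &
    forall h, vn h < d -> vn (F (z + h) - F z - h *m D) <= e * vn h.

Lemma holo_on_fd n m V (F : 'rV[C]_n -> 'rV[C]_m) z : holo_on V F -> V z ->
  exists D, fd F z D.
Proof.
move=> hF /hF[D hD]; exists D => e e0; have [|d [d0 hd]] := hD e%:C%C; first by rewrite ltcR.
exists (complex.Re d); first by move: d0; rewrite ltcE => /andP[].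
move=> h hh; have := hd h; rewrite !vnormE -rmorphM lecR; apply.
by rewrite ltcE /= hh andbT; move: d0; rewrite ltcE => /andP[].
Qed.

Lemma fd_mulmx n m k (F : 'rV[C]_n -> 'rV[C]_m) z D (M : 'M[C]_(m, k)) :
  fd F z D -> fd (fun w => F w *m M) z (D *m M).
Proof.
move=> hD.
pose K : R := \sum_j \sum_i nm (M i j).
have K0 : 0 <= K by apply: sumr_ge0 => j _; apply: sumr_ge0 => i _; exact: nm_ge0.
have hK v : vn (v *m M) <= K * vn v.
  rewrite /K mulr_suml; apply: ler_sum => j _; rewrite mxE.
  apply: le_trans (nm_sum _ _ _) _; rewrite mulr_suml; apply: ler_sum => i _.
  by rewrite nmM mulrC ler_wpM2l ?nm_ge0 // nm_le_vn.
move=> e e0; have K1 : 0 < K + 1 by lra.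
have [d d0 hd] := hD (e / (K + 1)) (divr_gt0 e0 K1); exists d => // h /hd H.
rewrite mulmxA -!mulmxBl; apply: le_trans (hK _) _.
apply: le_trans (ler_wpM2l K0 H) _; rewrite mulrA ler_wpM2r ?vn_ge0 //.
rewrite mulrA ler_pdivrMr //; have : 0 <= K * e by rewrite mulr_ge0 // ltW.
lra.
Qed.

Definition vcd n (Z : C -> 'rV[C]_n) (a : C) := forall j, cdiff (fun l => Z l 0 j) a.

Lemma vcd_cst n (v : 'rV[C]_n) a : vcd (fun=> v) a.
Proof. by move=> j; exact: cdiff_cst. Qed.

Lemma vcdD n (Y Z : C -> 'rV[C]_n) a : vcd Y a -> vcd Z a -> vcd (fun l => Y l + Z l) a.
Proof.
move=> hY hZ j; rewrite (_ : (fun _ => _) = (fun l => Y l 0 j + Z l 0 j)).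
  exact: cdiffD (hY j) (hZ j).
by apply: funext => l; rewrite mxE.
Qed.

Lemma vcdZ n (f : C -> C) (Z : C -> 'rV[C]_n) a : cdiff f a -> vcd Z a ->
  vcd (fun l => f l *: Z l) a.
Proof.
move=> hY hZ j; rewrite (_ : (fun _ => _) = (fun l => f l * Z l 0 j)).
  exact: cdiffM hY (hZ j).
by apply: funext => l; rewrite mxE.
Qed.

Lemma vcdB n (Y Z : C -> 'rV[C]_n) a : vcd Y a -> vcd Z a -> vcd (fun l => Y l - Z l) a.
Proof.
move=> hY hZ j; rewrite (_ : (fun _ => _) = (fun l => Y l 0 j - Z l 0 j)).
  exact: cdiffB (hY j) (hZ j).
by apply: funext => l; rewrite !mxE.
Qed.

Lemma vcd_line n (z h : 'rV[C]_n) a : vcd (fun l => z + l *: h) a.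
Proof. by apply: vcdD; [exact: vcd_cst|apply: vcdZ; [exact: cdiff_id|exact: vcd_cst]]. Qed.

Lemma near_all (n : nat) (P : 'I_n -> C -> Prop) :
  (forall i, exists2 d : R, 0 < d & forall h, nm h < d -> P i h) ->
  exists2 d : R, 0 < d & forall h, nm h < d -> forall i, P i h.
Proof.
move=> H.
suff [d d0 hd] : exists2 d : R, 0 < d &
    forall h, nm h < d -> forall i, i \in enum 'I_n -> P i h.
  by exists d => // h hh i; apply: hd => //; rewrite mem_enum.
elim: (enum 'I_n) => [|i s [d d0 hd]]; first by exists 1.
have [d' d'0 hd'] := H i; exists (Num.min d d') => [|h]; first by rewrite lt_min d0.
rewrite lt_min => /andP[h1 h2] k; rewrite inE => /orP[/eqP->|]; first exact: hd'.
exact: hd.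
Qed.

Lemma vcd_lipschitz n (Z : C -> 'rV[C]_n) a : vcd Z a -> exists2 K : R, 0 < K &
  exists2 d : R, 0 < d & forall h, nm h < d -> vn (Z (a + h) - Z a) <= K * nm h.
Proof.
move=> hZ; have /choice[D hD] : forall j, exists D : C, is_cd (fun l => Z l 0 j) a D.
  by move=> j; exact: hZ.
have [d d0 hd] := @near_all n (fun j h => nm (Z (a + h) 0 j - Z a 0 j) <= (nm (D j) + 1) * nm h)
   (fun j => ltac:(
     have [dl dl0 hdl] := (is_cdP _ _ _).1 (hD j) 1 ltr01; exists dl => // h /hdl;
     have := nmD (Z (a + h) 0 j - Z a 0 j - D j * h) (D j * h); rewrite subrK nmM; lra)).
exists (1 + \sum_j (nm (D j) + 1)).
  by rewrite ltr_pwDl // sumr_ge0 // => j _; rewrite addr_ge0 ?nm_ge0.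
exists d => // h /hd H.
apply: (@le_trans _ _ ((\sum_j (nm (D j) + 1)) * nm h)); last first.
  by rewrite ler_wpM2r ?nm_ge0 // lerDr.
by rewrite mulr_suml; apply: ler_sum => j _; rewrite !mxE.
Qed.

Lemma vcd_comp n m (F : 'rV[C]_n -> 'rV[C]_m) (Z : C -> 'rV[C]_n) a D :
  fd F (Z a) D -> vcd Z a -> vcd (fun l => F (Z l)) a.
Proof.
move=> hF hZ j; have [K K0 [r r0 hr]] := vcd_lipschitz hZ.
pose L l := \sum_i Z l 0 i * D i j.
have hL : cdiff L a by apply: cdiff_sum => i _; apply: cdiffM; [exact: hZ|exact: cdiff_cst].
pose er l := F (Z l) 0 j - L l.
rewrite (_ : (fun _ => _) = (fun l => L l + er l)); last by apply: funext => l; rewrite /er; ring.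
apply: cdiffD hL _; exists 0; apply/is_cdP => e e0.
have [d d0 hd] := hF (e / K) (divr_gt0 e0 K0).
exists (Num.min r (d / K)) => [|h]; first by rewrite lt_min r0 divr_gt0.
rewrite lt_min ltr_pdivlMr // => /andP[/hr h1 h2].
have := hd (Z (a + h) - Z a); rewrite [Z a + _]addrC subrK => H.
have {}H := H (le_lt_trans h1 _); rewrite mulrC in h2; have {}H := H h2.
rewrite mul0r subr0 /er /L.
have -> : F (Z (a + h)) 0 j - \sum_i Z (a + h) 0 i * D i j -
   (F (Z a) 0 j - \sum_i Z a 0 i * D i j) =
   (F (Z (a + h)) - F (Z a) - (Z (a + h) - Z a) *m D) 0 j.
  rewrite !mxE; under [X in _ = _ - X]eq_bigr => i _ do rewrite !mxE mulrBl.
  by rewrite sumrB; ring.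
apply: le_trans (nm_le_vn _ _) _; apply: le_trans H _.
have := ler_wpM2l (ltW (divr_gt0 e0 K0)) h1; rewrite mulrA divfK ?gt_eqF //.
Qed.

Lemma fd_line n m (F : 'rV[C]_n -> 'rV[C]_m) z h a D j : fd F (z + a *: h) D ->
  is_cd (fun l => F (z + l *: h) 0 j) a ((h *m D) 0 j).
Proof.
move=> hD; apply/is_cdP => e e0; have h0 := vn_ge0 h; have K0 : 0 < vn h + 1 by lra.
have [d d0 hd] := hD (e / (vn h + 1)) (divr_gt0 e0 K0).
exists (d / (vn h + 1)) => [|k]; first exact: divr_gt0.
rewrite ltr_pdivlMr // => hk.
have k0 := nm_ge0 k.
have := hd (k *: h); rewrite vnZ => H.
have -> : F (z + (a + k) *: h) 0 j - F (z + a *: h) 0 j - (h *m D) 0 j * k =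
   (F (z + a *: h + k *: h) - F (z + a *: h) - (k *: h) *m D) 0 j.
  by rewrite -scalemxAl scalerDl addrA !mxE; ring.
apply: le_trans (nm_le_vn _ _) _; apply: le_trans (H _) _; first by lra.
rewrite mulrCA mulrC ler_wpM2r // mulrAC ler_pdivrMr // ler_wpM2l ?(ltW e0) //; lra.
Qed.

End Vectors.

(** * The Hermitian form and its holomorphic dependence *)

Section HermitianForm.
Variable R : realType.
Local Notation C := (complex R).
Variables r s t : nat.
Implicit Types (u v w z : 'rV[C]_(r + s + t)) (a b : C).

Definition hsgn (j : 'I_(r + s + t)) : C :=
  if (j < r)%N then 1 else if (j < r + s)%N then -1 else 0.

Lemma hformE z w : hform z w = \sum_j hsgn j * (z 0 j * (w 0 j)^*).
Proof.
rewrite /hform big_mkcond [X in _ - X]big_mkcond -sumrB; apply: eq_bigr => j _.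
rewrite /hsgn; case: ltnP => /= h1; first by rewrite subr0 mul1r.
by case: ltnP => h2; rewrite ?subr0 ?sub0r ?mulN1r ?mul0r.
Qed.

Lemma hformDl u v w : hform (u + v) w = hform u w + hform v w.
Proof. by rewrite !hformE -big_split; apply: eq_bigr => j _; rewrite mxE /=; ring. Qed.

Lemma hformZl a u w : hform (a *: u) w = a * hform u w.
Proof. by rewrite !hformE mulr_sumr; apply: eq_bigr => j _; rewrite mxE /=; ring. Qed.

Lemma hformC u w : hform w u = (hform u w)^*.
Proof.
rewrite !hformE rmorph_sum; apply: eq_bigr => j _; rewrite !rmorphM /= conjCK.
have -> : (hsgn j)^* = hsgn j.
  by rewrite /hsgn; do 2?case: ifP => _; rewrite ?rmorphN ?rmorph1 ?rmorph0.
ring.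
Qed.

Lemma hformDr u v w : hform w (u + v) = hform w u + hform w v.
Proof. by rewrite hformC hformDl rmorphD /= -!hformC. Qed.

Lemma hformZr a u w : hform w (a *: u) = a^* * hform w u.
Proof. by rewrite hformC hformZl rmorphM /= -hformC. Qed.

Lemma hform0l w : hform 0 w = 0.
Proof. by rewrite -(scale0r (0 : 'rV[C]_(r + s + t))) hformZl mul0r. Qed.
Lemma hform0r w : hform w 0 = 0.
Proof. by rewrite hformC hform0l rmorph0. Qed.

Lemma hformNl u w : hform (- u) w = - hform u w.
Proof. by rewrite -scaleN1r hformZl mulN1r. Qed.
Lemma hformNr u w : hform w (- u) = - hform w u.
Proof. by rewrite hformC hformNl rmorphN /= -hformC. Qed.
Lemma hformBl u v w : hform (u - v) w = hform u w - hform v w.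
Proof. by rewrite hformDl hformNl. Qed.
Lemma hformBr u v w : hform w (u - v) = hform w u - hform w v.
Proof. by rewrite hformDr hformNr. Qed.

Lemma hform_suml (I : Type) (l : seq I) (P : pred I) (G : I -> 'rV[C]_(r + s + t)) w :
  hform (\sum_(i <- l | P i) G i) w = \sum_(i <- l | P i) hform (G i) w.
Proof.
elim/big_rec2: _ => [|i x y _ <-]; first exact: hform0l.
by rewrite hformDl.
Qed.

Lemma hform_sumr (I : Type) (l : seq I) (P : pred I) (G : I -> 'rV[C]_(r + s + t)) w :
  hform w (\sum_(i <- l | P i) G i) = \sum_(i <- l | P i) hform w (G i).
Proof.
elim/big_rec2: _ => [|i x y _ <-]; first exact: hform0r.
by rewrite hformDr.
Qed.

Lemma hform_real u : (hform u u)^* = hform u u.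
Proof. by rewrite -hformC. Qed.

Lemma hform_eq0C u v : hform u v = 0 -> hform v u = 0.
Proof. by move=> h; rewrite hformC h rmorph0. Qed.

Lemma nm_hform u v : nm (hform u v) <= vn u * vn v.
Proof.
rewrite hformE; apply: le_trans (nm_sum _ _ _) _; rewrite mulr_suml.
apply: ler_sum => j _; rewrite !nmM nm_conj.
have h : nm (hsgn j) <= 1.
  by rewrite /hsgn; do 2?case: ifP => _; rewrite ?nmN ?nm1 ?nm0.
apply: (@le_trans _ _ (nm (u 0 j) * nm (v 0 j))).
  by rewrite ler_piMl // mulr_ge0 ?nm_ge0.
by rewrite ler_wpM2l ?nm_ge0 // nm_le_vn.
Qed.

Lemma cdiff_hform (Z : C -> 'rV[C]_(r + s + t)) w a :
  vcd Z a -> cdiff (fun l => hform (Z l) w) a.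
Proof.
move=> hZ; rewrite (_ : (fun _ => _) = (fun l => \sum_j hsgn j * (Z l 0 j * (w 0 j)^*))).
  apply: cdiff_sum => j _; apply: cdiffM; first exact: cdiff_cst.
  by apply: cdiffM; [exact: hZ|exact: cdiff_cst].
by apply: funext => l; rewrite hformE.
Qed.

(** The reflection [l^*] in the second slot undoes the antilinearity of the form, so the pairing is
    holomorphic in [l]. *)
Lemma cdiff_hform2 (Y Z : C -> 'rV[C]_(r + s + t)) a :
  vcd Y a -> vcd Z a^* -> cdiff (fun l => hform (Y l) (Z l^*)) a.
Proof.
move=> hY hZ.
rewrite (_ : (fun _ => _) = (fun l => \sum_j hsgn j * (Y l 0 j * (Z l^* 0 j)^*))).
  apply: cdiff_sum => j _; apply: cdiffM; first exact: cdiff_cst.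
  by apply: cdiffM; [exact: hY|apply: (@cdiff_conj R (fun l => Z l 0 j)); exact: hZ].
by apply: funext => l; rewrite hformE.
Qed.

Lemma is_cd_sum (I : Type) (l : seq I) (G : I -> C -> C) (d : I -> C) a :
  (forall i, is_cd (G i) a (d i)) ->
  is_cd (fun x => \sum_(i <- l) G i x) a (\sum_(i <- l) d i).
Proof.
move=> hF; elim: l => [|i l IH].
  rewrite big_nil (_ : (fun _ => _) = (fun=> 0)); first exact: is_cd_cst.
  by apply: funext => x; rewrite big_nil.
rewrite big_cons (_ : (fun _ => _) = (fun x => G i x + \sum_(j <- l) G j x)).
  exact: is_cdD.
by apply: funext => x; rewrite big_cons.
Qed.

Lemma is_cd_hform_line n (F : 'rV[C]_n -> 'rV[C]_(r + s + t)) (z : 'rV[C]_n) h y (a : C) D :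
  fd F (z + a *: h) D ->
  is_cd (fun l => hform (F (z + l *: h)) y) a (hform (h *m D) y).
Proof.
move=> hD; rewrite hformE.
rewrite (_ : (fun _ => _) = (fun l => \sum_j (hsgn j * (y 0 j)^*) * F (z + l *: h) 0 j)).
  rewrite (_ : \sum_j _ = \sum_j (hsgn j * (y 0 j)^*) * (h *m D) 0 j).
    apply: is_cd_sum => j; apply: is_cd_eq.
      exact: is_cdM (is_cd_cst _ _) (fd_line j hD).
    by rewrite mul0r add0r.
  by apply: eq_bigr => j _; ring.
by apply: funext => l; rewrite hformE; apply: eq_bigr => j _; ring.
Qed.

End HermitianForm.

(** * Preservation of orthogonality *)

Section Orthogonality.
Variable R : realType.
Local Notation C := (complex R).
Variables r s t r' s' t' : nat.
Local Notation V := ('rV[C]_(r + s + t)).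
Local Notation W := ('rV[C]_(r' + s' + t')).
Implicit Types (z w x y : V) (a b c l : C).

(** What a lift on a ball in the cone retains of a local proper map. Values on one complex line are
    proportional, with no regularity asked of the factor [mu]. *)
Definition proper_germ (F : V -> W) (p : V) (rho : R) := [/\
  0 < rho,
  forall z, vn (z - p) < rho -> exists D, fd F z D,
  forall z c, vn (z - p) < rho -> vn (c *: z - p) < rho -> c != 0 ->
    exists2 mu : C, mu != 0 & F (c *: z) = mu *: F z,
  forall z, vn (z - p) < rho -> 0 < hform z z -> 0 < hform (F z) (F z) &
  forall z, vn (z - p) < rho -> hform z z = 0 -> hform (F z) (F z) = 0].

Variables (F : V -> W) (p : V) (rho : R).
Hypothesis HF : proper_germ F p rho.

Lemma conj_ii : 'i^* = - 'i :> C. Proof. exact: conjCi. Qed.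

(* With [x], [y] as in [Polarization] below, the curve passes (up to scalars) through [z] at ['i]
   and through [w] at [- 'i], and it is null for real [l]. So [<F (Z l), F (Z (conj l))>] vanishes
   for real [l], hence at ['i], where it is a multiple of [<F z, F w>]. *)
Definition null_curve (q x y : V) (l : C) : V :=
  (hform q x + l * hform q y) *: (x + l *: y) - ((1 + l ^+ 2) * hform y y / 2) *: q.

Lemma vcd_null_curve q x y a : vcd (null_curve q x y) a.
Proof.
have hl : cdiff (fun l : C => l) a := cdiff_id a.
apply: vcdB.
  apply: vcdZ; last exact: vcd_line.
  by apply: cdiffD; [exact: cdiff_cst|apply: cdiffM => //; exact: cdiff_cst].
apply: vcdZ; last exact: vcd_cst.
apply: cdiffM; last exact: cdiff_cst.
apply: cdiffM; last exact: cdiff_cst.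
by apply: cdiffD; [exact: cdiff_cst|exact: (cdiffX 2 hl)].
Qed.

Section Polarization.
Variables (q z w : V).
Hypotheses (qq : hform q q = 0) (zw : hform z w = 0).
Let x : V := 2^-1 *: (z + w).
Let y : V := (- 'i / 2) *: (z - w).

Lemma null_curve_i : null_curve q x y 'i = hform q w *: z.
Proof.
have i2 : 'i ^+ 2 = -1 :> C by rewrite sqrCi.
rewrite /null_curve i2 subrr mul0r mul0r scale0r subr0.
have -> : x + 'i *: y = z.
  rewrite /x /y scalerA !scalerDr scalerN addrACA -!scalerDl -scalerBl.
  have -> : 'i * (- 'i / 2) = 2^-1 :> C by rewrite mulrA mulrN -expr2 i2 opprK mul1r.
  have -> : 2^-1 + 2^-1 = 1 :> C by field.
  by rewrite subrr scale1r scale0r addr0.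
congr (_ *: _); rewrite /x /y !hformZr hformDr hformBr.
rewrite rmorphM rmorphN /= conj_ii opprK !fmorphV !rmorph_nat.
have -> : 'i * ('i / 2 * (hform q z - hform q w)) =
  'i ^+ 2 * (hform q z - hform q w) / 2 :> C by ring.
by rewrite i2; field.
Qed.

Lemma null_curve_Ni : null_curve q x y (- 'i) = hform q z *: w.
Proof.
have i2 : 'i ^+ 2 = -1 :> C by rewrite sqrCi.
rewrite /null_curve sqrrN i2 subrr mul0r mul0r scale0r subr0.
have -> : x + (- 'i) *: y = w.
  rewrite /x /y scalerA !scalerDr scalerN addrACA -!scalerDl -scalerBl.
  have -> : (- 'i) * (- 'i / 2) = - 2^-1 :> C by rewrite mulrA mulrNN -expr2 i2 mulN1r.
  have -> : 2^-1 - - 2^-1 = 1 :> C by field.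
  by rewrite subrr scale1r scale0r add0r.
congr (_ *: _); rewrite /x /y !hformZr hformDr hformBr.
rewrite rmorphM rmorphN /= conj_ii opprK !fmorphV !rmorph_nat.
have -> : (- 'i) * ('i / 2 * (hform q z - hform q w)) =
  - ('i ^+ 2) * (hform q z - hform q w) / 2 :> C by ring.
by rewrite i2; field.
Qed.

(** For real [l] and [u = x + l y], orthogonality of [z] and [w] gives
    [<u, u> = (1 + l ^ 2) <y, y>]. So the curve is [<q, u> u - (<u, u> / 2) q], that is [u] pushed
    onto the null cone along the null vector [q]. Writing [<u, u>] as a polynomial in [l] keeps the
    curve holomorphic and removes the correction at ['i] and [- 'i]. *)
Lemma null_curve_null l : l^* = l -> hform (null_curve q x y l) (null_curve q x y l) = 0.
Proof.
move=> lr.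
have i2 : 'i ^+ 2 = -1 :> C by rewrite sqrCi.
have wz : hform w z = 0 by exact: hform_eq0C.
have h2 : (2^-1)^* = 2^-1 :> C by rewrite fmorphV rmorph_nat.
pose u := x + l *: y.
have uu : hform u u = (1 + l ^+ 2) * hform y y.
  rewrite /u /x /y !(hformBl, hformBr, hformDl, hformDr, hformZl, hformZr) lr zw wz.
  rewrite !rmorphM !rmorphN /= conj_ii h2 !opprK.
  set a := hform z z; set b := hform w w.
  transitivity ((a + b) / 4 + l * ((a - b) * ('i - 'i) / 4) - l ^+ 2 * ('i ^+ 2 * (a + b) / 4)).
    by field.
  transitivity (- (1 + l ^+ 2) * ('i ^+ 2 * (a + b) / 4)); first by rewrite i2; field.
  by field.
have yr : (hform y y)^* = hform y y by exact: hform_real.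
rewrite /null_curve -/u.
have -> : hform q x + l * hform q y = hform q u by rewrite /u hformDr hformZr lr.
have uq : hform u q = (hform q u)^* by exact: hformC.
set k := hform y y in uu yr *.
have kr : ((1 + l ^+ 2) * k / 2)^* = (1 + l ^+ 2) * k / 2.
  by rewrite !rmorphM /= h2 yr rmorphD rmorph1 rmorphXn /= lr.
rewrite !(hformBl, hformBr, hformZl, hformZr) qq uq uu kr.
by field.
Qed.

End Polarization.

(** The constants come from [nm l < 30]: 31 bounds [1 + nm l], and 451 bounds half of
    [1 + nm l ^+ 2]. *)
Lemma null_curve_near q x y (e : R) l : hform q p = 1 -> nm l < 30 -> e <= 1 ->
  vn (x - p) <= e -> vn y <= e ->
  vn (null_curve q x y l - p) <= e * (31 * vn q * (vn p + 31) + 31 + 451 * vn q).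
Proof.
move=> qp hl e1 hx hy; have e0 : 0 <= e := le_trans (vn_ge0 _) hx.
have q0 := vn_ge0 q; have p0 := vn_ge0 p; have l0 := nm_ge0 l.
pose u := x + l *: y.
have lb v : nm l * v <= 30 * v \/ v < 0.
  by have [v0|v0] := lerP 0 v; [left; rewrite ler_wpM2r // ltW|right].
have ly : nm l * vn y <= 30 * e.
  by apply: ler_pM => //; [exact: vn_ge0|exact: ltW].
have hu : vn (u - p) <= 31 * e.
  have -> : u - p = (x - p) + l *: y by rewrite /u addrAC.
  by apply: le_trans (vnD _ _) _; rewrite vnZ; lra.
have hu' : vn u <= vn p + 31.
  have := vnD (u - p) p; rewrite subrK; lra.
have hA : nm (hform q x + l * hform q y - 1) <= vn q * (31 * e).
  have -> : hform q x + l * hform q y - 1 = hform q (x - p) + l * hform q y.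
    by rewrite hformBr qp; ring.
  apply: le_trans (nmD _ _) _; rewrite nmM.
  have h1 := le_trans (nm_hform q (x - p)) (ler_wpM2l q0 hx).
  have h2 := le_trans (nm_hform q y) (ler_wpM2l q0 hy).
  have h3 := ler_wpM2l l0 h2.
  have h4 : nm l * (vn q * e) <= 30 * (vn q * e) by rewrite ler_wpM2r ?mulr_ge0 // ltW.
  lra.
have hk : nm ((1 + l ^+ 2) * hform y y / 2) <= 451 * e.
  rewrite !nmM nmV nm2.
  have h1 : nm (1 + l ^+ 2) <= 901.
    apply: le_trans (nmD _ _) _; rewrite nm1 nmX.
    have := ler_pM l0 l0 (ltW hl) (ltW hl); rewrite -!expr2; lra.
  have h2 : nm (hform y y) <= e.
    apply: le_trans (nm_hform _ _) _.
    apply: (@le_trans _ _ (1 * e)); last by rewrite mul1r.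
    by apply: ler_pM; rewrite ?vn_ge0 //; apply: le_trans hy e1.
  have := ler_pM (nm_ge0 _) (nm_ge0 _) h1 h2; lra.
have -> : null_curve q x y l - p = (hform q x + l * hform q y - 1) *: u + (u - p) -
    ((1 + l ^+ 2) * hform y y / 2) *: q.
  rewrite /null_curve -/u scalerBl scale1r; move: (_ *: u) (_ *: q) => v1 v2.
  by rewrite addrA subrK addrAC.
apply: le_trans (vnD _ _) _; rewrite vnN vnZ.
have := vnD ((hform q x + l * hform q y - 1) *: u) (u - p); rewrite vnZ.
have m1 := ler_pM (nm_ge0 _) (vn_ge0 _) hA hu'.
have m2 := ler_wpM2r q0 hk.
lra.
Qed.

Lemma orthogonality q : hform q q = 0 -> hform q p = 1 ->
  exists2 rho1, 0 < rho1 <= rho & forall z w, vn (z - p) < rho1 -> vn (w - p) < rho1 ->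
    hform z w = 0 -> hform (F z) (F w) = 0.
Proof.
move=> qq qp; have [rho0 Hd Hpr Hpos Hnull] := HF.
pose K := 31 * vn q * (vn p + 31) + 31 + 451 * vn q.
have q0 := vn_ge0 q; have p0 := vn_ge0 p.
have K0 : 0 < K by rewrite /K ltr_wpDr ?mulr_ge0 // ltr_wpDl // !mulr_ge0 // addr_ge0.
have K1 : 0 < K + 1 by lra.
have Q1 : 0 < vn q + 1 by lra.
(* The last bound keeps the pairing with [q] away from 0 near [p], where it is 1; otherwise the
   curve could degenerate to 0 at ['i] or [- 'i]. *)
pose e := Num.min (Num.min 1 rho) (Num.min (rho / (K + 1)) ((vn q + 1)^-1)).
have e0 : 0 < e by rewrite !lt_min ltr01 rho0 divr_gt0 //= invr_gt0.
have [e1 er] : e <= 1 /\ e <= rho.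
  have : e <= Num.min 1 rho by rewrite /e ge_min lexx.
  by rewrite le_min => /andP[].
have [ek eq] : e <= rho / (K + 1) /\ e <= (vn q + 1)^-1.
  have : e <= Num.min (rho / (K + 1)) ((vn q + 1)^-1) by rewrite /e ge_min lexx orbT.
  by rewrite le_min => /andP[].
exists e; first by rewrite e0.
move=> z w hz hw zw.
pose x : V := 2^-1 *: (z + w); pose y : V := (- 'i / 2) *: (z - w).
have hx : vn (x - p) <= e.
  have -> : x - p = 2^-1 *: ((z - p) + (w - p)).
    have E : p + p = (2 : C) *: p by rewrite scaler_nat mulr2n.
    by rewrite addrACA -opprD E scalerBr scalerA mulVf ?scale1r // pnatr_eq0.
  by rewrite vnZ nmV nm2; have := vnD (z - p) (w - p); lra.
have hy : vn y <= e.
  rewrite vnZ nmM nmN nm_i nmV nm2 mul1r.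
  by have := vn_triangle z p w; rewrite (vnC p w); lra.
pose Z := null_curve q x y.
have nZ l : nm l < 30 -> vn (Z l - p) < rho.
  move=> hl; apply: le_lt_trans (null_curve_near qp hl e1 hx hy) _.
  rewrite -/K; have := ler_wpM2r (ltW K0) ek; move=> h; apply: le_lt_trans h _.
  rewrite mulrAC ltr_pdivrMr //; have : rho * K < rho * (K + 1) by rewrite ltr_pM2l //; lra.
  by [].
have cF l : nm l < 30 -> vcd (fun l => F (Z l)) l.
  move=> hl; have [D hD] := Hd _ (nZ l hl).
  exact: vcd_comp hD (vcd_null_curve q x y l).
have : hform (F (Z 'i)) (F (Z 'i^*)) = 0.
  apply: (@zero_on_reals R (fun l => hform (F (Z l)) (F (Z l^*)))) => l hl.
    have lr : (l%:C%C)^* = l%:C%C :> C.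
      by apply/eqP; rewrite eq_complex /= oppr0 !eqxx.
    rewrite lr; apply: Hnull; [exact: nZ|exact: null_curve_null].
  have hl' : nm l^* < 30 by rewrite nm_conj.
  exact: (cdiff_hform2 (cF _ hl) (cF _ hl')).
rewrite conj_ii.
have n1 v : vn (v - p) < e -> hform q v != 0.
  move=> hv; apply/eqP => h0.
  have := nm_hform q (v - p); rewrite hformBr h0 qp sub0r nmN nm1.
  have h1 : vn q * vn (v - p) <= vn q * (vn q + 1)^-1 by rewrite ler_wpM2l //; lra.
  move=> h2; have := le_trans h2 h1; rewrite ler_pdivlMr // mul1r; lra.
have i30 : nm 'i < 30 :> R by rewrite nm_i; lra.
have i30' : nm (- 'i) < 30 :> R by rewrite nmN nm_i; lra.
have Zi : Z 'i = hform q w *: z by exact: null_curve_i.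
have ZNi : Z (- 'i) = hform q z *: w by exact: null_curve_Ni.
have := nZ 'i i30; have := nZ (- 'i) i30'; rewrite Zi ZNi => k1 k2.
have [mu mu0 ->] := Hpr z (hform q w) (lt_le_trans hz er) k2 (n1 _ hw).
have [nu nu0 ->] := Hpr w (hform q z) (lt_le_trans hw er) k1 (n1 _ hz).
rewrite hformZl hformZr => /eqP; rewrite !mulf_eq0 (negbTE mu0) conjC_eq0 (negbTE nu0) /=.
by move/eqP.
Qed.

End Orthogonality.

(** * Consequences of the law of inertia *)

Section Inertia.
Variable R : realType.
Local Notation C := (complex R).
Variables r s t : nat.
Local Notation W := ('rV[C]_(r + s + t)).

(** A complement of the radical, on which the form is nondegenerate. *)
Definition radical_free (v : W) := forall j : 'I_(r + s + t), (r + s <= j)%N -> v 0 j = 0.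

(** Some nontrivial combination [x] of [r + 1] vectors has its first [r] coordinates equal to 0, so
    [<x, x> <= 0]; by orthogonality [<x, x>] is also a sum of nonnegative terms. Both sides vanish:
    [x] is 0, having no radical part, and positive vectors get the coefficient 0. *)
Lemma nonneg_orthogonal_dependent (y : 'I_r.+1 -> W) :
  (forall i, radical_free (y i)) -> (forall i j, i != j -> hform (y i) (y j) = 0) ->
  (forall i, 0 <= hform (y i) (y i)) ->
  exists a : 'I_r.+1 -> C, [/\ exists i, a i != 0, \sum_i a i *: y i = 0 &
    forall i, 0 < hform (y i) (y i) -> a i = 0].
Proof.
move=> hy orth pos.
have hemb (j : 'I_r) : (j < r + s + t)%N by rewrite (leq_trans (ltn_ord j)) // -addnA leq_addr.
pose emb j := Ordinal (hemb j).
pose M : 'M[C]_(r.+1, r) := \matrix_(i, j) y i 0 (emb j).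
have : kermx M != 0.
  by rewrite -mxrank_eq0 mxrank_ker -lt0n subn_gt0 ltnS rank_leq_col.
case/rowV0Pn => v /sub_kermxP vM vn0.
pose x := \sum_i v 0 i *: y i.
have x_lt (j : 'I_(r + s + t)) : (j < r)%N -> x 0 j = 0.
  move=> jr; have /matrixP/(_ 0 (Ordinal jr)) := vM; rewrite !mxE => <-.
  rewrite /x summxE; apply: eq_bigr => i _; rewrite !mxE; congr (_ * y i 0 _); exact: val_inj.
have x_ge (j : 'I_(r + s + t)) : (r + s <= j)%N -> x 0 j = 0.
  by move=> jr; rewrite /x summxE big1 // => i _; rewrite mxE (hy i j jr) mulr0.
have xx1 : hform x x = \sum_i `|v 0 i| ^+ 2 * hform (y i) (y i).
  rewrite /x hform_suml; apply: eq_bigr => i _; rewrite hformZl hform_sumr (bigD1 i) //=.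
  rewrite big1 ?addr0; last by move=> j ji; rewrite hformZr orth ?mulr0 // eq_sym.
  by rewrite hformZr normCK mulrA.
have xx2 : hform x x = - \sum_j `|x 0 j| ^+ 2.
  rewrite hformE -sumrN; apply: eq_bigr => j _; rewrite /hsgn -normCK.
  case: ltnP => h1; first by rewrite x_lt // normr0 expr0n mulr0 oppr0.
  by case: ltnP => h2; rewrite ?mulN1r // x_ge // normr0 expr0n mulr0 oppr0.
have xx0 : hform x x = 0.
  apply: le_anti; apply/andP; split; last first.
    by rewrite xx1 sumr_ge0 // => i _; rewrite mulr_ge0 // exprn_ge0.
  by rewrite xx2 oppr_le0 sumr_ge0 // => i _; rewrite exprn_ge0.
exists (fun i => v 0 i); split.
- have [i hi] : exists i, v 0 i != 0.
    apply/existsP; rewrite -negb_forall; apply: contra vn0 => /forallP h.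
    by apply/eqP/rowP => i; rewrite mxE; exact/eqP/h.
  by exists i.
- apply/rowP => j; rewrite mxE -/x.
  have : \sum_j `|x 0 j| ^+ 2 == 0 by rewrite -oppr_eq0 -xx2 xx0.
  rewrite psumr_eq0; last by move=> i _; rewrite exprn_ge0.
  move/allP/(_ j); rewrite mem_index_enum => /(_ isT) /=.
  by rewrite expf_eq0 /= normr_eq0 => /eqP.
- move=> i hi; have : \sum_i `|v 0 i| ^+ 2 * hform (y i) (y i) == 0 by rewrite -xx1 xx0.
  rewrite psumr_eq0; last by move=> k _; rewrite mulr_ge0 // exprn_ge0.
  move/allP/(_ i); rewrite mem_index_enum => /(_ isT) /=.
  by rewrite mulf_eq0 (gt_eqF hi) orbF expf_eq0 /= normr_eq0 => /eqP.
Qed.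

(** In a dependence between [x] and [r] positive vectors only the coefficient of [x] can be
    nonzero. *)
Lemma orthogonal_to_positive_null_eq0 (x : W) (y : nat -> W) :
  radical_free x -> hform x x = 0 ->
  (forall i, (i < r)%N -> [/\ radical_free (y i), hform x (y i) = 0 & 0 < hform (y i) (y i)]) ->
  (forall i j, (i < r)%N -> (j < r)%N -> i != j -> hform (y i) (y j) = 0) ->
  x = 0.
Proof.
move=> hx xx hy orth.
pose Y (i : 'I_r.+1) := if (i < r)%N then y i else x.
have [] := @nonneg_orthogonal_dependent Y.
- by move=> i; rewrite /Y; case: ifP => // /hy[].
- move=> i j ij; rewrite /Y; case: ifP => hi; case: ifP => hj.
  + exact: orth.
  + by have [_ h _] := hy i hi; exact: hform_eq0C.
  + by have [] := hy j hj.
  + have E (k : 'I_r.+1) : (k < r)%N = false -> k = r :> nat.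
      by move=> hk; have := ltn_ord k; rewrite ltnS leq_eqVlt hk orbF => /eqP.
    by case/eqP: ij; apply: val_inj; rewrite /= (E i hi) (E j hj).
- by move=> i; rewrite /Y; case: ifP => [/hy[_ _ /ltW]|_] //; rewrite xx.
move=> a [[i ai] S a0].
have a0' (k : 'I_r.+1) : (k < r)%N -> a k = 0.
  by move=> kr; apply: a0; rewrite /Y kr; have [] := hy k kr.
have hi : i = ord_max.
  apply: val_inj; have := ltn_ord i; rewrite ltnS leq_eqVlt => /orP[/eqP//|/a0' h].
  by rewrite h eqxx in ai.
move: S; rewrite (bigD1 i) //= big1 ?addr0.
  by rewrite /Y hi ltnn -hi => /eqP; rewrite scaler_eq0 (negbTE ai) => /eqP.
move=> k ki; rewrite a0' ?scale0r // ltn_neqAle -ltnS ltn_ord andbT.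
by apply: contra ki => /eqP E; rewrite hi; apply/eqP/val_inj.
Qed.

(** With [r - 2] positive vectors the three null ones make [r + 1] mutually orthogonal vectors, and
    the relation cannot involve the positive ones. In the application the [r] of the target is the
    [r] of the source. *)
Lemma three_null_dependent (x : nat -> W) (y : nat -> W) : (2 <= r)%N ->
  (forall i, (i < 3)%N -> radical_free (x i)) ->
  (forall i j, (i < 3)%N -> (j < 3)%N -> hform (x i) (x j) = 0) ->
  (forall i, (i < r - 2)%N -> radical_free (y i) /\ 0 < hform (y i) (y i)) ->
  (forall i j, (i < r - 2)%N -> (j < 3)%N -> hform (y i) (x j) = 0) ->
  (forall i j, (i < r - 2)%N -> (j < r - 2)%N -> i != j -> hform (y i) (y j) = 0) ->
  exists a0 a1 a2 : C, [|| a0 != 0, a1 != 0 | a2 != 0] /\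
     a0 *: x 0%N + a1 *: x 1%N + a2 *: x 2%N = 0.
Proof.
move=> r2 hx xx hy yx yy.
pose Y (i : 'I_r.+1) := if (i < 3)%N then x i else y (i - 3)%N.
have lt3 (i : 'I_r.+1) : (i < 3)%N = false -> (i - 3 < r - 2)%N.
  move/negbT; rewrite -leqNgt => h; have := ltn_ord i; rewrite ltn_subLR //.
  by rewrite -[3%N]/(1 + 2)%N -addnA subnKC // add1n.
have [] := @nonneg_orthogonal_dependent Y.
- move=> i; rewrite /Y; case: ifP => hi; first exact: hx.
  by have [] := hy _ (lt3 i hi).
- move=> i j ij; rewrite /Y; case: ifP => hi; case: ifP => hj.
  + exact: xx.
  + by apply: hform_eq0C; apply: yx => //; exact: lt3.
  + by apply: yx => //; exact: lt3.
  + apply: yy; rewrite ?lt3 //; apply: contra ij => /eqP E; apply/eqP/val_inj => /=.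
    move/negbT: hi; move/negbT: hj; rewrite -!leqNgt => hj hi.
    by rewrite -(subnK hi) E subnK.
- move=> i; rewrite /Y; case: ifP => hi; first by rewrite xx.
  by have [_ /ltW] := hy _ (lt3 i hi).
move=> a [[i ai] S a0].
have a0' (k : 'I_r.+1) : (k < 3)%N = false -> a k = 0.
  by move=> kr; apply: a0; rewrite /Y kr; have [] := hy _ (lt3 k kr).
have b0 : (0 < r.+1)%N by [].
have b1 : (1 < r.+1)%N by rewrite ltnS (leq_trans _ r2).
have b2 : (2 < r.+1)%N by rewrite ltnS.
exists (a (Ordinal b0)), (a (Ordinal b1)), (a (Ordinal b2)); split.
  have i3 : (i < 3)%N by apply: contraNT ai => /negbTE/a0' ->.
  case: i i3 ai => -[|[|[|//]]] hi i3 /= ai.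
  - by rewrite (_ : Ordinal b0 = Ordinal hi) ?ai //; exact: val_inj.
  - by rewrite (_ : Ordinal b1 = Ordinal hi) ?ai ?orbT //; exact: val_inj.
  - by rewrite (_ : Ordinal b2 = Ordinal hi) ?ai ?orbT //; exact: val_inj.
rewrite -{}S (bigD1 (Ordinal b0)) //= (bigD1 (Ordinal b1)) //= (bigD1 (Ordinal b2)) //=.
rewrite big1 ?addr0 /Y /= ?addrA // => k /andP[/andP[k0 k1] k2].
rewrite a0' ?scale0r //; apply/negbTE; rewrite -leqNgt.
case: k k0 k1 k2 => -[|[|[|k]]] hk //= k0 k1 k2.
Qed.

End Inertia.

(** * Images of lines *)

Section Near.
Variable R : realType.
Local Notation C := (complex R).
Variables (T : Type) (dom : T -> Prop) (sg : T -> R).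
Hypothesis sg01 : forall x, dom x -> 0 <= sg x <= 1.

(** A big-O calculus with the small quantity [sg], uniform over [dom], for situations where several
    vectors and scalars vary at once. *)
Definition near (f : T -> C) (l : C) := exists2 K : R, 0 <= K &
  forall x, dom x -> nm (f x - l) <= K * sg x.
Definition vnear n (X : T -> 'rV[C]_n) (v : 'rV[C]_n) := exists2 K : R, 0 <= K &
  forall x, dom x -> vn (X x - v) <= K * sg x.
Definition bdd (f : T -> C) := exists2 K : R, 0 <= K & forall x, dom x -> nm (f x) <= K.

Lemma near_eq f l l' : near f l -> l = l' -> near f l'. Proof. by move=> + <-. Qed.
Lemma vnear_eq n (X : T -> 'rV[C]_n) v v' : vnear X v -> v = v' -> vnear X v'.
Proof. by move=> + <-. Qed.
Lemma vnear_cst n (v : 'rV[C]_n) : vnear (fun=> v) v.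
Proof. by exists 0 => // x _; rewrite subrr vn0 mul0r. Qed.

Lemma nearD f g l m : near f l -> near g m -> near (fun x => f x + g x) (l + m).
Proof.
move=> [K K0 hK] [L L0 hL]; exists (K + L); first exact: addr_ge0.
move=> x dx; have -> : f x + g x - (l + m) = (f x - l) + (g x - m) by ring.
by apply: le_trans (nmD _ _) _; rewrite mulrDl lerD ?hK ?hL.
Qed.

Lemma nearM f g l m : near f l -> near g m -> near (fun x => f x * g x) (l * m).
Proof.
move=> [K K0 hK] [L L0 hL]; have l0 := nm_ge0 l; have m0 := nm_ge0 m.
exists (K * L + nm l * L + K * nm m); first by rewrite !addr_ge0 ?mulr_ge0.
move=> x dx; have /andP[s0 s1] := sg01 dx; have h1 := hK x dx; have h2 := hL x dx.
have -> : f x * g x - l * m = (f x - l) * (g x - m) + l * (g x - m) + (f x - l) * m by ring.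
apply: le_trans (nmD _ _) _; have := nmD ((f x - l) * (g x - m)) (l * (g x - m)).
rewrite !nmM.
have e1 : nm (f x - l) * nm (g x - m) <= K * L * sg x.
  apply: le_trans (ler_pM (nm_ge0 _) (nm_ge0 _) h1 h2) _.
  rewrite mulrACA ler_wpM2l ?mulr_ge0 // -[X in _ <= X]mulr1 ler_wpM2l //.
have e2 := ler_wpM2l l0 h2; have e3 := ler_wpM2r m0 h1.
lra.
Qed.

Lemma nearN f l : near f l -> near (fun x => - f x) (- l).
Proof.
move=> [K K0 hK]; exists K => // x dx.
by rewrite -opprD nmN; exact: hK.
Qed.
Lemma nearB f g l m : near f l -> near g m -> near (fun x => f x - g x) (l - m).
Proof. by move=> hf hg; apply: nearD => //; exact: nearN. Qed.

Lemma near_conj f l : near f l -> near (fun x => (f x)^*) l^*.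
Proof. by move=> [K K0 hK]; exists K => // x dx; rewrite -rmorphB nm_conj; exact: hK. Qed.

Lemma near_bddM b f : bdd b -> near f 0 -> near (fun x => b x * f x) 0.
Proof.
move=> [K K0 hK] [L L0 hL]; exists (K * L); first exact: mulr_ge0.
move=> x dx; rewrite subr0 nmM -mulrA.
by apply: ler_pM; rewrite ?nm_ge0 ?hK //; have := hL x dx; rewrite subr0.
Qed.

Lemma vnearD n (X Y : T -> 'rV[C]_n) v w : vnear X v -> vnear Y w ->
  vnear (fun x => X x + Y x) (v + w).
Proof.
move=> [K K0 hK] [L L0 hL]; exists (K + L); first exact: addr_ge0.
move=> x dx; rewrite opprD addrACA.
by apply: le_trans (vnD _ _) _; rewrite mulrDl lerD ?hK ?hL.
Qed.

Lemma vnearN n (X : T -> 'rV[C]_n) v : vnear X v -> vnear (fun x => - X x) (- v).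
Proof. by move=> [K K0 hK]; exists K => // x dx; rewrite -opprD vnN; exact: hK. Qed.
Lemma vnearB n (X Y : T -> 'rV[C]_n) v w : vnear X v -> vnear Y w ->
  vnear (fun x => X x - Y x) (v - w).
Proof. by move=> hf hg; apply: vnearD => //; exact: vnearN. Qed.

Lemma vnearZ n f (X : T -> 'rV[C]_n) l v : near f l -> vnear X v ->
  vnear (fun x => f x *: X x) (l *: v).
Proof.
move=> [K K0 hK] [L L0 hL]; have l0 := nm_ge0 l; have m0 := vn_ge0 v.
exists (K * L + nm l * L + K * vn v); first by rewrite !addr_ge0 ?mulr_ge0.
move=> x dx; have /andP[s0 s1] := sg01 dx; have h1 := hK x dx; have h2 := hL x dx.
have -> : f x *: X x - l *: v = (f x - l) *: (X x - v) + l *: (X x - v) + (f x - l) *: v.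
  by rewrite -scalerDl subrK scalerBl scalerBr addrA subrK.
apply: le_trans (vnD _ _) _; have := vnD ((f x - l) *: (X x - v)) (l *: (X x - v)).
rewrite !vnZ.
have e1 : nm (f x - l) * vn (X x - v) <= K * L * sg x.
  apply: le_trans (ler_pM (nm_ge0 _) (vn_ge0 _) h1 h2) _.
  rewrite mulrACA ler_wpM2l ?mulr_ge0 // -[X in _ <= X]mulr1 ler_wpM2l //.
have e2 := ler_wpM2l l0 h2; have e3 := ler_wpM2r m0 h1.
lra.
Qed.

Lemma near_hform r s t (X Y : T -> 'rV[C]_(r + s + t)) v w : vnear X v -> vnear Y w ->
  near (fun x => hform (X x) (Y x)) (hform v w).
Proof.
move=> [K K0 hK] [L L0 hL]; have l0 := vn_ge0 v; have m0 := vn_ge0 w.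
exists (K * L + vn v * L + K * vn w); first by rewrite !addr_ge0 ?mulr_ge0.
move=> x dx; have /andP[s0 s1] := sg01 dx; have h1 := hK x dx; have h2 := hL x dx.
have -> : hform (X x) (Y x) - hform v w =
   hform (X x - v) (Y x - w) + hform v (Y x - w) + hform (X x - v) w.
  by rewrite !(hformBl, hformBr); ring.
apply: le_trans (nmD _ _) _; have := nmD (hform (X x - v) (Y x - w)) (hform v (Y x - w)).
have e1 : vn (X x - v) * vn (Y x - w) <= K * L * sg x.
  apply: le_trans (ler_pM (vn_ge0 _) (vn_ge0 _) h1 h2) _.
  rewrite mulrACA ler_wpM2l ?mulr_ge0 // -[X in _ <= X]mulr1 ler_wpM2l //.
have e2 := ler_wpM2l l0 h2; have e3 := ler_wpM2r m0 h1.
have i1 := nm_hform (X x - v) (Y x - w); have i2 := nm_hform v (Y x - w).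
have i3 := nm_hform (X x - v) w.
lra.
Qed.

Lemma vnear_small n (X : T -> 'rV[C]_n) v (e : R) : vnear X v -> 0 < e ->
  exists2 d : R, 0 < d & forall x, dom x -> sg x < d -> vn (X x - v) < e.
Proof.
move=> [K K0 hK] e0; have K1 : 0 < K + 1 by lra.
exists (e / (K + 1)) => [|x dx]; first exact: divr_gt0.
rewrite ltr_pdivlMr // => h; apply: le_lt_trans (hK x dx) _.
by have /andP[s0 _] := sg01 dx; lra.
Qed.

Lemma near_small f l (e : R) : near f l -> 0 < e ->
  exists2 d : R, 0 < d & forall x, dom x -> sg x < d -> nm (f x - l) < e.
Proof.
move=> [K K0 hK] e0; have K1 : 0 < K + 1 by lra.
exists (e / (K + 1)) => [|x dx]; first exact: divr_gt0.
rewrite ltr_pdivlMr // => h; apply: le_lt_trans (hK x dx) _.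
by have /andP[s0 _] := sg01 dx; lra.
Qed.

End Near.

(** * Null planes and their complexification *)

Section Planes.
Variable R : realType.
Local Notation C := (complex R).

(** The determinant of a 3 by 3 matrix, listed by rows. *)
Definition d3 (a b c d e f g h i : C) : C :=
  a * (e * i - f * h) - b * (d * i - f * g) + c * (d * h - e * g).

Lemma d3_dependent (a0 a1 a2 a b c d e f g h i : C) : [|| a0 != 0, a1 != 0 | a2 != 0] ->
  a0 * a + a1 * d + a2 * g = 0 -> a0 * b + a1 * e + a2 * h = 0 ->
  a0 * c + a1 * f + a2 * i = 0 -> d3 a b c d e f g h i = 0.
Proof.
move=> H h1 h2 h3; apply/eqP; case/or3P: H => /mulfI/inj_eq <-; rewrite mulr0; apply/eqP.
- rewrite (_ : _ * _ = (a0 * a + a1 * d + a2 * g) * (e * i - f * h) -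
    (a0 * b + a1 * e + a2 * h) * (d * i - f * g) + (a0 * c + a1 * f + a2 * i) * (d * h - e * g)).
    by rewrite h1 h2 h3; ring.
  by rewrite /d3; ring.
- rewrite (_ : _ * _ = a * ((a0 * b + a1 * e + a2 * h) * i - (a0 * c + a1 * f + a2 * i) * h) -
    b * ((a0 * a + a1 * d + a2 * g) * i - (a0 * c + a1 * f + a2 * i) * g) +
    c * ((a0 * a + a1 * d + a2 * g) * h - (a0 * b + a1 * e + a2 * h) * g)).
    by rewrite h1 h2 h3; ring.
  by rewrite /d3; ring.
- rewrite (_ : _ * _ = a * (e * (a0 * c + a1 * f + a2 * i) - f * (a0 * b + a1 * e + a2 * h)) -
    b * (d * (a0 * c + a1 * f + a2 * i) - f * (a0 * a + a1 * d + a2 * g)) +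
    c * (d * (a0 * b + a1 * e + a2 * h) - e * (a0 * a + a1 * d + a2 * g))).
    by rewrite h1 h2 h3; ring.
  by rewrite /d3; ring.
Qed.

Variables r s t s' t' : nat.
Local Notation V := ('rV[C]_(r + s + t)).
Local Notation W := ('rV[C]_(r + s' + t')).

(** Linear dependence of the three values, expressed by determinants. With fixed [y1], [y2], [y3]
    these are holomorphic along curves, hence accessible to the identity theorem. *)
Definition colin (F : V -> W) (x y z : V) := forall y1 y2 y3 : W,
  d3 (hform (F x) y1) (hform (F x) y2) (hform (F x) y3)
     (hform (F y) y1) (hform (F y) y2) (hform (F y) y3)
     (hform (F z) y1) (hform (F z) y2) (hform (F z) y3) = 0.

Lemma dependent_colin F x y z (a0 a1 a2 : C) : [|| a0 != 0, a1 != 0 | a2 != 0] ->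
  a0 *: F x + a1 *: F y + a2 *: F z = 0 -> colin F x y z.
Proof.
move=> ha E y1 y2 y3.
have H w : a0 * hform (F x) w + a1 * hform (F y) w + a2 * hform (F z) w = 0.
  by rewrite -!hformZl -!hformDl E hform0l.
exact: d3_dependent ha (H y1) (H y2) (H y3).
Qed.

Section Frame.
Variables (p q v u : V) (e : nat -> V).

(** Two orthogonal hyperbolic planes with null bases [p], [q] and [v], [u], and [r - 2] orthonormal
    positive vectors orthogonal to both. The null plane of [p] and [v] is the one to be moved, [q]
    and [u] are dual to it. *)
Definition hyperbolic_frame := [/\
  [/\ hform p p = 0, hform q q = 0, hform v v = 0 & hform u u = 0],
  [/\ hform p q = 1, hform v u = 1, hform p u = 0 & hform v q = 0],
  [/\ hform p v = 0 & hform q u = 0],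
  forall i, (i < r - 2)%N -> [/\ hform (e i) p = 0, hform (e i) q = 0, hform (e i) v = 0 & hform (e i) u = 0] &
  forall i j, (i < r - 2)%N -> (j < r - 2)%N -> hform (e i) (e j) = (i == j)%:R].

Hypothesis HB : hyperbolic_frame.

Let qq : hform q q = 0. Proof. by have [[]] := HB. Qed.
Let uu : hform u u = 0. Proof. by have [[]] := HB. Qed.
Let qu : hform q u = 0. Proof. by have [_ _ []] := HB. Qed.
Let uq : hform u q = 0. Proof. exact: hform_eq0C qu. Qed.

(* The span of [z] and [y] has the basis [pz], [py], dual to [q], [u] up to the factor [pd].
   For real [l] the corrections by [q], [u] make [cz], [cy] span a null plane; they vanish
   at [l = 'i], where [cP z y mu] is a multiple of [z + mu *: y]. *)
Definition pz (z y : V) := hform y u *: z - hform z u *: y.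
Definition py (z y : V) := hform z q *: y - hform y q *: z.
Definition pd (z y : V) := hform z q * hform y u - hform z u * hform y q.
Definition cz (z y : V) (l : C) := (pd z y)^* *: pz z y -
  ((1 + 'i * l) / 2) *: (hform (pz z y) (pz z y) *: q + hform (pz z y) (py z y) *: u).
Definition cy (z y : V) (l : C) := (pd z y)^* *: py z y -
  ((1 + 'i * l) / 2) *: (hform (py z y) (pz z y) *: q + hform (py z y) (py z y) *: u).
Definition cP (z y : V) (mu l : C) :=
  (hform z q + mu * hform y q) *: cz z y l + (hform z u + mu * hform y u) *: cy z y l.

Lemma pz_q z y : hform (pz z y) q = pd z y.
Proof. by rewrite hformBl !hformZl /pd; ring. Qed.
Lemma pz_u z y : hform (pz z y) u = 0.
Proof. by rewrite hformBl !hformZl; ring. Qed.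
Lemma py_q z y : hform (py z y) q = 0.
Proof. by rewrite hformBl !hformZl; ring. Qed.
Lemma py_u z y : hform (py z y) u = pd z y.
Proof. by rewrite hformBl !hformZl /pd; ring. Qed.

Let q_pz z y : hform q (pz z y) = (pd z y)^*. Proof. by rewrite hformC pz_q. Qed.
Let u_pz z y : hform u (pz z y) = 0. Proof. by rewrite hformC pz_u rmorph0. Qed.
Let q_py z y : hform q (py z y) = 0. Proof. by rewrite hformC py_q rmorph0. Qed.
Let u_py z y : hform u (py z y) = (pd z y)^*. Proof. by rewrite hformC py_u. Qed.

Definition hexp := (@hformBl R r s t, @hformBr R r s t, @hformDl R r s t, @hformDr R r s t,
  @hformZl R r s t, @hformZr R r s t).

Lemma cz_q z y l : hform (cz z y l) q = (pd z y)^* * pd z y.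
Proof.
have := pz_q z y; rewrite /cz; move: (pz z y) (py z y) => X Y h.
by rewrite !hexp h qq uq; ring.
Qed.
Lemma cz_u z y l : hform (cz z y l) u = 0.
Proof.
have := pz_u z y; rewrite /cz; move: (pz z y) (py z y) => X Y h.
by rewrite !hexp h qu uu; ring.
Qed.
Lemma cy_q z y l : hform (cy z y l) q = 0.
Proof.
have := py_q z y; rewrite /cy; move: (pz z y) (py z y) => X Y h.
by rewrite !hexp h qq uq; ring.
Qed.
Lemma cy_u z y l : hform (cy z y l) u = (pd z y)^* * pd z y.
Proof.
have := py_u z y; rewrite /cy; move: (pz z y) (py z y) => X Y h.
by rewrite !hexp h qu uu; ring.
Qed.

(** For real [l] the coefficient [c] satisfies [c + conj c = 1], so that in [cz] and [cy] the two
    cross terms with [q] and [u] cancel the original products exactly; at [l = 'i] it is 0. *)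
Let half_conj (l : C) : l^* = l -> ((1 + 'i * l) / 2)^* = 1 - (1 + 'i * l) / 2.
Proof.
by move=> lr; rewrite rmorphM rmorphD rmorph1 rmorphM /= conjCi lr fmorphV rmorph_nat; field.
Qed.

Lemma cz_cz z y l : l^* = l -> hform (cz z y l) (cz z y l) = 0.
Proof.
move=> /half_conj; rewrite /cz; move: (_ / 2) => c hl.
move: (pz_q z y) (pz_u z y) (q_pz z y) (u_pz z y); move: (pd z y) (pz z y) (py z y) => d X Y.
move=> h0 h1 h2 h3.
have Xr : (hform X X)^* = hform X X by rewrite -hformC.
by rewrite !hexp hl qq uu qu uq ?h0 ?h1 ?h2 ?h3 conjCK Xr; ring.
Qed.

Lemma cz_cy z y l : l^* = l -> hform (cz z y l) (cy z y l) = 0.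
Proof.
move=> /half_conj; rewrite /cz /cy; move: (_ / 2) => c hl.
move: (pz_q z y) (pz_u z y) (q_py z y) (u_py z y); move: (pd z y) (pz z y) (py z y) => d X Y.
move=> h0 h1 h2 h3.
have Xr : (hform Y X)^* = hform X Y by rewrite -hformC.
by rewrite !hexp hl qq uu qu uq ?h0 ?h1 ?h2 ?h3 conjCK Xr; ring.
Qed.

Lemma cy_cy z y l : l^* = l -> hform (cy z y l) (cy z y l) = 0.
Proof.
move=> /half_conj; rewrite /cy; move: (_ / 2) => c hl.
move: (py_q z y) (py_u z y) (q_py z y) (u_py z y); move: (pd z y) (pz z y) (py z y) => d X Y.
move=> h0 h1 h2 h3.
have Xr : (hform Y Y)^* = hform Y Y by rewrite -hformC.
by rewrite !hexp hl qq uu qu uq ?h0 ?h1 ?h2 ?h3 conjCK Xr; ring.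
Qed.

Lemma cP_i z y mu : cP z y mu 'i = ((pd z y)^* * pd z y) *: (z + mu *: y).
Proof.
have h0 : (1 + 'i * 'i) / 2 = 0 :> C by rewrite ii subrr mul0r.
rewrite /cP /cz /cy h0 !scale0r !subr0 /pz /py; set d := (pd z y)^*.
apply/rowP => j; rewrite !mxE /pd; ring.
Qed.

Lemma vcd_cP z y mu a : vcd (cP z y mu) a.
Proof.
have hc : cdiff (fun l : C => (1 + 'i * l) / 2) a.
  apply: cdiffM; last exact: cdiff_cst.
  apply: cdiffD; first exact: cdiff_cst.
  by apply: cdiffM; [exact: cdiff_cst|exact: cdiff_id].
apply: vcdD; apply: vcdZ; try exact: cdiff_cst; apply: vcdB; try exact: vcd_cst;
  by apply: vcdZ => //; exact: vcd_cst.
Qed.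

Section NearFrame.
Variables (T : Type) (dom : T -> Prop) (sg : T -> R).
Hypothesis sg01 : forall x, dom x -> 0 <= sg x <= 1.
Variables (z y : T -> V) (mu l : T -> C).
Hypotheses (hz : vnear dom sg z p) (hy : vnear dom sg y v) (hmu : near dom sg mu 0).
Hypothesis hl : bdd dom l.

Let hzq : near dom sg (fun x => hform (z x) q) 1.
Proof.
by apply: near_eq (near_hform sg01 hz (vnear_cst _ _ _)) _; have [_ []] := HB.
Qed.
Let hzu : near dom sg (fun x => hform (z x) u) 0.
Proof.
by apply: near_eq (near_hform sg01 hz (vnear_cst _ _ _)) _; have [_ []] := HB.
Qed.
Let hyq : near dom sg (fun x => hform (y x) q) 0.
Proof.
by apply: near_eq (near_hform sg01 hy (vnear_cst _ _ _)) _; have [_ []] := HB.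
Qed.
Let hyu : near dom sg (fun x => hform (y x) u) 1.
Proof.
by apply: near_eq (near_hform sg01 hy (vnear_cst _ _ _)) _; have [_ []] := HB.
Qed.

Lemma near_pd : near dom sg (fun x => pd (z x) (y x)) 1.
Proof.
apply: near_eq (nearB (nearM sg01 hzq hyu) (nearM sg01 hzu hyq)) _; ring.
Qed.
Let hpz : vnear dom sg (fun x => pz (z x) (y x)) p.
Proof.
apply: vnear_eq (vnearB (vnearZ sg01 hyu hz) (vnearZ sg01 hzu hy)) _.
by rewrite scale1r scale0r subr0.
Qed.
Let hpy : vnear dom sg (fun x => py (z x) (y x)) v.
Proof.
apply: vnear_eq (vnearB (vnearZ sg01 hzq hy) (vnearZ sg01 hyq hz)) _.
by rewrite scale1r scale0r subr0.
Qed.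
Let hc : bdd dom (fun x => (1 + 'i * l x) / 2).
Proof.
move: hl => [K K0 hK]; exists ((1 + K) / 2) => [|x /hK h]; first by lra.
rewrite nmM nmV nm2; have := nmD 1 ('i * l x); rewrite nmM nm_i nm1; lra.
Qed.

Let near_corr f g : near dom sg f 0 -> near dom sg g 0 ->
  vnear dom sg (fun x => ((1 + 'i * l x) / 2) *: (f x *: q + g x *: u)) 0.
Proof.
move=> hf hg.
have := vnearD (vnearZ sg01 (near_bddM hc hf) (vnear_cst dom sg q))
          (vnearZ sg01 (near_bddM hc hg) (vnear_cst dom sg u)).
rewrite !scale0r addr0 => -[K K0 hK]; exists K => // x /hK; rewrite !subr0.
by rewrite scalerDr !scalerA.
Qed.

Lemma vnear_cz : vnear dom sg (fun x => cz (z x) (y x) (l x)) p.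
Proof.
have [[pp _ vv _] _ [pv _] _ _] := HB.
have h1 := near_eq (near_hform sg01 hpz hpz) pp.
have h2 := near_eq (near_hform sg01 hpz hpy) pv.
apply: vnear_eq (vnearB (vnearZ sg01 (near_conj near_pd) hpz) (near_corr h1 h2)) _.
by rewrite subr0 rmorph1 scale1r.
Qed.

Lemma vnear_cy : vnear dom sg (fun x => cy (z x) (y x) (l x)) v.
Proof.
have [[pp _ vv _] _ [pv _] _ _] := HB.
have h1 := near_eq (near_hform sg01 hpy hpz) (hform_eq0C pv).
have h2 := near_eq (near_hform sg01 hpy hpy) vv.
apply: vnear_eq (vnearB (vnearZ sg01 (near_conj near_pd) hpy) (near_corr h1 h2)) _.
by rewrite subr0 rmorph1 scale1r.
Qed.

Lemma vnear_cP : vnear dom sg (fun x => cP (z x) (y x) (mu x) (l x)) p.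
Proof.
have h1 := nearD hzq (nearM sg01 hmu hyq).
have h2 := nearD hzu (nearM sg01 hmu hyu).
apply: vnear_eq (vnearD (vnearZ sg01 h1 vnear_cz) (vnearZ sg01 h2 vnear_cy)) _.
by rewrite mulr0 mul0r !addr0 scale1r scale0r addr0.
Qed.

End NearFrame.

End Frame.
End Planes.

(** * Images of lines near a null point *)

Section Collinearity.
Variable R : realType.
Local Notation C := (complex R).
Variables r s t s' t' : nat.
Local Notation V := ('rV[C]_(r + s + t)).
Local Notation W := ('rV[C]_(r + s' + t')).

Definition orth_germ (F : V -> W) (p : V) (rho : R) := [/\
  0 < rho,
  forall z, vn (z - p) < rho -> exists D, fd F z D,
  forall z c, vn (z - p) < rho -> vn (c *: z - p) < rho -> c != 0 ->
    exists2 mu : C, mu != 0 & F (c *: z) = mu *: F z,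
  forall z, vn (z - p) < rho -> radical_free (F z) &
  (forall z, vn (z - p) < rho -> 0 < hform z z -> 0 < hform (F z) (F z)) /\
  forall z w, vn (z - p) < rho -> vn (w - p) < rho -> hform z w = 0 ->
    hform (F z) (F w) = 0].

Variables (F : V -> W) (p : V) (rho : R).
Hypothesis HF : orth_germ F p rho.
Hypothesis r2 : (2 <= r)%N.

Let rho0 : 0 < rho. Proof. by case: HF. Qed.
Let Hd z : vn (z - p) < rho -> exists D, fd F z D. Proof. by case: HF => _ H _ _ _; exact: H. Qed.
Let Hpr z c : vn (z - p) < rho -> vn (c *: z - p) < rho -> c != 0 ->
    exists2 mu : C, mu != 0 & F (c *: z) = mu *: F z.
Proof. by case: HF => _ _ H _ _; exact: H. Qed.
Let Hrf z : vn (z - p) < rho -> radical_free (F z). Proof. by case: HF => _ _ _ H _; exact: H. Qed.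
Let Hpos z : vn (z - p) < rho -> 0 < hform z z -> 0 < hform (F z) (F z).
Proof. by case: HF => _ _ _ _ [H _]; exact: H. Qed.
Let Horth z w : vn (z - p) < rho -> vn (w - p) < rho -> hform z w = 0 -> hform (F z) (F w) = 0.
Proof. by case: HF => _ _ _ _ [_ H]; exact: H. Qed.

Lemma small_step (I : finType) (h : I -> V) z : vn (z - p) < rho ->
  exists2 e : R, 0 < e & forall i, vn (z + e%:C%C *: h i - p) < rho.
Proof.
move=> hz; pose S := \sum_i vn (h i).
have S0 : 0 <= S by apply: sumr_ge0 => i _; exact: vn_ge0.
have S1 : 0 < S + 1 by lra.
pose e := (rho - vn (z - p)) / (S + 1).
have e0 : 0 < e by apply: divr_gt0; lra.
exists e => // i; rewrite addrAC; apply: le_lt_trans (vnD _ _) _.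
rewrite vnZ nm_real gtr0_norm //.
have h1 : vn (h i) <= S by rewrite /S (bigD1 i) //= lerDl sumr_ge0 // => j _; exact: vn_ge0.
have h2 := ler_wpM2l (ltW e0) h1.
have : e * (S + 1) = rho - vn (z - p) by rewrite /e divfK // gt_eqF.
lra.
Qed.

Variables (q v u : V) (e : nat -> V).
Hypothesis HB : hyperbolic_frame p q v u e.

(** Points of a null plane have null and mutually orthogonal images. Corrected along [q] and [u],
    the [e j] become orthogonal to the plane; adding small multiples of them to one of its points
    gives [r - 2] positive vectors inside the ball, orthogonal to the plane and to each other, and
    [three_null_dependent] applies to the images. *)
Lemma null_plane_dependent X Y (D : C) (a b : nat -> C) : D != 0 ->
  hform X X = 0 -> hform X Y = 0 -> hform Y Y = 0 ->
  hform X q = D -> hform X u = 0 -> hform Y q = 0 -> hform Y u = D ->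
  (forall i, (i < 3)%N -> vn (a i *: X + b i *: Y - p) < rho) ->
  exists a0 a1 a2 : C, [|| a0 != 0, a1 != 0 | a2 != 0] /\
    a0 *: F (a 0%N *: X + b 0%N *: Y) + a1 *: F (a 1%N *: X + b 1%N *: Y) +
    a2 *: F (a 2%N *: X + b 2%N *: Y) = 0.
Proof.
move=> D0 XX XY YY Xq Xu Yq Yu hP.
have [[_ qq _ uu] _ [_ qu] he1 he2] := HB.
have uq := hform_eq0C qu; have YX := hform_eq0C XY.
pose P i := a i *: X + b i *: Y.
pose e' j := e j - (hform X (e j) / D)^* *: q - (hform Y (e j) / D)^* *: u.
have Xe j : hform X (e' j) = 0.
  by rewrite /e' !hformBr !hformZr !conjCK Xq Xu; field.
have Ye j : hform Y (e' j) = 0.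
  by rewrite /e' !hformBr !hformZr !conjCK Yq Yu; field.
have ee i j : (i < r - 2)%N -> (j < r - 2)%N -> hform (e' i) (e' j) = (i == j)%:R.
  move=> hi hj; rewrite -(he2 i j hi hj) /e'.
  have [_ eq _ eu] := he1 i hi; have [_ eq' _ eu'] := he1 j hj.
  have qe := hform_eq0C eq'; have ue := hform_eq0C eu'.
  rewrite !hformBr !hformBl !hformZr !hformZl qq uu qu uq eq eu qe ue; ring.
have PX i : hform (P i) X = 0 by rewrite hformDl !hformZl XX YX !mulr0 addr0.
have PY i : hform (P i) Y = 0 by rewrite hformDl !hformZl XY YY !mulr0 addr0.
have PP i j : hform (P i) (P j) = 0 by rewrite {2}/P hformDr !hformZr PX PY !mulr0 addr0.
have Pe i j : hform (P i) (e' j) = 0 by rewrite hformDl !hformZl Xe Ye !mulr0 addr0.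
have eP i j : hform (e' j) (P i) = 0 by exact: hform_eq0C.
have [ep ep0 hep] := @small_step 'I_(r - 2) (fun j => e' j) (P 0%N) (hP 0%N isT).
pose w j := P 0%N + ep%:C%C *: e' j.
have hw j : (j < r - 2)%N -> vn (w j - p) < rho by move=> hj; exact: (hep (Ordinal hj)).
have epr : (ep%:C%C)^* = ep%:C%C :> C by exact: conjc_real.
have ww i j : (i < r - 2)%N -> (j < r - 2)%N -> hform (w i) (w j) = ep%:C%C ^+ 2 * (i == j)%:R.
  move=> hi hj; have := PP 0%N 0%N; have := Pe 0%N j; have := eP 0%N i; have := ee i j hi hj.
  rewrite /w; move: (P 0%N) (e' i) (e' j) => X0 E1 E2 h1 h2 h3 h4.
  by rewrite !hformDr !hformDl !hformZr !hformZl h1 h2 h3 h4 epr; ring.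
have wP j i : hform (w j) (P i) = 0 by rewrite hformDl hformZl PP eP mulr0 addr0.
apply: (@three_null_dependent R r s' t' (fun i => F (P i)) (fun j => F (w j))) => //.
- by move=> i hi; apply: Hrf; exact: hP.
- by move=> i j hi hj; apply: Horth; rewrite ?PP //; exact: hP.
- move=> i hi; split; first by apply: Hrf; exact: hw.
  apply: Hpos; first exact: hw.
  by rewrite ww // eqxx mulr1 exprn_gt0 // ltcR.
- by move=> i j hi hj; apply: Horth; rewrite ?wP //; [exact: hw|exact: hP].
- move=> i j hi hj ij; apply: Horth; [exact: hw|exact: hw|].
  by rewrite ww // (negbTE ij) mulr0.
Qed.

Lemma cdiff_d3 (f : nat -> nat -> C -> C) (a : C) : (forall i j, cdiff (f i j) a) ->
  cdiff (fun l => d3 (f 0%N 0%N l) (f 0%N 1%N l) (f 0%N 2%N l) (f 1%N 0%N l) (f 1%N 1%N l)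
     (f 1%N 2%N l) (f 2%N 0%N l) (f 2%N 1%N l) (f 2%N 2%N l)) a.
Proof.
move=> h; rewrite /d3.
by apply: cdiffD; [apply: cdiffB|]; apply: cdiffM => //; apply: cdiffB; apply: cdiffM.
Qed.

(** [I] stands for the vanishing assumption of an identity theorem, on the reals or on a disc, so
    that both share the argument for differentiability. *)
Lemma colin_zero_on (I : (C -> C) -> Prop) (Z0 Z1 Z2 : C -> V) (l0 : C) :
  (forall g, (forall l, nm l < 30 -> cdiff g l) -> I g -> g l0 = 0) ->
  (forall l, nm l < 30 -> [/\ vn (Z0 l - p) < rho, vn (Z1 l - p) < rho & vn (Z2 l - p) < rho]) ->
  (forall l, [/\ vcd Z0 l, vcd Z1 l & vcd Z2 l]) ->
  (forall y1 y2 y3, I (fun l =>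
   d3 (hform (F (Z0 l)) y1) (hform (F (Z0 l)) y2) (hform (F (Z0 l)) y3)
     (hform (F (Z1 l)) y1) (hform (F (Z1 l)) y2) (hform (F (Z1 l)) y3)
     (hform (F (Z2 l)) y1) (hform (F (Z2 l)) y2) (hform (F (Z2 l)) y3))) ->
  colin F (Z0 l0) (Z1 l0) (Z2 l0).
Proof.
move=> HI hZ hc HIg y1 y2 y3; apply: (HI _ _ (HIg y1 y2 y3)) => l hl.
have [z0 z1 z2] := hZ l hl; have [c0 c1 c2] := hc l.
have [D0 hD0] := Hd z0; have [D1 hD1] := Hd z1; have [D2 hD2] := Hd z2.
pose y j := if j == 0%N then y1 else if j == 1%N then y2 else y3.
pose Z i := if i == 0%N then Z0 else if i == 1%N then Z1 else Z2.
apply: (@cdiff_d3 (fun i j l => hform (F (Z i l)) (y j))) => i j.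
apply: cdiff_hform; rewrite /Z; case: ifP => _; [|case: ifP => _].
- exact: vcd_comp hD0 c0.
- exact: vcd_comp hD1 c1.
- exact: vcd_comp hD2 c2.
Qed.

Lemma d3_scale (m n k a b c d f g h i j : C) :
  d3 (m * a) (m * b) (m * c) (n * d) (n * f) (n * g) (k * h) (k * i) (k * j) =
  m * n * k * d3 a b c d f g h i j.
Proof. by rewrite /d3; ring. Qed.

Lemma colin_scale (x y z : V) (a b d : C) : a != 0 -> b != 0 -> d != 0 ->
  vn (x - p) < rho -> vn (y - p) < rho -> vn (z - p) < rho ->
  vn (a *: x - p) < rho -> vn (b *: y - p) < rho -> vn (d *: z - p) < rho ->
  colin F (a *: x) (b *: y) (d *: z) -> colin F x y z.
Proof.
move=> a0 b0 d0 hx hy hz hx' hy' hz' H y1 y2 y3.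
have [m m0 Em] := Hpr hx hx' a0; have [n n0 En] := Hpr hy hy' b0.
have [k k0 Ek] := Hpr hz hz' d0.
have := H y1 y2 y3; rewrite Em En Ek !hformZl d3_scale => /eqP.
by rewrite !mulf_eq0 (negbTE m0) (negbTE n0) (negbTE k0) /= => /eqP.
Qed.

(** For real [l] the points [cP] lie in a null plane, so the determinants vanish; at [l = 'i] the
    same points are multiples of [z], [z + m1 *: y], [z + m2 *: y], and the plane of [z] and [y] is
    any plane close to that of [p] and [v]. *)
Lemma colin_open : exists2 d : R, 0 < d & forall z y (m1 m2 : C), vn (z - p) < d ->
  vn (y - v) < d -> nm m1 < d -> nm m2 < d -> colin F z (z + m1 *: y) (z + m2 *: y).
Proof.
pose T := ((V * V) * (C * C))%type.
pose sg (x : T) : R := vn (x.1.1 - p) + vn (x.1.2 - v) + nm x.2.1.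
pose dom (x : T) := sg x <= 1 /\ nm x.2.2 < 30.
have sg0 x : 0 <= sg x by rewrite /sg !addr_ge0 ?vn_ge0 ?nm_ge0.
have sg01 x : dom x -> 0 <= sg x <= 1 by move=> [h _]; rewrite sg0.
have hz : vnear dom sg (fun x : T => x.1.1) p.
  exists 1 => // x _; rewrite mul1r /sg; have := vn_ge0 (x.1.2 - v); have := nm_ge0 x.2.1; lra.
have hy : vnear dom sg (fun x : T => x.1.2) v.
  exists 1 => // x _; rewrite mul1r /sg; have := vn_ge0 (x.1.1 - p); have := nm_ge0 x.2.1; lra.
have hm : near dom sg (fun x : T => x.2.1) 0.
  exists 1 => // x _; rewrite mul1r subr0 /sg.
  have := vn_ge0 (x.1.1 - p); have := vn_ge0 (x.1.2 - v); lra.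
have hl : bdd dom (fun x : T => x.2.2) by exists 30 => // x [_ /ltW].
have [d1 d10 h1] := vnear_small sg01 (vnear_cP HB sg01 hz hy hm hl) rho0.
have hzy : vnear dom sg (fun x : T => x.1.1 + x.2.1 *: x.1.2) p.
  by apply: vnear_eq (vnearD hz (vnearZ sg01 hm hy)) _; rewrite scale0r addr0.
have [d2 d20 h2] := vnear_small sg01 hzy rho0.
have [d3 d30 h3] := near_small sg01 (near_pd HB sg01 hz hy) ltr01.
(* [sg] is a sum of three terms, each below [d]. *)
pose d := Num.min (Num.min 1 d1) (Num.min d2 d3) / 3.
have m0 : 0 < Num.min (Num.min 1 d1) (Num.min d2 d3) by rewrite !lt_min ltr01 d10 d20 d30.
exists d; first by rewrite /d; lra.
move=> z y m1 m2 hz' hy' hm1 hm2.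
have sgb (m l : C) : nm m < d -> sg ((z, y), (m, l)) < Num.min (Num.min 1 d1) (Num.min d2 d3).
  by move=> h; rewrite /sg /=; rewrite /d in hz' hy' h *; lra.
have A (m l : C) : nm m < d -> nm l < 30 -> [/\ vn (cP q u z y m l - p) < rho,
   vn (z + m *: y - p) < rho & pd q u z y != 0].
  move=> hm' hl'; have := sgb m l hm'; rewrite !lt_min => /andP[/andP[s1 s2] /andP[s3 s4]].
  have dx : dom ((z, y), (m, l)) by split=> //; exact: ltW.
  split; [exact: (h1 _ dx)|exact: (h2 _ dx)|].
  by have := h3 _ dx s4; apply: contraTneq => /= ->; rewrite sub0r nmN nm1 ltxx.
have d0 : 0 < d by rewrite /d; lra.
have z0 : nm (0 : C) < d by rewrite nm0.
have n0 : nm (0 : C) < 30 by rewrite nm0.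
have [_ hz1 pd0] := A 0 0 z0 n0; rewrite scale0r addr0 in hz1.
have i30 : nm ('i : C) < 30 by rewrite nm_i; lra.
pose D := (pd q u z y)^* * pd q u z y.
have D0 : D != 0 by rewrite mulf_neq0 ?conjC_eq0.
have key : colin F (cP q u z y 0 'i) (cP q u z y m1 'i) (cP q u z y m2 'i).
  apply: (@colin_zero_on (fun g => forall x : R, nm (x%:C%C : C) < 30 -> g x%:C%C = 0)).
  - by move=> g g1 g2; exact: zero_on_reals.
  - move=> l hl'; have [a0 _ _] := A 0 l z0 hl'; have [a1 _ _] := A m1 l hm1 hl'.
    have [a2 _ _] := A m2 l hm2 hl'; exact: And3 a0 a1 a2.
  - by move=> l; split; exact: vcd_cP.
  - move=> y1 y2 y3 x hx.
    have xr : (x%:C%C)^* = x%:C%C :> C by exact: conjc_real.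
    pose mm i := if i == 0%N then 0 else if i == 1%N then m1 else m2.
    have hP i : (i < 3)%N -> vn ((hform z q + mm i * hform y q) *: cz q u z y x%:C%C +
        (hform z u + mm i * hform y u) *: cy q u z y x%:C%C - p) < rho.
      move=> _; have hmi : nm (mm i) < d by rewrite /mm; case: ifP => _ //; case: ifP.
      by have [] := A (mm i) x%:C%C hmi hx.
    have [a0 [a1 [a2 [ha E]]]] := null_plane_dependent D0 (cz_cz HB z y xr) (cz_cy HB z y xr)
      (cy_cy HB z y xr) (cz_q HB z y _) (cz_u HB z y _) (cy_q HB z y _) (cy_u HB z y _) hP.
    exact: (dependent_colin ha E).
move: key; rewrite !cP_i scale0r addr0 -/D.
have [c0 _ _] := A 0 'i z0 i30; have [c1 e1 _] := A m1 'i hm1 i30.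
have [c2 e2 _] := A m2 'i hm2 i30.
rewrite cP_i scale0r addr0 in c0; rewrite cP_i in c1; rewrite cP_i in c2.
exact: (colin_scale D0 D0 D0 hz1 e1 e2 c0 c1 c2).
Qed.

(** Directions near [v] reach all others by continuation: [Z l] runs from [p] to [z], and [Wl l]
    from [p + dc *: v] to [w]. For small [l] the direction of the line through them is close to that
    of [v], where [colin_open] applies, and the disc version of the identity theorem leads to
    [l = 1]. *)
Lemma colin_near : exists2 rho2 : R, 0 < rho2 <= rho & forall z w (a : C),
  vn (z - p) < rho2 -> vn (w - p) < rho2 -> nm a <= 1 -> colin F z w (z + a *: (w - z)).
Proof.
have [d d0 hd] := colin_open.
(* For [nm l < 30] the three points stay within [121 * rho2] of [p]; 200 is a safe choice. *)
have [rho2 r20 r2E] : exists2 rho2 : R, 0 < rho2 & 200 * rho2 = rho.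
  by exists (rho / 200); have := rho0; lra.
exists rho2; first by rewrite r20 /=; lra.
have v0 := vn_ge0 v; have v1 : 0 < vn v + 1 by lra.
have [dr [dr0 dr1 dr2]] : exists dr : R, [/\ 0 < dr, dr < d & dr * vn v <= rho2].
  exists (Num.min (d / 2) (rho2 / (vn v + 1))); split.
  - by rewrite lt_min !divr_gt0.
  - by apply: (@le_lt_trans _ _ (d / 2)); [rewrite ge_min lexx|lra].
  - have : Num.min (d / 2) (rho2 / (vn v + 1)) <= rho2 / (vn v + 1) by rewrite ge_min lexx orbT.
    have : 0 < Num.min (d / 2) (rho2 / (vn v + 1)) by rewrite lt_min !divr_gt0.
    by move: (Num.min _ _) => m m0; rewrite ler_pdivlMr //; lra.
have [dc ndc dc0] : exists2 dc : C, nm dc = dr & dc != 0.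
  exists dr%:C%C; first by rewrite nm_real gtr0_norm.
  apply: contraTneq dr0 => E; have : nm (dr%:C%C : C) = 0 by rewrite E nm0.
  by rewrite nm_real => /normr0P/eqP ->; rewrite ltxx.
move=> z w a hz hw ha.
have [h hE] : exists h : V, h = w - p - dc *: v by eexists.
have [Z ZE] : exists Z : C -> V, forall l, Z l = p + l *: (z - p).
  by exists (fun l => p + l *: (z - p)).
have [Wl WlE] : exists Wl : C -> V, forall l, Wl l = (p + dc *: v) + l *: h.
  by exists (fun l => (p + dc *: v) + l *: h).
have [X XE] : exists X : C -> V, forall l, X l = Z l + a *: (Wl l - Z l).
  by exists (fun l => Z l + a *: (Wl l - Z l)).
have e1 : Z 1 = z by rewrite ZE; apply/rowP => j; rewrite !mxE; ring.
have e2 : Wl 1 = w by rewrite WlE hE; apply/rowP => j; rewrite !mxE; ring.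
have -> : z + a *: (w - z) = X 1 by rewrite XE e1 e2.
rewrite -{1}e1 -{1}e2.
have nh : vn h <= 2 * rho2.
  by rewrite hE; apply: le_trans (vnD _ _) _; rewrite vnN vnZ ndc; move: (vn _) hw => y; lra.
apply: (@colin_zero_on (fun g => exists2 e : R, 0 < e & forall l, nm l < e -> g l = 0)).
- by move=> g g1 [e0 e00 g2]; exact: zero_on_disc e00 g2 g1.
- move=> l hl; have l0 := nm_ge0 l.
  have b1 : vn (Z l - p) <= 30 * rho2.
    rewrite ZE addrAC subrr add0r vnZ; apply: ler_pM; rewrite ?vn_ge0 //; exact: ltW.
  have b2 : vn (Wl l - p) <= 61 * rho2.
    have -> : Wl l - p = dc *: v + l *: h by rewrite WlE; apply/rowP => j; rewrite !mxE; ring.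
    apply: le_trans (vnD _ _) _; rewrite !vnZ ndc.
    have : nm l * vn h <= 30 * (2 * rho2) by apply: ler_pM; rewrite ?vn_ge0 // ltW.
    by lra.
  have b3 : vn (X l - p) <= 121 * rho2.
    rewrite XE addrAC; apply: le_trans (vnD _ _) _; rewrite vnZ.
    have : nm a * vn (Wl l - Z l) <= 1 * vn (Wl l - Z l) by rewrite ler_wpM2r ?vn_ge0.
    have := vn_triangle (Wl l) p (Z l); rewrite (vnC p).
    lra.
  move: b1 b2 b3; move: (vn (Z l - p)) (vn (Wl l - p)) (vn (X l - p)) => m1 m2 m3 b1 b2 b3.
  by split; lra.
- have c1 l : vcd Z l.
    by rewrite (_ : Z = (fun l => p + l *: (z - p))); [exact: vcd_line|exact: funext].
  have c2 l : vcd Wl l.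
    by rewrite (_ : Wl = (fun l => (p + dc *: v) + l *: h)); [exact: vcd_line|exact: funext].
  move=> l; split=> //.
  rewrite (_ : X = (fun l => Z l + a *: (Wl l - Z l))); last exact: funext.
  exact: (vcdD (c1 l) (vcdZ (cdiff_cst a l) (vcdB (c2 l) (c1 l)))).
- move=> y1 y2 y3.
  (* Makes [Wl l - Z l] equal to [dc *: (v + l *: g)], with direction close to [v] for small [l]. *)
  have [g gE] : exists g : V, h = (z - p) + dc *: g.
    exists (dc^-1 *: (h - (z - p))); rewrite scalerA mulfV // scale1r.
    by rewrite addrC subrK.
  have g0 := vn_ge0 g; have g1 : 0 < vn g + 1 by lra.
  have r21 : 0 < rho2 + 1 by lra.
  exists (Num.min (d / (rho2 + 1)) (d / (vn g + 1))).
    by rewrite lt_min !divr_gt0.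
  move=> l; rewrite lt_min => /andP[l1 l2].
  have l0 := nm_ge0 l.
  rewrite ltr_pdivlMr // in l2; rewrite ltr_pdivlMr // in l1.
  have WE : Wl l = Z l + dc *: (v + l *: g).
    rewrite WlE ZE gE; apply/rowP => j; rewrite !mxE; ring.
  have XE' : X l = Z l + (a * dc) *: (v + l *: g).
    rewrite XE WE; apply/rowP => j; rewrite !mxE; ring.
  rewrite WE XE'; apply: hd.
  - rewrite ZE addrAC subrr add0r vnZ.
    apply: le_lt_trans (_ : nm l * rho2 < d); first by rewrite ler_wpM2l // ltW.
    by move: (nm l) l0 l1 => m; lra.
  - rewrite addrAC subrr add0r vnZ.
    by move: (nm l) (vn g) l0 l2 => m m'; lra.
  - by rewrite ndc.
  - rewrite nmM ndc; apply: le_lt_trans (_ : 1 * dr < d); last by rewrite mul1r.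
    by rewrite ler_wpM2r // ltW.
Qed.

End Collinearity.

(** * Local linearity *)

Section Configuration.
Variable R : realType.
Local Notation C := (complex R).
Variables r s t s' t' : nat.
Local Notation V := ('rV[C]_(r + s + t)).
Local Notation W := ('rV[C]_(r + s' + t')).

(** An orthogonal system that realizes all [r] positive squares in the complement of a negative
    vector, placed entirely in the small ball where [F] can be applied. *)
Definition config (p z : V) (w : nat -> V) (rr : R) := [/\
  vn (z - p) < rr, hform z z < 0,
  forall i, (i < r)%N -> [/\ vn (w i - p) < rr, 0 < hform (w i) (w i) & hform (w i) z = 0] &
  forall i j, (i < r)%N -> (j < r)%N -> i != j -> hform (w i) (w j) = 0].

(* The correction along [z] keeps [w 0] orthogonal to the new centre [z + l *: w 0]. *)
Definition perturb0 (z : V) (w : nat -> V) (l : C) (i : nat) : V :=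
  if i == 0%N then w 0%N - (l^* * (hform (w 0%N) (w 0%N) / hform z z)) *: z else w i.

Lemma pos_nm (x : C) : 0 < x -> x = (nm x)%:C%C.
Proof. by move=> h; rewrite -nmE gtr0_norm. Qed.
Lemma neg_nm (x : C) : x < 0 -> x = - (nm x)%:C%C.
Proof. by move=> h; rewrite -nmE ltr0_norm // opprK. Qed.

Lemma config_perturb p z w rr : (2 <= r)%N -> config p z w rr ->
  exists2 d : R, 0 < d & forall l, nm l < d -> config p (z + l *: w 0%N) (perturb0 z w l) rr.
Proof.
move=> r2 [hz zz hw ww]; have r0 : (0 < r)%N by exact: leq_trans r2.
have [hw0 w00 w0z] := hw 0%N r0; have zw0 := hform_eq0C w0z.
have [z0 w0] : exists z0 : V, z0 = z by eexists.
move: hw0 w00 w0z zw0; have [x xE] : exists x : V, x = w 0%N by eexists.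
rewrite -xE => hx xx xz zx.
have [K K0 KE] : exists2 K : R, 0 < K & hform x x = K%:C%C.
  by exists (nm (hform x x)); [apply: nm_gt0; rewrite gt_eqF|exact: pos_nm].
have [k k0 kE] : exists2 k : R, 0 < k & hform z z = - k%:C%C.
  by exists (nm (hform z z)); [apply: nm_gt0; rewrite lt_eqF|exact: neg_nm].
have vx := vn_ge0 x; have vz := vn_ge0 z.
have d1 : 0 < (rr - vn (z - p)) / (vn x + 1) by apply: divr_gt0; lra.
have den : 0 < K / k * vn z + 1.
  by rewrite ltr_wpDl // mulr_ge0 // divr_ge0 // ltW.
have d2 : 0 < (rr - vn (x - p)) / (K / k * vn z + 1) by apply: divr_gt0; [lra|exact: den].
have d3 : 0 < Num.min 1 (k / K) by rewrite lt_min ltr01 divr_gt0.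
(* The bounds 1 and [k / K] give [nm l ^+ 2 * K < k]: the new centre stays negative and the
   corrected [w 0] positive. The other two keep both in the ball. *)
exists (Num.min (Num.min 1 (k / K))
  (Num.min ((rr - vn (z - p)) / (vn x + 1)) ((rr - vn (x - p)) / (K / k * vn z + 1)))).
  by rewrite lt_min d3 lt_min d1 d2.
move=> l; rewrite !lt_min => /andP[/andP[l1 l2] /andP[l3 l4]].
have l0 := nm_ge0 l.
have {}l2 : nm l ^+ 2 * K < k.
  rewrite ltr_pdivlMr // in l2; apply: le_lt_trans l2; rewrite ler_wpM2r ?(ltW K0) //.
  by rewrite expr2 ler_piMl // ltW.
have [N NE ll] : exists2 N : R, N = nm l ^+ 2 & l * l^* = N%:C%C.
  by exists (nm l ^+ 2) => //; rewrite -normCK nmE rmorphXn.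
rewrite -NE in l2.
have neg : hform (z + l *: x) (z + l *: x) = (N * K - k)%:C%C.
  rewrite !hformDr !hformDl !hformZr !hformZl xz zx KE kE realCD realCN realCM -ll; ring.
have [c cE] : exists c : C, c = l^* * (hform x x / hform z z) by eexists.
have kn : k%:C%C != 0 :> C by rewrite -[0]/(0%:C%C) (inj_eq (@complexI R)) gt_eqF.
have ck : c * hform z z = l^* * hform x x by rewrite cE kE; field.
have cc : c^* * hform z z = l * hform x x.
  by rewrite -(conjCK l) -(hform_real z) -rmorphM ck rmorphM /= hform_real.
have wp0 : perturb0 z w l 0%N = x - c *: z by rewrite /perturb0 eqxx -xE cE.
have wpS i : i != 0%N -> perturb0 z w l i = w i by rewrite /perturb0 => /negbTE->.
split.
- rewrite addrAC; apply: le_lt_trans (vnD _ _) _; rewrite vnZ.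
  rewrite ltr_pdivlMr in l3; last by lra.
  lra.
- by rewrite neg -[0]/(0%:C%C) ltcR; lra.
- move=> i ir; have [->|i0] := eqVneq i 0%N; last first.
    have [a b c'] := hw i ir; rewrite (wpS i i0); split; [exact: a|exact: b|].
    by rewrite hformDr hformZr c' xE (ww i 0%N ir r0 i0) mulr0 addr0.
  rewrite wp0; split.
  + rewrite addrAC; apply: le_lt_trans (vnD _ _) _; rewrite vnN vnZ.
    have -> : nm c = nm l * (K / k).
      rewrite cE nmM nm_conj nmM nmV KE kE nmN !nm_real !gtr0_norm //.
    rewrite (ltr_pdivlMr _ _ den) in l4.
    by move: (K / k) (vn z) (vn (x - p)) l4 l0 => m1 m2 m3; lra.
  + have -> : hform (x - c *: z) (x - c *: z) = (K / k * (k - N * K))%:C%C.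
      rewrite !hformBr !hformBl !hformZr !hformZl xz zx !mulr0 !subr0 sub0r opprK.
      rewrite mulrCA cc cE KE kE.
      rewrite !(realCM, realCD, realCN, fmorphV) -ll; field.
      exact: kn.
    rewrite -[0]/(0%:C%C) ltcR; apply: mulr_gt0; first exact: divr_gt0 K0 k0.
    by rewrite subr_gt0.
  + rewrite !hformDr !hformBl !hformZr !hformZl xz zx mulr0 ck; ring.
- have w0i i : (i < r)%N -> i != 0%N -> hform (x - c *: z) (w i) = 0.
    move=> ir i0; have [_ _ a] := hw i ir.
    by rewrite hformBl hformZl xE (hform_eq0C (ww i 0%N ir r0 i0)) (hform_eq0C a) mulr0 subr0.
  move=> i j ir jr ij; have [iE|i0] := eqVneq i 0%N.
    have j0 : j != 0%N by rewrite -iE eq_sym.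
    by rewrite iE wp0 (wpS j j0); exact: w0i jr j0.
  have [jE|j0] := eqVneq j 0%N.
    by rewrite jE wp0 (wpS i i0); exact: (hform_eq0C (w0i i ir i0)).
  by rewrite (wpS i i0) (wpS j j0); exact: ww i j ir jr ij.
Qed.

(** For orthonormal [f i] orthogonal to [p], the [r - 1] vectors [p + ep f_i] are orthogonal and
    positive, and [p + ep b] with [<b, b> = -1] is negative. The last positive vector needs the dual
    direction [q]: since [<g, p> = ep] and [<g, f_i> = <g, b> = -1], the vector [p + k g] is
    orthogonal to all the others, with square [2 k ep + k ^ 2 (r - 2)]. *)
Lemma config_exists (p q v u : V) e (rr : R) : (2 <= r)%N -> 0 < rr ->
  hyperbolic_frame p q v u e -> exists z w, config p z w rr.
Proof.
move=> r2 rr0 [[pp qq vv uu] [pq vu pu vq] [pv qu] he1 he2].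
have h2 : (2^-1)^* = 2^-1 :> C by rewrite fmorphV rmorph_nat.
have up := hform_eq0C pu; have qv := hform_eq0C vq; have vp := hform_eq0C pv.
have uq := hform_eq0C qu.
have qp : hform q p = 1 by rewrite hformC pq rmorph1.
have uv : hform u v = 1 by rewrite hformC vu rmorph1.
have [b bE] : exists b, b = 2^-1 *: v - u by eexists.
have [a aE] : exists a, a = 2^-1 *: v + u by eexists.
have bb : hform b b = -1.
  by rewrite bE !hformBr !hformBl !hformZr !hformZl vv uu vu uv h2; field.
have aa : hform a a = 1.
  by rewrite aE !hformDr !hformDl !hformZr !hformZl vv uu vu uv h2; field.
have ab : hform a b = 0.
  by rewrite aE bE hformBr !hformDl !hformZr !hformZl vv uu vu uv h2; field.
have bp : hform b p = 0 by rewrite bE hformBl hformZl vp up; ring.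
have ap : hform a p = 0 by rewrite aE hformDl hformZl vp up; ring.
have bq : hform b q = 0 by rewrite bE hformBl hformZl vq uq; ring.
have aq : hform a q = 0 by rewrite aE hformDl hformZl vq uq; ring.
have ba := hform_eq0C ab; have pb := hform_eq0C bp; have pa := hform_eq0C ap.
have qb := hform_eq0C bq; have qa := hform_eq0C aq.
pose f i := if i == 0%N then a else e i.-1.
have ff i j : (i < r.-1)%N -> (j < r.-1)%N -> hform (f i) (f j) = (i == j)%:R.
  have r1 : r.-1 = (r - 2).+1 by case: r r2 => [|[|k]] // _; rewrite subSS subn1.
  have ea k : (k < r - 2)%N -> hform (e k) a = 0.
    by move=> /he1[_ _ kv ku]; rewrite aE hformDr hformZr kv ku; ring.
  rewrite r1 /f; case: i => [|i]; case: j => [|j] //= hi hj.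
  - by apply: hform_eq0C; exact: ea.
  - exact: ea.
  - exact: he2.
have fp i : (i < r.-1)%N -> [/\ hform (f i) p = 0, hform (f i) q = 0 & hform (f i) b = 0].
  have r1 : r.-1 = (r - 2).+1 by case: r r2 => [|[|k]] // _; rewrite subSS subn1.
  rewrite r1 /f; case: i => [|i] //= hi; have [ip iq iv iu] := he1 i hi.
  by split=> //; rewrite bE hformBr hformZr iv iu; ring.
have p0 : vn (p - p) < rr by rewrite subrr vn0.
have small (I : finType) (h : I -> V) : exists2 e : R, 0 < e & forall i, vn (p + e%:C%C *: h i - p) < rr.
  pose S := \sum_i vn (h i).
  have S0 : 0 <= S by apply: sumr_ge0 => i _; exact: vn_ge0.
  exists (rr / (S + 1)) => [|i]; first by apply: divr_gt0; lra.
  rewrite addrAC subrr add0r vnZ nm_real gtr0_norm; last by apply: divr_gt0; lra.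
  have h1 : vn (h i) <= S by rewrite /S (bigD1 i) //= lerDl sumr_ge0 // => j _; exact: vn_ge0.
  rewrite mulrAC ltr_pdivrMr; last by lra.
  have := ler_wpM2l (ltW rr0) h1; lra.
have [ep ep0 hep] := @small (option 'I_r.-1) (fun i => if i is Some j then f j else b).
have [g gE] : exists g, g = ep%:C%C *: q - \sum_(i < r.-1) f i + b by eexists.
have [k k0 hk] := @small unit (fun _ => g).
have epr : (ep%:C%C)^* = ep%:C%C :> C by exact: conjc_real.
have kr : (k%:C%C)^* = k%:C%C :> C by exact: conjc_real.
have gf i : (i < r.-1)%N -> hform (f i) g = -1.
  move=> ir; have [_ fq fb] := fp i ir.
  rewrite gE hformDr hformBr hformZr fq fb mulr0 sub0r addr0; congr (- _).
  rewrite hform_sumr (bigD1 (Ordinal ir)) //= ff // eqxx big1 ?addr0 // => j ji.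
  by rewrite ff // eq_sym (negbTE (_ : val j != i)) //; apply: contra ji => /eqP E; apply/eqP/val_inj.
have fpS : hform (\sum_(i < r.-1) f i) p = 0.
  by rewrite hform_suml big1 // => i _; have [] := fp i (ltn_ord i).
have fqS : hform (\sum_(i < r.-1) f i) q = 0.
  by rewrite hform_suml big1 // => i _; have [] := fp i (ltn_ord i).
have fbS : hform (\sum_(i < r.-1) f i) b = 0.
  by rewrite hform_suml big1 // => i _; have [] := fp i (ltn_ord i).
have fgS : hform (\sum_(i < r.-1) f i) g = - (r.-1)%:R.
  rewrite hform_suml (eq_bigr (fun=> -1)) => [|i _]; last exact: gf.
  by rewrite sumr_const card_ord mulNrn.
have gp : hform g p = ep%:C%C by rewrite gE hformDl hformBl hformZl qp fpS bp; ring.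
have gb : hform g b = -1 by rewrite gE hformDl hformBl hformZl qb fbS bb; ring.
have qg : hform q g = 0.
  rewrite gE hformDr hformBr hformZr qq qb (hform_eq0C fqS); ring.
have bg : hform b g = -1 by rewrite hformC gb rmorphN rmorph1.
have gg : hform g g = (r.-1)%:R - 1.
  by rewrite {1}gE hformDl hformBl hformZl qg fgS bg; ring.
exists (p + ep%:C%C *: b), (fun i => if (i < r.-1)%N then p + ep%:C%C *: f i else p + k%:C%C *: g).
split.
- exact: (hep None).
- rewrite !hformDr !hformDl !hformZr !hformZl pp pb bp bb epr.
  have -> : 0 + ep%:C%C * 0 + (ep%:C%C * 0 + ep%:C%C * (ep%:C%C * -1)) = (- (ep * ep))%:C%C :> C.
    by rewrite realCN realCM; ring.
  by rewrite -[0]/(0%:C%C) ltcR oppr_lt0 mulr_gt0.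
- move=> i ir; case: ifP => hi.
    have [ip iq ib] := fp i hi; have pi := hform_eq0C ip.
    split; first exact: (hep (Some (Ordinal hi))).
      rewrite !hformDr !hformDl !hformZr !hformZl pp pi ip ff // eqxx epr.
      have -> : 0 + ep%:C%C * 0 + (ep%:C%C * 0 + ep%:C%C * (ep%:C%C * 1%:R)) = (ep * ep)%:C%C :> C.
        by rewrite realCM; ring.
      by rewrite -[0]/(0%:C%C) ltcR mulr_gt0.
    by rewrite !hformDr !hformDl !hformZr !hformZl pp pb ip ib; ring.
  split; first exact: (hk tt).
    have pg : hform p g = ep%:C%C by rewrite hformC gp.
    rewrite !hformDr !hformDl !hformZr !hformZl pp gp pg gg kr.
    have -> : 0 + k%:C%C * ep%:C%C + (k%:C%C * ep%:C%C + k%:C%C * (k%:C%C * ((r.-1)%:R - 1))) =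
       (2 * (k * ep) + k * k * ((r.-1)%:R - 1))%:C%C :> C.
      by rewrite !(realCD, realCM, realCN, realC1) !rmorph_nat; ring.
    rewrite -[0]/(0%:C%C) ltcR; apply: ltr_wpDr; last by rewrite !mulr_gt0.
    apply: mulr_ge0; first by apply: mulr_ge0; exact: ltW.
    rewrite subr_ge0 ler1n.
    by case: r r2 => [|[|m]].
  by rewrite !hformDr !hformDl !hformZr !hformZl pp pb gp gb epr; ring.
- move=> i j ir jr ij.
  have mixed m : (m < r.-1)%N -> hform (p + ep%:C%C *: f m) (p + k%:C%C *: g) = 0.
    move=> hm; have [mp mq mb] := fp m hm; have pg : hform p g = ep%:C%C by rewrite hformC gp.
    by rewrite !hformDr !hformDl !hformZr !hformZl pp mp pg gf // kr; ring.
  case: ifP => hi; case: ifP => hj.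
  + have [ip _ _] := fp i hi; have [jp _ _] := fp j hj; have pj := hform_eq0C jp.
    have f0 : hform (f i) (f j) = 0 by rewrite ff // (negbTE ij).
    by rewrite !hformDr !hformDl !hformZr !hformZl pp ip pj f0; ring.
  + exact: mixed.
  + by apply: hform_eq0C; exact: mixed.
  + have E m : (m < r)%N -> (m < r.-1)%N = false -> m = r.-1.
      move=> mr /negbT; rewrite -leqNgt => h; apply/eqP; rewrite eqn_leq h andbT.
      by rewrite -ltnS prednK // (leq_trans _ r2).
    by case/eqP: ij; rewrite (E i) // (E j).
Qed.

End Configuration.

(** * A negative point with nondegenerate derivative *)

Section Derivative.
Variable R : realType.
Local Notation C := (complex R).

Lemma is_cd_unique (g : C -> C) (a d d' : C) : is_cd g a d -> is_cd g a d' -> d = d'.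
Proof.
move=> /is_cdP h1 /is_cdP h2; apply: contrapT => /eqP; rewrite -subr_eq0 => /nm_gt0 n0.
have e0 : 0 < nm (d - d') / 3 by lra.
have [d1 d10 H1] := h1 _ e0; have [d2 d20 H2] := h2 _ e0.
have [x [x0 x1 x2]] : exists x : R, [/\ 0 < x, x < d1 & x < d2].
  exists (Num.min d1 d2 / 2).
  have m0 : 0 < Num.min d1 d2 by rewrite lt_min d10.
  have m1 : Num.min d1 d2 <= d1 by rewrite ge_min lexx.
  have m2 : Num.min d1 d2 <= d2 by rewrite ge_min lexx orbT.
  by split; lra.
have nx : nm (x%:C%C : C) = x by rewrite nm_real gtr0_norm.
have := H1 x%:C%C; have := H2 x%:C%C; rewrite nx => /(_ x2) k2 /(_ x1) k1.
have := nmDB (g (a + x%:C%C) - g a - d' * x%:C%C) (g (a + x%:C%C) - g a - d * x%:C%C).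
have -> : g (a + x%:C%C) - g a - d' * x%:C%C - (g (a + x%:C%C) - g a - d * x%:C%C) =
  (d - d') * x%:C%C by ring.
rewrite nmM nx; move: (nm (d - d')) n0 k1 k2 => m m0; move: (nm _) (nm _) => y1 y2 k1 k2 k3.
have : m / 3 * x + m / 3 * x < m * x by have := mulr_gt0 m0 x0; lra.
lra.
Qed.

Variables r s t s' t' : nat.
Local Notation V := ('rV[C]_(r + s + t)).
Local Notation W := ('rV[C]_(r + s' + t')).

Definition good_germ (F : V -> W) (p : V) (rho : R) := orth_germ F p rho /\
  forall z w (a : C), vn (z - p) < rho -> vn (w - p) < rho -> nm a <= 1 ->
    colin F z w (z + a *: (w - z)).

Lemma orth_germ_le (F : V -> W) (p : V) (rho rho2 : R) : 0 < rho2 <= rho -> orth_germ F p rho -> orth_germ F p rho2.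
Proof.
move=> /andP[r20 le] [_ H1 H2 H3 [H4 H5]].
have L (z : V) : vn (z - p) < rho2 -> vn (z - p) < rho by move=> h; exact: lt_le_trans le.
split=> //.
- by move=> z /L; exact: H1.
- by move=> z c /L h1 /L; exact: H2.
- by move=> z /L; exact: H3.
- by split=> [z /L|z w /L h1 /L h2]; [exact: H4|exact: H5].
Qed.

Lemma good_germ_exists (F : V -> W) (p q v u : V) e (rho : R) : (2 <= r)%N -> orth_germ F p rho ->
  hyperbolic_frame p q v u e -> exists2 rho2 : R, 0 < rho2 <= rho & good_germ F p rho2.
Proof.
move=> r2 HF HB; have [rho2 h H] := colin_near HF r2 HB.
by exists rho2 => //; split=> //; exact: orth_germ_le HF.
Qed.

Variables (F : V -> W) (p : V) (rho : R).
Hypothesis HG : good_germ F p rho.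
Hypothesis r2 : (2 <= r)%N.
Let HF : orth_germ F p rho. Proof. by case: HG. Qed.
Let rho0 : 0 < rho. Proof. by case: HF. Qed.
Let Hd z : vn (z - p) < rho -> exists D, fd F z D. Proof. by case: HF => _ H _ _ _; exact: H. Qed.
Let Hpr z c : vn (z - p) < rho -> vn (c *: z - p) < rho -> c != 0 ->
    exists2 mu : C, mu != 0 & F (c *: z) = mu *: F z.
Proof. by case: HF => _ _ H _ _; exact: H. Qed.
Let Hrf z : vn (z - p) < rho -> radical_free (F z). Proof. by case: HF => _ _ _ H _; exact: H. Qed.
Let Hpos z : vn (z - p) < rho -> 0 < hform z z -> 0 < hform (F z) (F z).
Proof. by case: HF => _ _ _ _ [H _]; exact: H. Qed.
Let Horth z w : vn (z - p) < rho -> vn (w - p) < rho -> hform z w = 0 -> hform (F z) (F w) = 0.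
Proof. by case: HF => _ _ _ _ [_ H]; exact: H. Qed.

Lemma small_ball (z : V) : vn (z - p) < rho / 100 -> vn (z - p) < rho.
Proof. by move=> h; have := rho0; lra. Qed.

(** [w] is the point at infinity of the family [z + l *: w]. The affine line [z + l *: (w - z)]
    reaches it at [l = 1], and for small [l] its points are [1 - l] times members of the family. *)
Lemma line_id z w y : vn (z - p) < rho / 100 -> vn (w - p) < rho / 100 ->
  (exists2 d : R, 0 < d & forall l, nm l < d -> hform (F (z + l *: w)) y = 0) ->
  hform (F w) y = 0.
Proof.
move=> hz hw [d d0 hd].
have [L LE] : exists L : C -> V, L = (fun l => z + l *: (w - z)) by eexists.
have bw : vn (w - z) <= 2 * (rho / 100) by have := vn_triangle w p z; rewrite (vnC p); lra.
have hL l : nm l < 30 -> vn (L l - p) < rho.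
  move=> hl; rewrite LE addrAC; apply: le_lt_trans (vnD _ _) _; rewrite vnZ.
  have : nm l * vn (w - z) <= 30 * (2 * (rho / 100)).
    by apply: ler_pM; rewrite ?nm_ge0 ?vn_ge0 // ltW.
  have := rho0; lra.
have -> : hform (F w) y = hform (F (L 1)) y by rewrite LE scale1r addrC subrK.
have w0 := vn_ge0 w; have w1 : 0 < vn w + 1 by lra.
have e3 : 0 < rho / (4 * (vn w + 1)) by apply: divr_gt0; [exact: rho0|lra].
apply: (@zero_on_disc _ (fun l => hform (F (L l)) y)
    (Num.min (1 / 2) (Num.min (d / 2) (rho / (4 * (vn w + 1)))))).
- by rewrite !lt_min e3 andbT; apply/andP; split; lra.
- move=> l; rewrite !lt_min => /and3P[l1 l2 l3]; have l0 := nm_ge0 l.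
  rewrite ltr_pdivlMr in l3; last by lra.
  have n1 : 1 / 2 <= nm (1 - l) by have := nmD (1 - l) l; rewrite subrK nm1; lra.
  have nz : 1 - l != 0 by apply: contraTneq n1 => ->; rewrite nm0 -ltNge; lra.
  have [m mE] : exists m, m = l / (1 - l) by eexists.
  have nml : nm m <= 2 * nm l.
    rewrite mE nmM nmV ler_pdivrMr; last by lra.
    have := ler_wpM2l l0 n1; lra.
  have E : L l = (1 - l) *: (z + m *: w).
    rewrite LE; apply/rowP => j; rewrite !mxE mE; field; exact: nz.
  have hm : vn (z + m *: w - p) < rho.
    rewrite addrAC; apply: le_lt_trans (vnD _ _) _; rewrite vnZ.
    have := ler_wpM2r w0 nml; have := rho0; lra.
  have l30 : nm l < 30 by lra.
  have hLl : vn ((1 - l) *: (z + m *: w) - p) < rho by rewrite -E; exact: hL.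
  have [mu mu0] := Hpr hm hLl nz.
  rewrite E => ->; rewrite hformZl hd ?mulr0 //; lra.
- move=> l hl; have [D hD] := Hd (hL l hl); apply: cdiff_hform; apply: vcd_comp hD _.
  by rewrite LE; exact: vcd_line.
Qed.

(** Up to the factor [1 + l], the point [z + l *: w] lies on the affine line from [z] to [w]. *)
Lemma colin_ray z w : vn (z - p) < rho / 100 -> vn (w - p) < rho / 100 ->
  exists2 d : R, 0 < d & forall l, nm l < d ->
    vn (z + l *: w - p) < rho /\ colin F z w (z + l *: w).
Proof.
move=> hz hw; have w0 := vn_ge0 w; have w1 : 0 < vn w + 1 by lra.
have z0 := vn_ge0 z; have z1 : 0 < vn z + 1 by lra.
have e1 : 0 < rho / (4 * (vn w + 1)) by apply: divr_gt0; [exact: rho0|lra].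
exists (Num.min (1 / 4) (rho / (4 * (vn w + 1)))).
  by rewrite lt_min e1 andbT; lra.
move=> l; rewrite lt_min => /andP[l1 l2]; have l0 := nm_ge0 l.
rewrite ltr_pdivlMr in l2; last by lra.
have hl : vn (z + l *: w - p) < rho.
  rewrite addrAC; apply: le_lt_trans (vnD _ _) _; rewrite vnZ; have := rho0; lra.
split=> //.
have n1 : 3 / 4 <= nm (1 + l) by have := nmDB (1 + l) l; rewrite addrK nm1; lra.
have nz : 1 + l != 0 by apply: contraTneq n1 => ->; rewrite nm0 -ltNge; lra.
have [a aE] : exists a, a = l / (1 + l) by eexists.
have na : nm a <= 1 / 3.
  rewrite aE nmM nmV ler_pdivrMr; last by lra.
  lra.
have E : (1 + l)^-1 *: (z + l *: w) = z + a *: (w - z).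
  apply/rowP => j; rewrite !mxE aE; field; exact: nz.
have bw : vn (w - z) <= 2 * (rho / 100) by have := vn_triangle w p z; rewrite (vnC p); lra.
have hE : vn ((1 + l)^-1 *: (z + l *: w) - p) < rho.
  rewrite E addrAC; apply: le_lt_trans (vnD _ _) _; rewrite vnZ.
  have : nm a * vn (w - z) <= 1 / 3 * (2 * (rho / 100)).
    by apply: ler_pM => //; [exact: nm_ge0|exact: vn_ge0].
  have := rho0; lra.
have n1' : (1 + l)^-1 != 0 by rewrite invr_eq0.
have hz' := small_ball hz; have hw' := small_ball hw.
have H : colin F (1 *: z) (1 *: w) ((1 + l)^-1 *: (z + l *: w)).
  by rewrite !scale1r E; case: HG => _ Hc; apply: Hc => //; lra.
have hz1 : vn (1 *: z - p) < rho by rewrite scale1r.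
have hw1 : vn (1 *: w - p) < rho by rewrite scale1r.
exact: (colin_scale HF (oner_neq0 _) (oner_neq0 _) n1' hz' hw' hl hz1 hw1 hE H).
Qed.

(** Otherwise [line_id] would make [F (w 0)] null, although [w 0] is positive. *)
Lemma pairing_nonzero_nearby z w : config p z w (rho / 100) -> forall d : R, 0 < d ->
  exists2 l, nm l < d & hform (F (z + l *: w 0%N)) (F (w 0%N)) != 0.
Proof.
move=> [hz _ hw _] d d0; have [hw0 ww _] := hw 0%N (leq_trans (isT : (0 < 2)%N) r2).
apply: contrapT => H.
have := Hpos (small_ball hw0) ww; suff -> : hform (F (w 0%N)) (F (w 0%N)) = 0 by rewrite ltxx.
apply: (line_id hz hw0); exists d => // l hl; apply: contrapT => /eqP h.
by apply: H; exists l.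
Qed.

Lemma nonzero_pairing (x : W) : radical_free x -> x != 0 -> exists y, hform x y != 0.
Proof.
move=> hx; apply: contra_neqP => H; apply/rowP => j; rewrite mxE.
have [hj|hj] := leqP (r + s') j; first exact: hx.
apply: contrapT => /eqP xj; apply: H; exists (delta_mx 0 j).
rewrite hformE (bigD1 j) //= big1 ?addr0.
  rewrite mxE !eqxx rmorph1 mulr1 mulf_neq0 // /hsgn; case: ifP => _; rewrite ?oner_neq0 //.
  by rewrite hj oppr_eq0 oner_neq0.
by move=> i ij; rewrite mxE (negbTE ij) andbF rmorph0 !mulr0.
Qed.

(** If the derivative is degenerate at all nearby centres [z + l *: x], with [x = w 0], then the
    Wronskian of [A] and [B], the pairings of [F (z + l *: x)] with [y] and [F x], vanishes. So
    [B / A] is constant, equal to its value 0 at [l = 0], and [B] vanishes near 0, contrary to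
    [pairing_nonzero_nearby]. *)
Lemma nondegenerate_derivative_step z w : config p z w (rho / 100) -> F z != 0 ->
  exists z' w' D h, [/\ config p z' w' (rho / 100), fd F z' D, F z' != 0 &
    hform (h *m D) (F (w' 0%N)) != 0].
Proof.
move=> hcfg Fz0; apply: contrapT => HN.
have [d1 d10 hd1] := config_perturb r2 hcfg.
have rr0 : (0 < r)%N by exact: leq_trans r2.
have [hz zz hw ww] := hcfg; have [hx xx xz] := hw 0%N rr0.
have hz' := small_ball hz; have hx' := small_ball hx.
have [x xE] : exists x, x = w 0%N by eexists.
rewrite -xE in hx xx xz hx' hd1.
have zx := hform_eq0C xz.
have be0 : hform (F x) (F x) != 0 by rewrite gt_eqF // Hpos.
have Fzx : hform (F z) (F x) = 0 by exact: Horth.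
(* Removing the component along [F x] does not change the pairing with [F z], which is orthogonal to
   [F x]. *)
have [y [yz yx]] : exists y, hform (F z) y != 0 /\ hform (F x) y = 0.
  have [y0 hy0] := nonzero_pairing (Hrf hz') Fz0.
  exists (y0 - (hform (F x) y0 / hform (F x) (F x))^* *: F x).
  rewrite !hformBr !hformZr Fzx conjCK mulr0 subr0; split=> //.
  by rewrite divfK // subrr.
have [A AE] : exists A : C -> C, A = (fun l => hform (F (z + l *: x)) y) by eexists.
have [B BE] : exists B : C -> C, B = (fun l => hform (F (z + l *: x)) (F x)) by eexists.
have [d2 d20 hd2] := colin_ray hz hx.
(* Cramer's rule: collinearity expresses [F (z + l *: x)] through [F x] and [F z]. *)
have e1 l Y : nm l < d2 -> hform (F z) y * hform (F x) (F x) * hform (F (z + l *: x)) Y =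
    hform (F z) y * B l * hform (F x) Y + hform (F x) (F x) * A l * hform (F z) Y.
  move=> /hd2[_ /(_ y (F x) Y)]; rewrite /d3 yx Fzx AE BE => H.
  apply/eqP; rewrite -subr_eq0 -H; apply/eqP; ring.
have cont g (y' : W) (v v' : V) : vn (v - p) < rho -> g = (fun l : C => hform (F (v + l *: v')) y') ->
    g 0 != 0 -> exists2 d : R, 0 < d & forall l, nm l < d -> g l != 0.
  move=> hv gE g0; have [D hD] := Hd hv.
  have hD' : fd F (v + 0 *: v') D by rewrite scale0r addr0.
  have T : tends (fun h => g (0 + h)) (g 0).
    by rewrite gE; exact: is_cd_tends (is_cd_hform_line y' hD').
  have [d d0 hd] := T _ (nm_gt0 g0).
  exists d => // l /hd; rewrite add0r => h; apply: contraTneq h => ->.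
  by rewrite sub0r nmN ltxx.
have [d3 d30 hd3] := @cont A y z x hz' AE ltac:(by rewrite AE scale0r addr0).
have [m mE] : exists m : C -> C, m = (fun l : C => hform (F (x + l *: z)) (F x)) by eexists.
have [d4 d40 hd4] := @cont m (F x) x z hx' mE ltac:(by rewrite mE scale0r addr0).
have [k kE] : exists k, k = hform x x / hform z z by eexists.
have k0 := nm_ge0 k; have k1 : 0 < nm k + 1 by lra.
have [d [d0 le1 le2 le3 le4]] : exists d : R, [/\ 0 < d, d <= d1, d <= d2, d <= d3 & d <= d4 / (nm k + 1)].
  exists (Num.min (Num.min d1 d2) (Num.min d3 (d4 / (nm k + 1)))); split.
  - by rewrite !lt_min d10 d20 d30 divr_gt0.
  - by rewrite !ge_min lexx.
  - by rewrite !ge_min lexx orbT.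
  - by rewrite !ge_min lexx orbT.
  - by rewrite !ge_min lexx !orbT.
have [g gE] : exists g : C -> C, g = (fun l => B l * (A l)^-1) by eexists.
have key l : nm l < d -> is_cd g l 0.
  move=> hl; have hl1 := lt_le_trans hl le1; have hl2 := lt_le_trans hl le2.
  have hl3 := lt_le_trans hl le3; have l0 := nm_ge0 l.
  have [hlb _] := hd2 l hl2; have [D hD] := Hd hlb.
  have Al0 := hd3 l hl3.
  have Fl0 : F (z + l *: x) != 0.
    by apply: contraTneq Al0 => E; rewrite AE E hform0l negbK.
  have [w' wE] : exists w', w' = x - (l^* * k) *: z by eexists.
  have w'E : perturb0 z w l 0%N = w' by rewrite /perturb0 eqxx -xE wE kE.
  have hcfg' := hd1 l hl1.
  have der0 : hform (x *m D) (F w') = 0.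
    apply: contrapT => /eqP h; apply: HN.
    exists (z + l *: x), (perturb0 z w l), D, x; split=> //; by rewrite w'E.
  have orth0 : hform (F (z + l *: x)) (F w') = 0.
    have [q1 _ q2 _] := hcfg'; have [q3 _ q4] := q2 0%N rr0; rewrite w'E in q3 q4.
    by apply: Horth (small_ball q1) (small_ball q3) _; exact: hform_eq0C.
  have P0 : hform (F x) (F w') != 0.
    have hk : nm (- (l^* * k)) < d4.
      rewrite nmN nmM nm_conj; have h := lt_le_trans hl le4.
      by rewrite ltr_pdivlMr // in h; lra.
    have := hd4 _ hk; rewrite mE scaleNr -wE.
    by apply: contraNneq => h; rewrite hformC h rmorph0.
  have dA : is_cd A l (hform (x *m D) y) by rewrite AE; exact: is_cd_hform_line.
  have dB : is_cd B l (hform (x *m D) (F x)) by rewrite BE; exact: is_cd_hform_line.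
  set A' := hform (x *m D) y in dA; set B' := hform (x *m D) (F x) in dB.
  set al := hform (F z) y in e1 yz; set be := hform (F x) (F x) in e1 be0.
  set P := hform (F x) (F w') in P0; have [Q QE] : exists Q, Q = hform (F z) (F w') by eexists.
  have r1 : al * B l * P + be * A l * Q = 0 by rewrite QE -e1 // orth0 mulr0.
  have r2' : al * B' * P + be * A' * Q = 0.
    have c1 : is_cd (fun s => al * be * hform (F (z + s *: x)) (F w')) l
        (0 * hform (F (z + l *: x)) (F w') + al * be * hform (x *m D) (F w')).
      by apply: is_cdM; [exact: is_cd_cst|exact: is_cd_hform_line].
    rewrite der0 mulr0 mul0r addr0 in c1.
    have c2 : is_cd (fun s => al * P * B s + be * Q * A s) l
        ((0 * B l + al * P * B') + (0 * A l + be * Q * A')).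
      by apply: is_cdD; apply: is_cdM => //; exact: is_cd_cst.
    have dl0 : 0 < d2 - nm l by rewrite subr_gt0.
    have c3 : is_cd (fun s => al * P * B s + be * Q * A s) l 0.
      apply: (is_cd_local dl0 _ c1) => h hh; rewrite e1 /P ?QE; last first.
        by apply: le_lt_trans (nmD _ _) _; rewrite -ltrBrDl.
      ring.
    by have := is_cd_unique c2 c3 => <-; ring.
  (* [r1] and [r2'] are two linear equations with the nontrivial solution [al * P], [be * Q], so
     their determinant, the Wronskian, is 0. *)
  have W0 : B' * A l = A' * B l.
    apply: (mulfI (mulf_neq0 yz P0)); apply/eqP; rewrite -subr_eq0; apply/eqP.
    have -> : al * P * (B' * A l) - al * P * (A' * B l) =
      A l * (al * B' * P + be * A' * Q) - A' * (al * B l * P + be * A l * Q) by ring.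
    by rewrite r1 r2'; ring.
  rewrite gE; apply: is_cd_eq; first exact: (is_cdM dB (is_cdV Al0 dA)).
  have -> : B' / A l + B l * (- A' / A l ^+ 2) = (B' * A l - A' * B l) / A l ^+ 2 by field.
  by rewrite W0 subrr mul0r.
have := zero_derivative d0 key => hg.
have g0 : g 0 = 0 by rewrite gE BE scale0r addr0 Fzx mul0r.
have d40' : 0 < d / 8 by lra.
have [l hl] := pairing_nonzero_nearby hcfg d40'.
rewrite -xE => /eqP; apply.
have l4 : nm l <= d / 4 by lra.
have := hg l l4; rewrite g0 gE => /eqP; rewrite mulf_eq0 invr_eq0 (negbTE (hd3 l _)) ?orbF; last by lra.
by rewrite BE => /eqP.
Qed.

(** The projection modulo the radical may annihilate the lift at a negative point; a small move of
    the centre ensures [F z != 0]. *)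
Lemma nondegenerate_derivative z w : config p z w (rho / 100) ->
  exists z' w' D h, [/\ config p z' w' (rho / 100), fd F z' D, F z' != 0 &
    hform (h *m D) (F (w' 0%N)) != 0].
Proof.
move=> hcfg; have [d d0 hd] := config_perturb r2 hcfg.
have [l hl nz] := pairing_nonzero_nearby hcfg d0.
apply: (nondegenerate_derivative_step (hd l hl)).
by apply: contraNneq nz => ->; rewrite hform0l.
Qed.

End Derivative.

(** * Normalization and linearity *)

Section Linearization.
Variable R : realType.
Local Notation C := (complex R).
Variables r s t s' t' : nat.
Local Notation V := ('rV[C]_(r + s + t)).
Local Notation W := ('rV[C]_(r + s' + t')).

Lemma fd_continuous n m (F : 'rV[C]_n -> 'rV[C]_m) z D : fd F z D ->
  forall e : R, 0 < e -> exists2 d : R, 0 < d & forall w, vn (w - z) < d -> vn (F w - F z) < e.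
Proof.
move=> hD e e0; pose K : R := \sum_j \sum_i nm (D i j).
have K0 : 0 <= K by apply: sumr_ge0 => j _; apply: sumr_ge0 => i _; exact: nm_ge0.
have hK (v : 'rV[C]_n) : vn (v *m D) <= K * vn v.
  rewrite /K mulr_suml; apply: ler_sum => j _; rewrite mxE.
  apply: le_trans (nm_sum _ _ _) _; rewrite mulr_suml; apply: ler_sum => i _.
  by rewrite nmM mulrC ler_wpM2l ?nm_ge0 // nm_le_vn.
have [d d0 hd] := hD 1 ltr01; have K1 : 0 < K + 2 by lra.
exists (Num.min d (e / (K + 2))) => [|w]; first by rewrite lt_min d0 divr_gt0.
rewrite lt_min => /andP[/hd h1]; rewrite ltr_pdivlMr // => h2.
move: h1; rewrite [z + _]addrC subrK mul1r => h1.
have := vnD (F w - F z - (w - z) *m D) ((w - z) *m D); rewrite subrK.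
have := hK (w - z); have := vn_ge0 (w - z); move: (vn (w - z)) h1 h2 => x h1 h2; lra.
Qed.

Variables (F : V -> W) (p : V) (rho : R).
Hypothesis HG : good_germ F p rho.
Hypothesis r2 : (2 <= r)%N.
Let HF : orth_germ F p rho. Proof. by case: HG. Qed.
Let rho0 : 0 < rho. Proof. by case: HF. Qed.
Let Hd z : vn (z - p) < rho -> exists D, fd F z D. Proof. by case: HF => _ H _ _ _; exact: H. Qed.
Let Hrf z : vn (z - p) < rho -> radical_free (F z). Proof. by case: HF => _ _ _ H _; exact: H. Qed.
Let Hpos z : vn (z - p) < rho -> 0 < hform z z -> 0 < hform (F z) (F z).
Proof. by case: HF => _ _ _ _ [H _]; exact: H. Qed.
Let Horth z w : vn (z - p) < rho -> vn (w - p) < rho -> hform z w = 0 -> hform (F z) (F w) = 0.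
Proof. by case: HF => _ _ _ _ [_ H]; exact: H. Qed.
Let Hcol z w (a : C) : vn (z - p) < rho -> vn (w - p) < rho -> nm a <= 1 ->
    colin F z w (z + a *: (w - z)).
Proof. by case: HG => _; exact. Qed.

Variables (z0 : V) (w : nat -> V) (D : 'M[C]_(r + s + t, r + s' + t')) (h0 : V).
Hypothesis Hcfg : config p z0 w (rho / 100).
Hypothesis HD : fd F z0 D.
Hypothesis Fz0 : F z0 != 0.
Hypothesis Hh0 : hform (h0 *m D) (F (w 0%N)) != 0.

Let z0in : vn (z0 - p) < rho. Proof. by case: Hcfg => h _ _ _; have := rho0; lra. Qed.
Let z0neg : hform z0 z0 < 0. Proof. by case: Hcfg. Qed.
Let win i : (i < r)%N -> vn (w i - p) < rho.
Proof. by case: Hcfg => _ _ H _ /H[h _ _]; have := rho0; lra. Qed.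
Let wpos i : (i < r)%N -> 0 < hform (w i) (w i).
Proof. by case: Hcfg => _ _ H _ /H[? ? ?]. Qed.
Let wz0 i : (i < r)%N -> hform (w i) z0 = 0.
Proof. by case: Hcfg => _ _ H _ /H[? ? ?]. Qed.
Let ww i j : (i < r)%N -> (j < r)%N -> i != j -> hform (w i) (w j) = 0.
Proof. by case: Hcfg => _ _ _ H; exact: H. Qed.
Let r0 : (0 < r)%N. Proof. exact: leq_trans r2. Qed.

Lemma line_derivative y h : is_cd (fun l => hform (F (z0 + l *: h)) y) 0 (hform (h *m D) y).
Proof. by apply: is_cd_hform_line; rewrite scale0r addr0. Qed.

Lemma line_in (h : V) : exists2 d : R, 0 < d & forall l, nm l < d -> vn (z0 + l *: h - p) < rho.
Proof.
have v0 := vn_ge0 h; have v1 : 0 < vn h + 1 by lra.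
exists ((rho - vn (z0 - p)) / (vn h + 1)) => [|l].
  by apply: divr_gt0 => //; have := z0in; lra.
rewrite ltr_pdivlMr // => hl; rewrite addrAC; apply: le_lt_trans (vnD _ _) _; rewrite vnZ.
by have := nm_ge0 l; lra.
Qed.

(** Differentiate [<F (z0 + l h), F x> = 0], valid for all small [l] when [z0] and [h] are
    orthogonal to [x]. *)
Lemma derivative_vanish x h : vn (x - p) < rho -> hform x z0 = 0 -> hform h x = 0 ->
  hform (h *m D) (F x) = 0.
Proof.
move=> hx xz hxe; have [d d0 hd] := line_in h.
apply: (is_cd_unique (line_derivative (F x) h)).
apply: (is_cd_local d0 _ (is_cd_cst 0 0)) => l hl; rewrite add0r.
apply: Horth => //; first exact: hd.
by rewrite hformDl hformZl hxe (hform_eq0C xz); ring.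
Qed.

Lemma derivative_form x z : vn (x - p) < rho -> hform x z0 = 0 -> hform x x != 0 ->
  hform (z *m D) (F x) = hform (x *m D) (F x) / hform x x * hform z x.
Proof.
move=> hx xz xx; have := @derivative_vanish x (z - (hform z x / hform x x) *: x) hx xz.
rewrite hformBl hformZl divfK // subrr mulmxBl -scalemxAl hformBl hformZl => /(_ erefl).
by move/eqP; rewrite subr_eq0 => /eqP->; field.
Qed.

(** Along the line from [z0] to [z] the values are dependent on [F z0] and [F z], and [F z0] is
    orthogonal to [F x] and [F x']. So the two pairings keep the ratio they have at [F z], and their
    derivatives at [z0] inherit it. *)
Lemma derivative_identity0 x x' z : vn (x - p) < rho -> hform x z0 = 0 ->
  vn (x' - p) < rho -> hform x' z0 = 0 -> vn (z - p) < rho ->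
  hform (z *m D) (F x) * hform (F z) (F x') = hform (z *m D) (F x') * hform (F z) (F x).
Proof.
move=> hx xz hx' xz' hz.
(* [z0 *m D] is orthogonal to these values, so [z] may be replaced by the direction [z - z0]. *)
have lz y : vn (y - p) < rho -> hform y z0 = 0 -> hform (z *m D) (F y) = hform ((z - z0) *m D) (F y).
  move=> hy yz; rewrite mulmxBl hformBl (derivative_vanish hy yz (hform_eq0C yz)) subr0 //.
rewrite !lz //.
have [y hy] := nonzero_pairing (Hrf z0in) Fz0.
have F1 : hform (F z0) (F x) = 0 by apply: Horth => //; exact: hform_eq0C.
have F2 : hform (F z0) (F x') = 0 by apply: Horth => //; exact: hform_eq0C.
have E l : nm l <= 1 -> hform (F z) (F x') * hform (F (z0 + l *: (z - z0))) (F x) =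
     hform (F z) (F x) * hform (F (z0 + l *: (z - z0))) (F x').
  move=> hl; have := Hcol z0in hz hl => /(_ y (F x) (F x')); rewrite /d3 F1 F2.
  rewrite !mul0r !subr0 addr0 => /eqP; rewrite mulf_eq0 (negbTE hy) /= subr_eq0 => /eqP H.
  exact: esym H.
have c1 := is_cdM (is_cd_cst (hform (F z) (F x')) 0) (line_derivative (F x) (z - z0)).
have c2 := is_cdM (is_cd_cst (hform (F z) (F x)) 0) (line_derivative (F x') (z - z0)).
have c3 : is_cd (fun l => hform (F z) (F x') * hform (F (z0 + l *: (z - z0))) (F x)) 0
    (0 * hform (F (z0 + 0 *: (z - z0))) (F x') + hform (F z) (F x) * hform ((z - z0) *m D) (F x')).
  by apply: (is_cd_local ltr01 _ c2) => h /ltW hh; rewrite add0r E.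
have := is_cd_unique c1 c3; rewrite !mul0r !add0r => H.
by rewrite mulrC H mulrC.
Qed.

Let c0 := hform (w 0%N *m D) (F (w 0%N)) / hform (w 0%N) (w 0%N).

Let ell0 z : hform (z *m D) (F (w 0%N)) = c0 * hform z (w 0%N).
Proof. by apply: derivative_form; rewrite ?win ?wz0 // gt_eqF // wpos. Qed.

Let c0n : c0 != 0.
Proof. by apply: contraNneq Hh0 => E; rewrite ell0 E mul0r. Qed.

Let identity x z : vn (x - p) < rho -> hform x z0 = 0 -> vn (z - p) < rho ->
  hform (z *m D) (F x) * hform (F z) (F (w 0%N)) = c0 * hform z (w 0%N) * hform (F z) (F x).
Proof.
by move=> hx xz hz; rewrite -ell0; apply: derivative_identity0 => //; [exact: win|exact: wz0].
Qed.

(* Chosen so that the pairings of [normalized z] with the values [F x], [x] orthogonal to [z0],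
   are linear in [z]. *)
Definition normalizer z := c0 * hform z (w 0%N) / hform (F z) (F (w 0%N)).
Definition normalized z := locked (normalizer z *: F z).

Lemma normalizedE z : normalized z = normalizer z *: F z.
Proof. by rewrite /normalized -lock. Qed.

(** The points of the ball where [normalizer] neither vanishes nor divides by 0. *)
Definition regular z := [/\ vn (z - p) < rho, hform (F z) (F (w 0%N)) != 0 & hform z (w 0%N) != 0].

Lemma normalizer_neq0 z : regular z -> normalizer z != 0.
Proof. by move=> [_ h1 h2]; rewrite /normalizer mulf_neq0 ?invr_eq0 // mulf_neq0. Qed.

Lemma normalized_pairing z x : regular z -> vn (x - p) < rho -> hform x z0 = 0 ->
  hform (normalized z) (F x) = hform (z *m D) (F x).
Proof.
move=> [hz h1 h2] hx xz; rewrite normalizedE hformZl /normalizer mulrAC.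
by rewrite -identity // mulfK.
Qed.

Lemma regular_open z : regular z -> exists2 d : R, 0 < d & forall x, vn (x - z) < d -> regular x.
Proof.
move=> [hz h1 h2]; have [Dz hDz] := Hd hz.
have n1 := nm_gt0 h1; have n2 := nm_gt0 h2.
have v1 := vn_ge0 (F (w 0%N)); have v2 := vn_ge0 (w 0%N).
have q1 : 0 < vn (F (w 0%N)) + 1 by lra.
have q2 : 0 < vn (w 0%N) + 1 by lra.
have [d d0 hd] := fd_continuous hDz (divr_gt0 n1 q1).
exists (Num.min d (Num.min (rho - vn (z - p)) (nm (hform z (w 0%N)) / (vn (w 0%N) + 1)))).
  by rewrite !lt_min d0 subr_gt0 hz divr_gt0.
move=> x; rewrite !lt_min => /and3P[/hd x1 x2 x3].
rewrite ltr_pdivlMr // in x1; rewrite ltr_pdivlMr // in x3.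
split.
- by have := vn_triangle x z p; lra.
- apply/eqP => E; have := nm_hform (F x - F z) (F (w 0%N)).
  rewrite hformBl E sub0r nmN; have := vn_ge0 (F x - F z); lra.
- apply/eqP => E; have := nm_hform (x - z) (w 0%N).
  rewrite hformBl E sub0r nmN; have := vn_ge0 (x - z); lra.
Qed.

Lemma regular_w0 : regular (w 0%N).
Proof.
split; first exact: win.
- by rewrite gt_eqF // Hpos ?win ?wpos.
- by rewrite gt_eqF // wpos.
Qed.

(* A vector spanned by the normalized values and orthogonal to them is null and orthogonal
   to [r] positive vectors, hence vanishes. *)
Lemma relation_on_hyperplane (I : finType) (a : I -> C) (z : I -> V) :
  (forall i, regular (z i)) -> (forall i, hform (z i) z0 = 0) ->
  \sum_i a i *: z i = 0 -> \sum_i a i *: normalized (z i) = 0.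
Proof.
move=> hz zz S0; set X := \sum_i _.
have XF x : vn (x - p) < rho -> hform x z0 = 0 -> hform X (F x) = 0.
  move=> hx xz; rewrite /X hform_suml.
  rewrite (eq_bigr (fun i => hform ((a i *: z i) *m D) (F x))) => [|i _].
    by rewrite -hform_suml -mulmx_suml S0 mul0mx hform0l.
  by rewrite -scalemxAl !hformZl normalized_pairing.
apply: (@orthogonal_to_positive_null_eq0 R r s' t' X (fun i => F (w i))).
- move=> j hj; rewrite /X summxE big1 // => i _; rewrite normalizedE !mxE.
  by have [h _ _] := hz i; rewrite (Hrf h hj) !mulr0.
- rewrite {2}/X hform_sumr big1 // => i _; have [h _ _] := hz i.
  by rewrite normalizedE !hformZr XF // !mulr0.
- move=> i ir; have h1 := win ir; split; [exact: Hrf|exact: XF h1 (wz0 ir)|].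
  by apply: Hpos => //; exact: wpos.
- by move=> i j ir jr ij; apply: Horth; [exact: win|exact: win|exact: ww].
Qed.

(** Nondegeneracy passes from [w 0] to [w 1] through [identity] at a point [w 1 + e w 0]: the right
    side is nonzero there, while the left side sees only [w 1 *m D], since [w 0] is orthogonal to
    [w 1]. *)
Lemma derivative_w1 : hform (w 1%N *m D) (F (w 1%N)) != 0.
Proof.
have h1 := win r2.
have [d d0 hd] : exists2 d : R, 0 < d & forall x, vn (x - w 1%N) < d ->
    vn (x - p) < rho /\ hform (F x) (F (w 1%N)) != 0.
  have n1 : hform (F (w 1%N)) (F (w 1%N)) != 0 by rewrite gt_eqF // Hpos // wpos.
  have [Dz hDz] := Hd h1.
  have q1 : 0 < vn (F (w 1%N)) + 1 by have := vn_ge0 (F (w 1%N)); lra.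
  have [d d0 hd] := fd_continuous hDz (divr_gt0 (nm_gt0 n1) q1).
  exists (Num.min d (rho - vn (w 1%N - p))); first by rewrite lt_min d0 subr_gt0.
  move=> x; rewrite lt_min => /andP[/hd x1 x2]; split.
    by have := vn_triangle x (w 1%N) p; lra.
  apply/eqP => E; have := nm_hform (F x - F (w 1%N)) (F (w 1%N)).
  rewrite ltr_pdivlMr // in x1.
  rewrite hformBl E sub0r nmN; have := vn_ge0 (F x - F (w 1%N)); lra.
have q : 0 < vn (w 0%N) + 1 by have := vn_ge0 (w 0%N); lra.
pose e : R := d / (2 * (vn (w 0%N) + 1)).
have e0 : 0 < e by apply: divr_gt0 => //; lra.
have [x xE] : exists x, x = w 1%N + e%:C%C *: w 0%N by eexists.
have [hx Fx] : vn (x - p) < rho /\ hform (F x) (F (w 1%N)) != 0.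
  apply: hd; rewrite xE addrAC subrr add0r vnZ nm_real gtr0_norm //.
  rewrite /e mulrAC ltr_pdivrMr; last by lra.
  by rewrite ltr_pM2l //; have := vn_ge0 (w 0%N); lra.
have w10 : hform (w 1%N) (w 0%N) = 0 by exact: ww.
have xw0 : hform x (w 0%N) = e%:C%C * hform (w 0%N) (w 0%N).
  by rewrite xE hformDl hformZl w10 add0r.
have := identity h1 (wz0 r2) hx; rewrite xw0 => E.
have xD : hform (x *m D) (F (w 1%N)) = hform (w 1%N *m D) (F (w 1%N)).
  rewrite xE mulmxDl -scalemxAl hformDl hformZl.
  by rewrite (derivative_vanish h1 (wz0 r2) (hform_eq0C w10)) mulr0 addr0.
have en : e%:C%C != 0 :> C by rewrite -[0]/(0%:C%C) (inj_eq (@complexI R)) gt_eqF.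
have wn : hform (w 0%N) (w 0%N) != 0 by rewrite gt_eqF // wpos.
rewrite xD in E; apply: contra_eq_neq E => ->; rewrite mul0r eq_sym.
exact: (mulf_neq0 (mulf_neq0 c0n (mulf_neq0 en wn)) Fx).
Qed.

(** By collinearity the defect [X] depends on the normalized values at [zs] and [z1]. It pairs to 0
    with [F (w 0)] and [F (w 1)], whereas on the span of these two values the two pairings form a
    nonsingular triangular system, [zs] being orthogonal to [w 1] and [z1] not. *)
Lemma relation_off_hyperplane zs z1 (a : C) : regular zs -> hform zs (w 1%N) = 0 ->
  regular z1 -> hform z1 (w 1%N) != 0 -> nm a <= 1 -> regular (z1 + a *: (zs - z1)) ->
  normalized (z1 + a *: (zs - z1)) = a *: normalized zs + (1 - a) *: normalized z1.
Proof.
move=> hs sw hz1 zw ha hz.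
have k0 := win r0; have h1 := win r2.
have [z zE] : exists z, z = z1 + a *: (zs - z1) by eexists.
rewrite -zE in hz *.
apply/eqP; rewrite -subr_eq0; apply/eqP; set X := _ - _.
have rf x : regular x -> radical_free (normalized x).
  by move=> [h _ _] j hj; rewrite normalizedE mxE (Hrf h hj) mulr0.
have rX : radical_free X.
  by move=> j hj; rewrite !mxE (rf _ hz j hj) (rf _ hs j hj) (rf _ hz1 j hj); ring.
have XF x : vn (x - p) < rho -> hform x z0 = 0 -> hform X (F x) = 0.
  move=> hx xz; rewrite /X hformBl hformDl !hformZl !normalized_pairing //.
  by rewrite zE mulmxDl -scalemxAl mulmxBl hformDl hformZl hformBl; ring.
apply: contrapT => /eqP /(nonzero_pairing rX)[y hy].
have [b1 _ _] := hz1; have [bs _ _] := hs.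
have := Hcol b1 bs ha; rewrite -zE => /(_ (F (w 0%N)) (F (w 1%N)) y) col.
have E : d3 (hform (normalized z1) (F (w 0%N))) (hform (normalized z1) (F (w 1%N))) (hform (normalized z1) y)
     (hform (normalized zs) (F (w 0%N))) (hform (normalized zs) (F (w 1%N))) (hform (normalized zs) y)
     (hform (normalized z) (F (w 0%N))) (hform (normalized z) (F (w 1%N))) (hform (normalized z) y) = 0.
  by rewrite !normalizedE !hformZl d3_scale col mulr0.
have zX : normalized z = X + (a *: normalized zs + (1 - a) *: normalized z1) by rewrite /X subrK.
rewrite zX in E; move: E.
have X0 := XF _ k0 (wz0 r0); have X1 := XF _ h1 (wz0 r2).
have s1 : hform (normalized zs) (F (w 1%N)) = 0.
  by rewrite normalized_pairing ?wz0 // derivative_vanish ?wz0.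
have s0 : hform (normalized zs) (F (w 0%N)) != 0.
  rewrite normalized_pairing ?wz0 // ell0 mulf_neq0 //; by case: hs.
have t1 : hform (normalized z1) (F (w 1%N)) != 0.
  rewrite normalized_pairing ?wz0 // derivative_form ?wz0 //; last by rewrite gt_eqF // wpos.
  by rewrite !mulf_neq0 ?invr_eq0 ?derivative_w1 // gt_eqF // wpos.
clear zX rX XF; move: (normalized zs) (normalized z1) X hy X0 X1 s1 s0 t1 => Y Z X hy X0 X1 s1 s0 t1.
rewrite /d3 !hformDl !hformZl X0 X1 s1 => E.
have : hform X y * hform Y (F (w 0%N)) * hform Z (F (w 1%N)) = 0.
  by rewrite -[RHS]oppr0 -[in RHS]E; ring.
by move/eqP; rewrite !mulf_eq0 (negbTE hy) (negbTE s0) (negbTE t1).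
Qed.


Lemma regular_step z (x : V) : regular z -> exists2 e : R, 0 < e & regular (z + e%:C%C *: x).
Proof.
move=> /regular_open[d d0 hd]; have v0 := vn_ge0 x.
have e0 : 0 < d / (vn x + 1) by apply: divr_gt0; lra.
exists (d / (vn x + 1)) => //; apply: hd.
rewrite addrAC subrr add0r vnZ nm_real gtr0_norm // mulrAC ltr_pdivrMr; last by lra.
by rewrite ltr_pM2l //; lra.
Qed.

Let realC_neq0 (x : R) : 0 < x -> x%:C%C != 0 :> C.
Proof. by move=> h; rewrite -[0]/(0%:C%C) (inj_eq (@complexI R)) gt_eqF. Qed.

(** Projection from [zs] onto the hyperplane orthogonal to [z0]: the line from [zs] through a point
    near [c] meets the hyperplane in a regular point [z1], still near [c] and not orthogonal to
    [w 1]. *)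
Lemma decomposition zs c : regular zs -> hform zs (w 1%N) = 0 -> hform zs z0 != 0 ->
  regular c -> hform c z0 = 0 -> hform c (w 1%N) != 0 ->
  exists2 rc : R, 0 < rc & forall z, vn (z - c) < rc -> regular z /\
    exists z1, [/\ regular z1, hform z1 z0 = 0,
      (1 - hform z z0 / hform zs z0) *: z1 = z - (hform z z0 / hform zs z0) *: zs &
      normalized z = (hform z z0 / hform zs z0) *: normalized zs +
        (1 - hform z z0 / hform zs z0) *: normalized z1].
Proof.
move=> hs sw sz hc cz cw.
have [d1 d10 hd1] := regular_open hc.
have [M ME] : exists M : R, M = vn z0 / nm (hform zs z0) by eexists.
have [S SE] : exists S : R, S = vn (zs - c) by eexists.
have M0 : 0 <= M by rewrite ME divr_ge0 ?vn_ge0 ?nm_ge0.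
have S0 : 0 <= S by rewrite SE vn_ge0.
have MS : 0 <= M * S by exact: mulr_ge0.
have v1 := vn_ge0 (w 1%N); have q1 : 0 < vn (w 1%N) + 1 by lra.
have nc := nm_gt0 cw.
have [d2 [d20 d21 d22]] : exists d2 : R, [/\ 0 < d2, d2 <= d1 & d2 * (vn (w 1%N) + 1) <= nm (hform c (w 1%N))].
  exists (Num.min d1 (nm (hform c (w 1%N)) / (vn (w 1%N) + 1))); split.
  - by rewrite lt_min d10 divr_gt0.
  - by rewrite ge_min lexx.
  - rewrite -ler_pdivlMr //; by rewrite ge_min lexx orbT.
have [rc [rc0 rc1 rc2 rc3]] : exists rc : R, [/\ 0 < rc, rc <= d1, M * rc <= 1 / 2 & 2 * (1 + M * S) * rc <= d2].
  exists (Num.min d1 (Num.min (1 / 2 / (M + 1)) (d2 / (2 * (1 + M * S))))); split.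
  - by rewrite !lt_min d10 !divr_gt0 //; lra.
  - by rewrite ge_min lexx.
  - apply: (@le_trans _ _ (M * (1 / 2 / (M + 1)))).
      by rewrite ler_wpM2l // !ge_min lexx orbT.
    rewrite mulrA ler_pdivrMr; lra.
  - rewrite mulrC -ler_pdivlMr; last by lra.
    by rewrite !ge_min lexx !orbT.
exists rc => // z hz.
have rz : regular z by apply: hd1; exact: lt_le_trans rc1.
split=> //; have [a aE] : exists a, a = hform z z0 / hform zs z0 by eexists.
rewrite -aE.
have v0 := vn_ge0 (z - c).
have na : nm a <= M * vn (z - c).
  rewrite aE nmM nmV ME mulrAC ler_pM2r ?invr_gt0 ?nm_gt0 // mulrC.
  by rewrite -[hform z z0](subr0) -cz -hformBl nm_hform.
have na2 : nm a <= 1 / 2.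
  by apply: le_trans na _; apply: le_trans rc2; rewrite ler_wpM2l // ltW.
have n1 : 1 / 2 <= nm (1 - a) by have := nmD (1 - a) a; rewrite subrK nm1; lra.
have nz : 1 - a != 0 by apply: contraTneq n1 => ->; rewrite nm0 -ltNge; lra.
have [z1 z1E] : exists z1, z1 = (1 - a)^-1 *: (z - a *: zs) by eexists.
have E1 : (1 - a) *: z1 = z - a *: zs by rewrite z1E scalerA mulfV // scale1r.
have near1 : vn (z1 - c) < d2.
  have -> : z1 - c = (1 - a)^-1 *: ((z - c) - a *: (zs - c)).
    rewrite z1E; apply/rowP => j; rewrite !mxE; field; exact: nz.
  rewrite vnZ nmV mulrC ltr_pdivrMr; last by lra.
  have := vnD (z - c) (- (a *: (zs - c))); rewrite vnN vnZ -SE.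
  have h1 : nm a * S <= M * vn (z - c) * S by rewrite ler_wpM2r.
  have h2 : (1 + M * S) * vn (z - c) < (1 + M * S) * rc by rewrite ltr_pM2l //; lra.
  have h3 : d2 * (1 / 2) <= d2 * nm (1 - a) by rewrite ler_wpM2l // ltW.
  move: (vn (z - c - _)) => X hX; lra.
have r1 : regular z1 by apply: hd1; lra.
have zw1 : hform z1 (w 1%N) != 0.
  apply/eqP => E; have := nm_hform (z1 - c) (w 1%N).
  rewrite hformBl E sub0r nmN; have := vn_ge0 (z1 - c).
  have : vn (z1 - c) * vn (w 1%N) <= d2 * vn (w 1%N) by rewrite ler_wpM2r // ltW.
  lra.
have z10 : hform z1 z0 = 0.
  by rewrite z1E hformZl hformBl hformZl aE divfK // subrr mulr0.
have zz : z = z1 + a *: (zs - z1).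
  have -> : z1 + a *: (zs - z1) = (1 - a) *: z1 + a *: zs.
    by apply/rowP => j; rewrite !mxE; ring.
  by rewrite E1 subrK.
exists z1; split=> //.
rewrite {1}zz; apply: relation_off_hyperplane => //; first by lra.
by rewrite -zz.
Qed.

(** Through [decomposition] a linear relation near [c] splits into a multiple of [zs] with total
    coefficient 0 and a relation inside the hyperplane. So [normalized] respects all linear
    relations on a ball, and this makes it linear there. *)
Lemma local_linear : exists c (rc : R) (L : 'M[C]_(r + s + t, r + s' + t')),
  [/\ 0 < rc, hform c z0 = 0, 0 < hform c c &
   forall z, vn (z - c) < rc -> regular z /\ normalized z = z *m L].
Proof.
have zw i : (i < r)%N -> hform z0 (w i) = 0 by move=> ir; apply: hform_eq0C; exact: wz0.
have w01 : hform (w 0%N) (w 1%N) = 0 by exact: ww.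
(* [zs = w 0 + e z0] leaves the hyperplane but stays orthogonal to [w 1]; [c = w 0 + e' w 1] stays
   in the hyperplane and is not orthogonal to [w 1]. *)
have [e e0 hs] := regular_step z0 regular_w0.
have [zs zsE] : exists zs, zs = w 0%N + e%:C%C *: z0 by eexists.
have [e' e0' hc] := regular_step (w 1%N) regular_w0.
have [c cE] : exists c, c = w 0%N + e'%:C%C *: w 1%N by eexists.
rewrite -zsE in hs; rewrite -cE in hc.
have sw : hform zs (w 1%N) = 0 by rewrite zsE hformDl hformZl w01 (zw 1%N r2); ring.
have sz : hform zs z0 != 0.
  by rewrite zsE hformDl hformZl (wz0 r0) add0r mulf_neq0 ?realC_neq0 // lt_eqF.
have cz : hform c z0 = 0 by rewrite cE hformDl hformZl (wz0 r0) (wz0 r2); ring.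
have cw : hform c (w 1%N) != 0.
  by rewrite cE hformDl hformZl w01 add0r mulf_neq0 ?realC_neq0 // gt_eqF // wpos.
have cc : 0 < hform c c.
  have er : (e'%:C%C)^* = e'%:C%C :> C by exact: conjc_real.
  rewrite cE hformDr !hformDl !hformZr !hformZl w01 (hform_eq0C w01) er !mulr0 addr0 add0r.
  have ep : 0 < e'%:C%C :> C by rewrite ltcR.
  by apply: addr_gt0; [exact: wpos|rewrite !mulr_gt0 // wpos].
have [rc rc0 hrc] := decomposition hs sw sz hc cz cw.
have rel (I : finType) (a : I -> C) (z : I -> V) : (forall i, vn (z i - c) < rc) ->
    \sum_i a i *: z i = 0 -> \sum_i a i *: normalized (z i) = 0.
  move=> hz S0; have /choice[z1 hz1] := fun i => (hrc (z i) (hz i)).2.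
  pose al i := hform (z i) z0 / hform zs z0.
  have Sal : \sum_i a i * al i = 0.
    transitivity (hform (\sum_i a i *: z i) z0 / hform zs z0).
      by rewrite hform_suml mulr_suml; apply: eq_bigr => i _; rewrite hformZl /al mulrA.
    by rewrite S0 hform0l mul0r.
  have S1 : \sum_i (a i * (1 - al i)) *: z1 i = 0.
    rewrite (eq_bigr (fun i => a i *: z i - (a i * al i) *: zs)) => [|i _].
      by rewrite sumrB -scaler_suml S0 Sal scale0r subrr.
    by have [_ _ E _] := hz1 i; rewrite -scalerA E scalerBr scalerA.
  have S2 : \sum_i (a i * (1 - al i)) *: normalized (z1 i) = 0.
    by apply: relation_on_hyperplane => // i; have [] := hz1 i.
  rewrite (eq_bigr (fun i => (a i * al i) *: normalized zs + (a i * (1 - al i)) *: normalized (z1 i))).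
    by rewrite big_split /= -scaler_suml Sal scale0r add0r S2.
  by move=> i _; have [_ _ _ E] := hz1 i; rewrite E scalerDr !scalerA.
have [eta eta0 heta] : exists2 eta : R, 0 < eta &
    forall i : 'I_(r + s + t), vn (c + eta%:C%C *: delta_mx 0 i - c) < rc.
  exists (rc / 2) => [|i]; first by lra.
  rewrite addrAC subrr add0r vnZ nm_real gtr0_norm; last by lra.
  have -> : vn (delta_mx 0 i : V) = 1.
    rewrite /vn (bigD1 i) //= mxE !eqxx nm1 big1 ?addr0 // => j ji.
    by rewrite mxE (negbTE ji) andbF nm0.
  by rewrite mulr1; lra.
have en := realC_neq0 eta0.
have [E EE] : exists E : 'I_(r + s + t) -> V, forall i, E i = c + eta%:C%C *: delta_mx 0 i.
  by eexists.
have Eb i : vn (E i - c) < rc by rewrite EE.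
exists c, rc, (\matrix_i ((eta%:C%C)^-1 *: (normalized (E i) - normalized c))).
split=> // z hz; split; first by have [] := hrc z hz.
rewrite mulmx_sum_row; under eq_bigr => i _ do rewrite rowK.
(* The family [z], [c], [E k] with coefficients encoding the relation
   [z = sum_k z_k (E k - c) / eta]; transported to [normalized], it is the claimed matrix
   formula. *)
pose zz (i : 'I_(r + s + t).+2) := if unlift ord0 i is Some j then
   (if unlift ord0 j is Some k then E k else c) else z.
pose aa (i : 'I_(r + s + t).+2) : C := if unlift ord0 i is Some j then
   (if unlift ord0 j is Some k then - (z 0 k / eta%:C%C) else (\sum_k z 0 k) / eta%:C%C) else 1.
have a0 : aa ord0 = 1 by rewrite /aa unlift_none.
have a1 : aa (lift ord0 ord0) = (\sum_k z 0 k) / eta%:C%C by rewrite /aa liftK unlift_none.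
have a2 k : aa (lift ord0 (lift ord0 k)) = - (z 0 k / eta%:C%C) by rewrite /aa !liftK.
have z1 : zz ord0 = z by rewrite /zz unlift_none.
have z2 : zz (lift ord0 ord0) = c by rewrite /zz liftK unlift_none.
have z3 k : zz (lift ord0 (lift ord0 k)) = E k by rewrite /zz !liftK.
have zzb i : vn (zz i - c) < rc.
  rewrite /zz; case: unliftP => [j _|_] //; case: unliftP => [k _|_] //.
  by rewrite subrr vn0.
have sumE (m : nat) (G : V -> 'rV[C]_m) : \sum_i aa i *: G (zz i) =
    G z - \sum_k z 0 k *: ((eta%:C%C)^-1 *: (G (E k) - G c)).
  rewrite !big_ord_recl a0 z1 scale1r; congr (_ + _).
  under eq_bigr => k _ do rewrite a2 z3.
  rewrite a1 z2 mulr_suml scaler_suml -big_split -sumrN /=; apply: eq_bigr => k _.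
  by rewrite scalerA scalerBr scaleNr opprB.
have := rel _ aa zz zzb; rewrite !sumE => H.
apply/eqP; rewrite -subr_eq0; apply/eqP; apply: H.
have := sumE _ (fun x => x); move=> ->.
apply/eqP; rewrite subr_eq0 {1}(row_sum_delta z); apply/eqP; apply: eq_bigr => i _.
by rewrite EE addrAC subrr add0r !scalerA divfK.
Qed.

Lemma ball_linear c (rc : R) (M : 'M[C]_(r + s + t, r + s' + t')) Y : 0 < rc ->
  (forall z, vn (z - c) < rc -> hform (z *m M) Y = 0) -> forall z, hform (z *m M) Y = 0.
Proof.
move=> rc0 H z; have v0 := vn_ge0 z.
have e0 : 0 < rc / (vn z + 1) by apply: divr_gt0; lra.
have := H (c + (rc / (vn z + 1))%:C%C *: z); rewrite addrAC subrr add0r vnZ nm_real gtr0_norm //.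
rewrite mulmxDl -scalemxAl hformDl hformZl (H c) ?subrr ?vn0 // add0r => h.
have lt : rc / (vn z + 1) * vn z < rc.
  by rewrite mulrAC ltr_pdivrMr; [rewrite ltr_pM2l //|]; lra.
by move/eqP: (h lt); rewrite mulf_eq0 (negbTE (realC_neq0 e0)) => /eqP.
Qed.

(** For [x] near [c] in the hyperplane, [z *m L] and [z *m D] have the same pairing with [F x], a
    multiple of [x *m L]. So [<z L, x L>] is a multiple of [<z, x>]. Hermitian symmetry against [c]
    shows that the factor is independent of [x], and positivity at [c] that it is positive. *)
Lemma hyperplane_isometry : exists c (rc K : R) (L : 'M[C]_(r + s + t, r + s' + t')),
  [/\ 0 < rc, 0 < K, forall z, vn (z - c) < rc -> vn (z - p) < rho /\
        exists2 g : C, g != 0 & F z = g *: (z *m L) &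
      forall z x, hform x z0 = 0 -> hform (z *m L) (x *m L) = K%:C%C * hform z x].
Proof.
have [c [rc [L [rc0 cz cc hL]]]] := local_linear.
have FE z : vn (z - c) < rc -> exists2 g : C, g != 0 & F z = g *: (z *m L).
  move=> /hL[rz <-]; exists (normalizer z)^-1; first by rewrite invr_eq0 normalizer_neq0.
  by rewrite normalizedE scalerA mulVf ?normalizer_neq0 // scale1r.
have cin : vn (c - c) < rc by rewrite subrr vn0.
have key x : vn (x - c) < rc -> hform x z0 = 0 -> hform x x != 0 ->
    exists k, forall z, hform (z *m L) (x *m L) = k * hform z x.
  move=> hx xz xx; have [[xin _ _] _] := hL x hx; have [g g0 gE] := FE x hx.
  exists (hform (x *m D) (F x) / hform x x / g^*) => z.
  have H : hform (z *m (L - D)) (F x) = 0.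
    apply: (ball_linear rc0) => z' /hL[rz' E'].
    by rewrite mulmxBr hformBl -E' normalized_pairing // subrr.
  move: H; rewrite mulmxBr hformBl => /eqP; rewrite subr_eq0 => /eqP H.
  have gc : g^* != 0 by rewrite conjC_eq0.
  rewrite (derivative_form z xin xz xx) gE hformZr -gE in H.
  apply: (mulfI gc); rewrite H; field; exact/andP.
have ccn : hform c c != 0 by rewrite gt_eqF.
have [k hk] := key c cin cz ccn.
have cLpos : 0 < hform (c *m L) (c *m L).
  have [[xin _ _] _] := hL c cin; have [g g0 gE] := FE c cin.
  have := Hpos xin cc; rewrite gE hformZl hformZr mulrA -normCK pmulr_rgt0 //.
  by rewrite exprn_gt0 // normr_gt0.
have kpos : 0 < k by move: cLpos; rewrite hk pmulr_lgt0.
have kK := pos_nm kpos.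
have [d [d0 dle hd]] : exists d : R, [/\ 0 < d, d <= rc & forall x, vn (x - c) < d ->
    hform x x != 0 /\ hform c x != 0].
  have n0 := nm_gt0 ccn; have v0 := vn_ge0 c.
  have q : 0 < 2 * vn c + 1 by lra.
  exists (Num.min (Num.min 1 rc) (nm (hform c c) / (2 * vn c + 1))); split.
  - by rewrite !lt_min ltr01 rc0 divr_gt0.
  - by rewrite !ge_min lexx orbT.
  - move=> x; rewrite !lt_min => /andP[/andP[x1 x2] x3]; rewrite ltr_pdivlMr // in x3.
    have u0 := vn_ge0 (x - c).
    have u1 : vn x <= vn c + 1 by have := vnD (x - c) c; rewrite subrK; lra.
    have h1 : vn c * vn (x - c) <= vn (x - c) * (2 * vn c + 1) by rewrite mulrC ler_wpM2l //; lra.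
    split; apply/eqP => E.
      have E1 : - hform c c = hform (x - c) x + hform c (x - c).
        by rewrite hformBl hformBr E; ring.
      have := nmD (hform (x - c) x) (hform c (x - c)); rewrite -E1 nmN.
      have := nm_hform (x - c) x; have := nm_hform c (x - c).
      have := ler_wpM2l u0 u1; lra.
    have := nm_hform c (x - c); rewrite hformBr E sub0r nmN; lra.
have iso0 x z : vn (x - c) < d -> hform x z0 = 0 -> hform (z *m L) (x *m L) = k * hform z x.
  move=> hx xz; have [xx cx] := hd x hx.
  have [k' hk'] := key x (lt_le_trans hx dle) xz xx.
  have : k' * hform c x = k * hform c x.
    rewrite -hk' hformC hk rmorphM /= -hformC; congr (_ * _).
    by rewrite kK; exact: conjc_real.
  by move/(mulIf cx) => <-.
exists c, rc, (nm k), L; split=> //.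
- by apply: nm_gt0; rewrite gt_eqF.
- by move=> z hz; split; [have [[]] := hL z hz|exact: FE].
- move=> z x xz; rewrite -kK.
  have v0 := vn_ge0 x; have e0 : 0 < d / (vn x + 1) by apply: divr_gt0; lra.
  have := iso0 (c + (d / (vn x + 1))%:C%C *: x) z.
  rewrite hformDl hformZl cz xz mulr0 addr0 addrAC subrr add0r vnZ nm_real gtr0_norm //.
  rewrite mulmxDl -scalemxAl !hformDr !hformZr (hk z) => H.
  have en : ((d / (vn x + 1))%:C%C)^* != 0 :> C by rewrite conjC_eq0 realC_neq0.
  have lt : d / (vn x + 1) * vn x < d.
    by rewrite mulrAC ltr_pdivrMr; [rewrite ltr_pM2l //|]; lra.
  by apply: (mulfI en); apply: (addrI (k * hform z c)); rewrite (H lt); ring.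
Qed.

End Linearization.

(** * Globalization *)

Section FrameExistence.
Variable R : realType.
Local Notation C := (complex R).

Definition dot n (x y : 'rV[C]_n) : C := \sum_j x 0 j * (y 0 j)^*.

Lemma orthonormal_basis n (x : 'rV[C]_n) : (0 < n)%N -> x != 0 ->
  exists (a : nat -> 'rV[C]_n) (k : C), [/\ k != 0, x = k *: a 0%N &
    forall i j, (i < n)%N -> (j < n)%N -> dot (a i) (a j) = (i == j)%:R].
Proof.
case: n x => // n x _ x0.
(* All rows equal [x]: Gram-Schmidt still returns a unitary matrix, and its first row spans the line
   of [x]. *)
pose A : 'M[C]_n.+1 := \matrix_(i, j) x 0 j.
pose S := schmidt A.
have SU : S \is unitarymx by exact: schmidt_unitarymx.
pose a (i : nat) := row (inord i) S.
have hx : (x <= row 0 S)%MS.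
  have := row_schmidt_sub A 0.
  have -> : row 0 A = x by apply/rowP => j; rewrite !mxE.
  rewrite (big_pred1 ord0); first by rewrite genmxE.
  by move=> k /=; rewrite leqn0.
have /sub_rVP[k kE] := hx.
exists a, k; split.
- by apply: contraNneq x0 => k0; rewrite kE k0 scale0r.
- by rewrite kE /a; congr (_ *: row _ _); apply: val_inj; rewrite /= inordK.
- move=> i j hi hj; have /unitarymxP/matrixP/(_ (inord i) (inord j)) := SU.
  rewrite !mxE => E; rewrite /dot.
  rewrite (_ : (i == j) = (inord i == inord j :> 'I_n.+1)); last first.
    by rewrite -val_eqE /= !inordK.
  by rewrite -E; apply: eq_bigr => m _; rewrite !mxE.
Qed.

Variables r s t : nat.
Local Notation V := ('rV[C]_(r + s + t)).

Definition vec (x : 'rV[C]_r) (y : 'rV[C]_s) (z : 'rV[C]_t) : V := row_mx (row_mx x y) z.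

Lemma hform_vec x y z x' y' z' : hform (vec x y z) (vec x' y' z') = dot x x' - dot y y'.
Proof.
rewrite hformE big_split_ord /= big_split_ord /= -addrA; congr (_ + _).
  apply: eq_bigr => j _; rewrite /hsgn /= ltn_ord mul1r.
  by rewrite /vec !row_mxEl.
rewrite [X in _ + X]big1 ?addr0 => [|j _]; last first.
  have h1 : (r + s + j < r)%N = false by rewrite ltnNge -addnA leq_addr.
  have h2 : (r + s + j < r + s)%N = false by rewrite ltnNge leq_addr.
  by rewrite /hsgn /= h1 h2 mul0r.
rewrite -sumrN; apply: eq_bigr => j _.
have h1 : (r + j < r)%N = false by rewrite ltnNge leq_addr.
rewrite /hsgn /= h1 ltn_add2l ltn_ord mulN1r.
by rewrite /vec !row_mxEl !row_mxEr.
Qed.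

Lemma dot0l n (x : 'rV[C]_n) : dot 0 x = 0.
Proof. by rewrite /dot big1 // => i _; rewrite mxE mul0r. Qed.
Lemma dot0r n (x : 'rV[C]_n) : dot x 0 = 0.
Proof. by rewrite /dot big1 // => i _; rewrite mxE rmorph0 mulr0. Qed.
Lemma dotZ n a b (x y : 'rV[C]_n) : dot (a *: x) (b *: y) = a * b^* * dot x y.
Proof. by rewrite /dot mulr_sumr; apply: eq_bigr => i _; rewrite !mxE rmorphM /=; ring. Qed.

(** In orthonormal bases starting along [x] and [y] the null vector is [k A_0 + l B_0 + T] with
    [|k| = |l|], and reversing the sign of the [B_0] part gives the dual [q]. The second hyperbolic
    pair is built from [A_1] and [B_1], which is where [r, s >= 2] enters. *)
Lemma frame_at (x : 'rV[C]_r) (y : 'rV[C]_s) z : (2 <= r)%N -> (2 <= s)%N ->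
  x != 0 -> y != 0 -> dot x x = dot y y ->
  exists q v u e, hyperbolic_frame (vec x y z) q v u e.
Proof.
move=> r2 s2 x0 y0 xy.
have [r1 s1] : (0 < r)%N /\ (0 < s)%N by split; exact: leq_trans (isT : (0 < 2)%N) _.
have [a [k [k0 xE aa]]] := orthonormal_basis r1 x0.
have [b [l [l0 yE bb]]] := orthonormal_basis s1 y0.
pose A i := vec (a i) 0 0; pose B i := vec 0 (b i) 0.
have AA i j : (i < r)%N -> (j < r)%N -> hform (A i) (A j) = (i == j)%:R.
  by move=> hi hj; rewrite hform_vec aa // dot0l subr0.
have BB i j : (i < s)%N -> (j < s)%N -> hform (B i) (B j) = - (i == j)%:R.
  by move=> hi hj; rewrite hform_vec bb // dot0l sub0r.
have AB i j : hform (A i) (B j) = 0 by rewrite hform_vec dot0l dot0r subr0.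
have BA i j : hform (B i) (A j) = 0 by rewrite hform_vec dot0l dot0r subr0.
have [T TE] : exists T, T = vec 0 0 z by eexists.
have TA i : hform T (A i) = 0 by rewrite TE hform_vec !dot0l subr0.
have TB i : hform T (B i) = 0 by rewrite TE hform_vec !dot0l subr0.
have AT i : hform (A i) T = 0 by exact: hform_eq0C.
have BT i : hform (B i) T = 0 by exact: hform_eq0C.
have TT : hform T T = 0 by rewrite TE hform_vec !dot0l subr0.
have pE : vec x y z = k *: A 0%N + l *: B 0%N + T.
  rewrite TE /A /B /vec !scale_row_mx !scaler0 !add_row_mx !add0r !addr0 xE yE.
  by rewrite -xE -yE.
have kl : k * k^* = l * l^*.
  by move: xy; rewrite xE yE !dotZ aa // bb // !mulr1.
have ck : k^* != 0 by rewrite conjC_eq0.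
have cl : l^* != 0 by rewrite conjC_eq0.
have h2 : (2 : C)^* = 2 by rewrite rmorph_nat.
have al : ((2 * k^*)^-1)^* = (2 * k)^-1 by rewrite fmorphV rmorphM /= h2 conjCK.
have be : ((2 * l^*)^-1)^* = (2 * l)^-1 by rewrite fmorphV rmorphM /= h2 conjCK.
have h2' : (2^-1 : C)^* = 2^-1 by rewrite fmorphV rmorph_nat.
have a00 := AA 0%N 0%N r1 r1; have a11 := AA 1%N 1%N r2 r2.
have a01 := AA 0%N 1%N r1 r2; have a10 := AA 1%N 0%N r2 r1.
have b00 := BB 0%N 0%N s1 s1; have b11 := BB 1%N 1%N s2 s2.
have b01 := BB 0%N 1%N s1 s2; have b10 := BB 1%N 0%N s2 s1.
rewrite /= in a00 a01 a10 a11 b00 b01 b10 b11.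
rewrite ?oppr0 in b01 b10.
have ea i j : (i < r - 2)%N -> (j < 2)%N -> hform (A i.+2) (A j) = 0.
  move=> hi hj; rewrite AA; first by case: j hj => [|[|]].
    by rewrite -[i.+2]add2n -ltn_subRL.
  exact: leq_trans r2.
rewrite pE; move: A B AA BB AB BA TA TB AT BT a00 a01 a10 a11 b00 b01 b10 b11 ea {pE} => A B.
move=> AA BB AB BA TA TB AT BT a00 a01 a10 a11 b00 b01 b10 b11 ea.
have exps := (@hformBl R r s t, @hformBr R r s t, @hformDl R r s t, @hformDr R r s t,
  @hformZl R r s t, @hformZr R r s t).
exists ((2 * k^*)^-1 *: A 0%N - (2 * l^*)^-1 *: B 0%N), (A 1%N + B 1%N),
  (2^-1 *: A 1%N - 2^-1 *: B 1%N), (fun i => A i.+2).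
have two : (2 : C) != 0 by rewrite pnatr_eq0.
have ll0 : l * l^* != 0 by rewrite mulf_neq0.
split.
- split; rewrite !exps ?AB ?BA ?TA ?TB ?AT ?BT ?TT ?a00 ?a01 ?a10 ?a11 ?b00 ?b01 ?b10 ?b11 ?al ?be ?h2'.
  + transitivity (k * k^* - l * l^*); first by ring.
    by rewrite kl subrr.
  + transitivity (4^-1 * ((k * k^*)^-1 - (l * l^*)^-1)); first by field; rewrite k0 l0 ck cl.
    by rewrite kl subrr mulr0.
  + by ring.
  + by field.
- split; rewrite !exps ?AB ?BA ?TA ?TB ?AT ?BT ?TT ?a00 ?a01 ?a10 ?a11 ?b00 ?b01 ?b10 ?b11 ?al ?be ?h2'.
  + by field; rewrite k0 l0.
  + by field.
  + by ring.
  + by ring.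
- split; rewrite !exps ?AB ?BA ?TA ?TB ?AT ?BT ?TT ?a00 ?a01 ?a10 ?a11 ?b00 ?b01 ?b10 ?b11 ?al ?be ?h2'; ring.
- move=> i hi; have e0 := ea i 0%N hi isT; have e1 := ea i 1%N hi isT.
  by split; rewrite !exps ?AB ?AT ?e0 ?e1; ring.
- have lt i : (i < r - 2)%N -> (i.+2 < r)%N by rewrite ltn_subRL add2n.
  by move=> i j hi hj; rewrite AA ?eqSS //; exact: lt.
Qed.

(** A null point may lie in the radical, where nothing pairs to 1 with it; it is then moved slightly
    off within the null cone. *)
Lemma frame_exists (w : V) (e0 : R) : (2 <= r)%N -> (2 <= s)%N -> hform w w = 0 -> 0 < e0 ->
  exists p q v u e, vn (p - w) < e0 /\ hyperbolic_frame p q v u e.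
Proof.
move=> r2 s2 ww ep.
pose x := lsubmx (lsubmx w); pose y := rsubmx (lsubmx w); pose z := rsubmx w.
have wE : w = vec x y z by rewrite /vec !hsubmxK.
have dd n (v : 'rV[C]_n) : dot v v = 0 -> v = 0.
  move=> h; apply/rowP => j; rewrite mxE.
  have : \sum_j `|v 0 j| ^+ 2 == 0.
    by apply/eqP; transitivity (dot v v) => //; apply: eq_bigr => i _; rewrite normCK.
  rewrite psumr_eq0; last by move=> i _; rewrite exprn_ge0.
  move/allP/(_ j); rewrite mem_index_enum => /(_ isT) /=.
  by rewrite expf_eq0 /= normr_eq0 => /eqP.
have xy : dot x x = dot y y by move: ww; rewrite wE hform_vec => /eqP; rewrite subr_eq0 => /eqP.
have [x0|x0] := eqVneq x 0; last first.
  have y0 : y != 0 by apply: contra_neq x0 => y0; apply: dd; rewrite xy y0 dot0l.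
  have [q [v [u [e H]]]] := frame_at z r2 s2 x0 y0 xy.
  by exists (vec x y z), q, v, u, e; split=> //; rewrite -wE subrr vn0.
have y0 : y = 0 by apply: dd; rewrite -xy x0 dot0l.
have i1 : (0 < r)%N by exact: leq_trans r2.
have j1 : (0 < s)%N by exact: leq_trans s2.
(* Two coordinates move by [e0 / 3], so the displacement stays below [e0]. *)
pose d : C := (e0 / 3)%:C%C.
have d0 : d != 0 by rewrite -[0]/(0%:C%C) (inj_eq (@complexI R)) gt_eqF // divr_gt0.
pose X : 'rV[C]_r := d *: delta_mx 0 (Ordinal i1).
pose Y : 'rV[C]_s := d *: delta_mx 0 (Ordinal j1).
have dn n (i : 'I_n) : delta_mx 0 i != 0 :> 'rV[C]_n.
  by apply/eqP => /rowP/(_ i)/eqP; rewrite !mxE !eqxx oner_eq0.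
have X0 : X != 0 by rewrite scaler_eq0 negb_or d0 dn.
have Y0 : Y != 0 by rewrite scaler_eq0 negb_or d0 dn.
have dot_delta n (i : 'I_n) : dot (delta_mx 0 i) (delta_mx 0 i) = 1.
  rewrite /dot (bigD1 i) //= big1 ?addr0 ?mxE ?eqxx ?rmorph1 ?mulr1 // => j ji.
  by rewrite mxE (negbTE ji) andbF mul0r.
have XY : dot X X = dot Y Y by rewrite !dotZ !dot_delta.
have [q [v [u [e H]]]] := frame_at z r2 s2 X0 Y0 XY.
exists (vec X Y z), q, v, u, e; split=> //.
have vd n (i : 'I_n) : vn (d *: delta_mx 0 i) = e0 / 3.
  rewrite vnZ nm_real gtr0_norm ?divr_gt0 // /vn (bigD1 i) //= mxE !eqxx nm1.
  by rewrite big1 ?addr0 ?mulr1 // => j ji; rewrite mxE (negbTE ji) andbF nm0.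
have -> : vec X Y z - w = vec X Y 0.
  by rewrite wE x0 y0 /vec opp_row_mx opp_row_mx !add_row_mx !oppr0 !addr0 subrr.
have vn_row m n (g : 'rV[C]_m) (h : 'rV[C]_n) : vn (row_mx g h) = vn g + vn h.
  rewrite /vn big_split_ord /=; congr (_ + _); apply: eq_bigr => j _.
    by rewrite row_mxEl.
  by rewrite row_mxEr.
rewrite /vec !vn_row vn0 !vd; lra.
Qed.

End FrameExistence.

Section Parallel.
Variable R : realType.
Local Notation C := (complex R).

(** Vanishing of the 2 by 2 minors: a holomorphic condition, unlike proportionality, and satisfied
    as soon as one vector is 0. *)
Definition par n (x y : 'rV[C]_n) := forall i j, x 0 i * y 0 j = x 0 j * y 0 i.

Lemma parZl n (a : C) (x y : 'rV[C]_n) : par x y -> par (a *: x) y.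
Proof. by move=> h i j; rewrite !mxE -!mulrA h. Qed.
Lemma parZr n (a : C) (x y : 'rV[C]_n) : par x y -> par x (a *: y).
Proof. by move=> h i j; rewrite !mxE mulrCA h mulrCA. Qed.

Lemma par_collinear n (x y : 'rV[C]_n) : par x y -> x != 0 -> exists m, y = m *: x.
Proof.
move=> h x0; have [i xi] : exists i, x 0 i != 0.
  apply: contrapT => H; move/eqP: x0; apply; apply/rowP => i; rewrite mxE.
  by apply: contrapT => /eqP xi; apply: H; exists i.
exists (y 0 i / x 0 i); apply/rowP => j; rewrite mxE.
by apply: (mulfI xi); rewrite h; field.
Qed.

End Parallel.

Section RadicalProjection.
Variable R : realType.
Local Notation C := (complex R).
Variables r s t : nat.

Definition rproj : 'M[C]_(r + s + t) := \matrix_(i, j) ((i == j) && (j < r + s)%N)%:R.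

Lemma rprojE (x : 'rV[C]_(r + s + t)) j :
  (x *m rproj) 0 j = if (j < r + s)%N then x 0 j else 0.
Proof.
rewrite mxE (bigD1 j) //= big1 ?addr0; last first.
  by move=> i ij; rewrite mxE (negbTE ij) mulr0.
by rewrite mxE eqxx /=; case: ifP; rewrite ?mulr1 ?mulr0.
Qed.

Lemma rproj_radical_free (x : 'rV[C]_(r + s + t)) : radical_free (x *m rproj).
Proof. by move=> j hj; rewrite rprojE ltnNge hj. Qed.

Lemma rproj_idem : rproj *m rproj = rproj.
Proof.
apply/row_matrixP => i; rewrite row_mul; apply/rowP => j.
rewrite rprojE; case: ifP => // h; by rewrite !mxE h andbF.
Qed.

Lemma hform_rproj (x y : 'rV[C]_(r + s + t)) : hform (x *m rproj) (y *m rproj) = hform x y.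
Proof.
rewrite !hformE; apply: eq_bigr => j _; rewrite !rprojE /hsgn.
case: ifP => h; first by rewrite (leq_trans h) ?leq_addr.
by case: ifP => h' //; rewrite !mul0r.
Qed.

End RadicalProjection.

(** * From the local map to an isometry on the whole domain *)

Section Germ.
Variable R : realType.
Local Notation C := (complex R).
Variables r s t s' t' : nat.
Local Notation V := ('rV[C]_(r + s + t)).
Local Notation W := ('rV[C]_(r + s' + t')).
Variables (U : V -> Prop) (f : V -> W).
Hypothesis Hf : local_proper U f.
Hypotheses (r2 : (2 <= r)%N) (s2 : (2 <= s)%N).

Lemma chart z : U z -> exists (F : V -> W) (rho : R), 0 < rho /\
  forall w, vn (w - z) < rho -> [/\ U w, exists D, fd F w D & exists2 m : C, m != 0 & F w = m *: f w].
Proof.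
case: Hf => _ [_ [_ [_ [[_ [_ H]] _]]]] /H[O [oO [Oz [OU [F [hF FE]]]]]].
have [rho rho0 hrho] := is_open_ball oO Oz.
exists F, rho; split=> // w /hrho Ow; split; first exact: OU.
  exact: holo_on_fd hF Ow.
by have [m [m0 E]] := FE w Ow; exists m.
Qed.

Local Notation P := (rproj R r s' t').

(** The lift is composed with the projection that forgets the radical coordinates. This changes no
    value of the form and makes the inertia arguments available. *)
Lemma good_germ_of_proper : exists (F : V -> W) p rho q v u e,
  [/\ good_germ F p rho, hyperbolic_frame p q v u e &
    forall w, vn (w - p) < rho -> U w /\ exists2 m : C, m != 0 & F w = m *: (f w *m P)].
Proof.
have [oU [_ [_ [[z [Uz zz]] [[fn0 [fl _]] [fpos fnull]]]]]] := Hf.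
have [d d0 hd] := is_open_ball oU Uz.
have [p [q [v [u [e [pz HB]]]]]] := frame_exists r2 s2 zz d0.
have Up := hd p pz.
have [F [rho [rho0 hF]]] := chart Up.
have [G GE] : exists G : V -> W, G = (fun w => F w *m P) by eexists.
have hG w : vn (w - p) < rho -> exists2 m : C, m != 0 & G w = m *: (f w *m P).
  by move=> /hF[_ _ [m m0 E]]; exists m => //; rewrite GE E scalemxAl.
have proper : proper_germ G p rho.
  split=> //.
  - by move=> w /hF[_ [D hD] _]; exists (D *m P); rewrite GE; exact: fd_mulmx.
  - move=> w c hw hcw c0; have [m m0 E] := hG w hw; have [n n0 E'] := hG _ hcw.
    have [Uw _ _] := hF w hw; have [k [k0 Ek]] := fl w c Uw c0.
    exists (n * k / m); first by rewrite !mulf_neq0 ?invr_eq0.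
    by rewrite E' E Ek -scalemxAl !scalerA divfK.
  - move=> w hw ww; have [m m0 E] := hG w hw; have [Uw _ _] := hF w hw.
    rewrite E hformZl hformZr hform_rproj mulrA -normCK pmulr_rgt0; first exact: fpos.
    by rewrite exprn_gt0 // normr_gt0.
  - move=> w hw ww; have [m m0 E] := hG w hw; have [Uw _ _] := hF w hw.
    by rewrite E hformZl hformZr hform_rproj fnull // !mulr0.
have [[_ qq _ _] [pq _ _ _] _ _ _] := HB.
have qp : hform q p = 1 by rewrite hformC pq rmorph1.
have [rho1 /andP[r10 r11] horth] := orthogonality proper qq qp.
have [_ g1 g2 g3 _] := proper.
have og : orth_germ G p rho1.
  split=> //.
  - by move=> w hw; apply: g1; exact: lt_le_trans hw r11.
  - by move=> w c hw hcw; apply: g2; [exact: lt_le_trans hw r11|exact: lt_le_trans hcw r11].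
  - by move=> w hw; rewrite GE; exact: rproj_radical_free.
  - by split=> // w hw; apply: g3; exact: lt_le_trans hw r11.
have [rho2 /andP[r20 r21] gg] := good_germ_exists r2 og HB.
exists G, p, rho2, q, v, u, e; split=> // w hw.
have hw' := lt_le_trans hw (le_trans r21 r11).
by split; [have [] := hF w hw'|exact: hG].
Qed.

Lemma config_swap (p z : V) w (rr : R) : config p z w rr ->
  config p z (fun i => w (if i == 0%N then 1%N else if i == 1%N then 0%N else i)) rr.
Proof.
move=> [h1 h2 h3 h4]; have r1 : (0 < r)%N by exact: leq_trans r2.
pose sw i := if i == 0%N then 1%N else if i == 1%N then 0%N else i.
have swr i : (i < r)%N -> (sw i < r)%N by rewrite /sw; case: i => [|[|i]].
have swi i j : sw i = sw j -> i = j by rewrite /sw; case: i => [|[|i]]; case: j => [|[|j]].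
split=> //; first by move=> i /swr; exact: h3.
move=> i j /swr hi /swr hj ij; apply: h4 => //.
by apply: contra ij => /eqP/swi ->.
Qed.

(** Two orthogonal positive vectors, both with a component along [z]. As [F] preserves their
    orthogonality, expanding it isolates [<z L, z L>], the value that [hyperplane_isometry] leaves
    open. Two perturbations, with [w 0] and [w 1] exchanged in between, produce the pair. *)
Lemma skew_pair (p z : V) w (rr : R) : config p z w rr ->
  exists X Z x' z' c c', [/\ vn (X - p) < rr /\ vn (Z - p) < rr, 0 < hform X X /\ 0 < hform Z Z,
    hform Z X = 0, [/\ X = x' + c *: z, Z = z' + c' *: z & hform x' z = 0 /\ hform z' z = 0] &
    c != 0 /\ c' != 0].
Proof.
move=> hc; have r1 : (0 < r)%N by exact: leq_trans r2.
have pick d : 0 < d -> exists2 l : C, l != 0 & nm l < d.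
  move=> d0; exists (d / 2)%:C%C.
    by rewrite -[0]/(0%:C%C) (inj_eq (@complexI R)) gt_eqF // divr_gt0.
  rewrite nm_real gtr0_norm; lra.
have [d d0 hd] := config_perturb r2 hc; have [l l0 ld] := pick d d0.
have h1 := config_swap (hd l ld).
have [d' d'0 hd'] := config_perturb r2 h1; have [l' l'0 l'd] := pick d' d'0.
have h2 := hd' l' l'd.
have [_ zz hw _] := hc; have [_ zz1 hw1 _] := h1.
have [_ w00 w0z] := hw 0%N r1; have [_ w11 w1z] := hw 1%N r2.
have [_ w00' w0z'] := hw1 0%N r1.
have [_ _ g1 g2] := h2.
have [x1 x2 _] := g1 1%N r2; have [y1 y2 _] := g1 0%N r1.
have xy := g2 0%N 1%N r1 r2 isT.
move: x1 x2 y1 y2 xy w00'; rewrite /perturb0 /=.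
set c := (X in X *: z); set m := (X in X *: (z + _)) => x1 x2 y1 y2 xy w00'.
have lc0 (x : C) : x != 0 -> x^* != 0 by rewrite conjC_eq0.
exists (w 0%N - c *: z), (w 1%N - m *: (z + l *: w 0%N)), (w 0%N),
  (w 1%N - (m * l) *: w 0%N), (- c), (- m); split=> //.
- split; first by rewrite scaleNr.
    by apply/rowP => j; rewrite !mxE; ring.
  by split=> //; rewrite hformBl hformZl w0z w1z; ring.
- rewrite !oppr_eq0; split.
    by rewrite /c !mulf_neq0 ?invr_eq0 ?lc0 // ?(gt_eqF w00) ?(lt_eqF zz).
  by rewrite /m !mulf_neq0 ?invr_eq0 ?lc0 // ?(gt_eqF w00') ?(lt_eqF zz1).
Qed.

(* The identity theorem along complex lines in a chart makes the set of points near which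
   [f] is parallel to [z *m L] closed as well as open. *)
Lemma global_parallel (L : 'M[C]_(r + s + t, r + s' + t')) c (rc : R) : 0 < rc ->
  (forall w, vn (w - c) < rc -> U w /\ par (f w *m P) (w *m L)) ->
  forall z, U z -> par (f z *m P) (z *m L).
Proof.
move=> rc0 hc; have [oU [_ [cU _]]] := Hf.
pose Q z := exists2 d : R, 0 < d & forall w, vn (w - z) < d -> U w /\ par (f w *m P) (w *m L).
have QU z : Q z -> U z by move=> [d d0 hd]; have [] := hd z; rewrite ?subrr ?vn0.
have Qc : Q c by exists rc.
have openQ : is_open Q.
  move=> z [d d0 hd]; exists (d / 2)%:C%C; split; first by rewrite ltcR divr_gt0.
  move=> w; rewrite vnormE ltcR => hw; exists (d / 2) => [|x hx]; first by lra.
  by apply: hd; have := vn_triangle x w z; lra.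
have openC : is_open (fun z => U z /\ ~ Q z).
  move=> z [Uz nQ]; have [F [rho [rho0 hF]]] := chart Uz.
  (* For points in this ball the line from [w] to [x] stays in the chart for [nm l < 30], as 1 + 30
     * 2 is less than 100. *)
  exists (rho / 100)%:C%C; split; first by rewrite ltcR divr_gt0.
  move=> w; rewrite vnormE ltcR => hw; split; first by have [] := hF w ltac:(lra).
  move=> [d d0 hd]; apply: nQ; exists (rho / 100) => [|x hx]; first by lra.
  have [Ux _ [m m0 FE]] := hF x ltac:(lra); split=> //.
  have bx : vn (x - w) <= 2 * (rho / 100) by have := vn_triangle x z w; rewrite (vnC z); lra.
  have [Z ZE] : exists Z : C -> V, Z = (fun l => w + l *: (x - w)) by eexists.
  have hZ l : nm l < 30 -> vn (Z l - z) < rho.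
    move=> hl; rewrite ZE addrAC; apply: le_lt_trans (vnD _ _) _; rewrite vnZ.
    have : nm l * vn (x - w) <= 30 * (2 * (rho / 100)).
      by apply: ler_pM; rewrite ?nm_ge0 ?vn_ge0 // ltW.
    lra.
  have Z1 : Z 1 = x by rewrite ZE scale1r addrC subrK.
  suff H : par (F x *m P) (x *m L).
    have -> : f x *m P = m^-1 *: (F x *m P) by rewrite FE -scalemxAl scalerA mulVf // scale1r.
    exact: parZl.
  move=> i j; apply/eqP; rewrite -subr_eq0; apply/eqP.
  have v0 := vn_ge0 (x - w).
  have e0 : 0 < d / (vn (x - w) + 1) by apply: divr_gt0; lra.
  rewrite -{1 2 3 4}Z1.
  apply: (@zero_on_disc _ (fun l => (F (Z l) *m P) 0 i * (Z l *m L) 0 j -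
      (F (Z l) *m P) 0 j * (Z l *m L) 0 i) (Num.min 30 (d / (vn (x - w) + 1)))).
  - by rewrite lt_min e0 andbT.
  - move=> l; rewrite lt_min => /andP[l1 l2].
    have [_ _ [n n0 E]] := hF _ (hZ l l1).
    have [|_ hp] := hd (Z l).
      rewrite ZE addrAC subrr add0r vnZ; rewrite ltr_pdivlMr in l2; last by lra.
      by have := nm_ge0 l; lra.
    have {}hp := parZl n hp; rewrite scalemxAl -E in hp.
    by rewrite hp subrr.
  - move=> l hl; have [_ [D hD] _] := hF _ (hZ l hl).
    have cZ : vcd Z l by rewrite ZE; exact: vcd_line.
    have c1 := vcd_comp (fd_mulmx P hD) cZ.
    have c2 : vcd (fun l => Z l *m L) l.
      move=> k; rewrite (_ : (fun _ => _) = (fun l => \sum_i Z l 0 i * L i k)).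
        by apply: cdiff_sum => a _; apply: cdiffM; [exact: cZ|exact: cdiff_cst].
      by apply: funext => a; rewrite mxE.
    exact: (cdiffB (cdiffM (c1 i) (c2 j)) (cdiffM (c1 j) (c2 i))).
move=> z Uz; case: (cU Q QU openQ openC) => [H|H]; first by case: (H c).
by have [d d0 hd] := H z Uz; have [] := hd z; rewrite ?subrr ?vn0.
Qed.

Lemma isometry_exists : exists L : 'M[C]_(r + s + t, r + s' + t'),
  [/\ lin_isometry L, L *m P = L, exists2 z, U z & f z *m P != 0 &
    forall z, U z -> f z *m P != 0 -> prop_vec (f z *m P) (z *m L)].
Proof.
have [F [p [rho [q [v [u [e [gg HB hF]]]]]]]] := good_germ_of_proper.
have [og _] := gg; have [rho0 _ _ _ [Fpos Forth]] := og.
have rr0 : 0 < rho / 100 by lra.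
have sm z : vn (z - p) < rho / 100 -> vn (z - p) < rho by move=> h; lra.
have [z1 [w1 cfg1]] := config_exists r2 rr0 HB.
have [z0 [w [D [h [cfg HD Fz0 Hh]]]]] := nondegenerate_derivative gg r2 cfg1.
have [c [rc [K [L0 [rc0 K0 hc iso]]]]] := hyperplane_isometry gg r2 cfg HD Fz0 Hh.
have [L LE] : exists L, L = L0 *m P by eexists.
have hL : forall z, U z -> par (f z *m P) (z *m L).
  apply: (global_parallel rc0) => x hx; have [xp [g g0 gE]] := hc x hx.
  have [Ux [m m0 mE]] := hF x xp; split=> //.
  have -> : x *m L = (g^-1 * m) *: (f x *m P).
    have -> : x *m L = g^-1 *: (F x *m P).
      by rewrite LE mulmxA gE -!scalemxAl scalerA mulVf // scale1r.
    by rewrite mE -!scalemxAl -mulmxA rproj_idem scalerA.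
  by apply: parZr => i j; rewrite mulrC.
have {}iso z x : hform x z0 = 0 -> hform (z *m L) (x *m L) = K%:C%C * hform z x.
  by move=> /(iso z) <-; rewrite LE !mulmxA hform_rproj.
have [X [Z [x' [z' [k [k' [[Xp Zp] [XX ZZ] ZX [XE ZE [xz zz]] [k0 k0']]]]]]]] := skew_pair cfg.
have Fneq x : vn (x - p) < rho -> 0 < hform x x -> F x != 0.
  by move=> h1 h2; apply: contraTneq (Fpos x h1 h2) => ->; rewrite hform0l ltxx.
have parF x : vn (x - p) < rho -> 0 < hform x x -> exists n, x *m L = n *: F x.
  move=> h1 h2; have [Ux [m m0 mE]] := hF x h1.
  by have := par_collinear (parZl m (hL x Ux)); rewrite -mE; apply; exact: Fneq.
have iso0 : hform (z0 *m L) (z0 *m L) = K%:C%C * hform z0 z0.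
  have [n nE] := parF Z (sm _ Zp) ZZ; have [n' nE'] := parF X (sm _ Xp) XX.
  have : hform (Z *m L) (X *m L) = K%:C%C * hform Z X.
    by rewrite nE nE' hformZl hformZr ZX (Forth _ _ (sm _ Zp) (sm _ Xp) ZX) !mulr0.
  have i1 := iso z' x' xz; have i2 := iso z0 x' xz.
  have i3 : hform (z' *m L) (z0 *m L) = K%:C%C * hform z' z0.
    by rewrite [LHS]hformC (iso z0 z' zz) zz (hform_eq0C zz) mulr0 rmorph0.
  rewrite XE ZE !mulmxDl -!scalemxAl !hformDr !hformDl !hformZr !hformZl i1 i2 i3.
  (* All other terms agree on both sides, and [B] has the nonzero coefficient [k^* * k']. *)
  set B := hform (z0 *m L) _; move=> E.
  have kk : k^* * k' != 0 by rewrite mulf_neq0 ?conjC_eq0.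
  apply: (mulfI kk); apply/eqP; rewrite -subr_eq0; apply/eqP.
  have := congr1 (fun y => y - K%:C%C * (hform z' x' + k' * hform z0 x' + (k^* * hform z' z0 + k^* * (k' * hform z0 z0)))) E.
  by rewrite subrr => <-; ring.
have [_ z0neg hw hww] := cfg.
have z0n : hform z0 z0 != 0 by rewrite lt_eqF.
have isoL x y : hform (x *m L) (y *m L) = K%:C%C * hform x y.
  have dec a : exists a' b, a = a' + b *: z0 /\ hform a' z0 = 0.
    exists (a - (hform a z0 / hform z0 z0) *: z0), (hform a z0 / hform z0 z0).
    by rewrite subrK hformBl hformZl divfK // subrr.
  have [x1 [a [-> xz1]]] := dec x; have [y1 [b [-> yz1]]] := dec y.
  have i3 : hform (x1 *m L) (z0 *m L) = K%:C%C * hform x1 z0.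
    by rewrite [LHS]hformC (iso z0 x1 xz1) xz1 (hform_eq0C xz1) mulr0 rmorph0.
  rewrite !mulmxDl -!scalemxAl !hformDr !hformDl !hformZr !hformZl.
  rewrite (iso x1 y1 yz1) (iso z0 y1 yz1) i3 iso0; ring.
(* Suppose [z *m L = 0]. Along [z + l *: y] the lift is parallel to [y *m L] for [l != 0], hence by
   continuity also at [z]. The whole image of [L] is then parallel to one vector, although [w 0] and
   [w 1] have orthogonal positive images. *)
have nz z : U z -> f z *m P != 0 -> z *m L != 0.
  move=> Uz fz; apply/eqP => zL.
  have [G [d [d0 hG]]] := chart Uz.
  have zin : vn (z - z) < d by rewrite subrr vn0.
  have [_ [DG hDG] [m m0 mE]] := hG z zin.
  have Gz : G z *m P != 0 by rewrite mE -scalemxAl scaler_eq0 negb_or m0.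
  have parh y : par (G z *m P) (y *m L).
    move=> i j; apply/eqP; rewrite -subr_eq0; apply/eqP.
    pose phi (l : C) := (G (z + l *: y) *m P) 0 i * (y *m L) 0 j - (G (z + l *: y) *m P) 0 j * (y *m L) 0 i.
    have hD' : fd G (z + 0 *: y) DG by rewrite scale0r addr0.
    have cl := vcd_comp (fd_mulmx P hD') (@vcd_line R _ z y 0).
    have [dd /is_cd_tends ht] : cdiff phi 0.
      by apply: (cdiffB (cdiffM (cl i) (cdiff_cst _ _)) (cdiffM (cl j) (cdiff_cst _ _))).
    have phi0 : phi 0 = (G z *m P) 0 i * (y *m L) 0 j - (G z *m P) 0 j * (y *m L) 0 i.
      by rewrite /phi scale0r addr0.
    rewrite -phi0; apply: contrapT => /eqP/nm_gt0 n0.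
    have [a a0 ha] := ht _ n0; have y0 := vn_ge0 y.
    have [b [b0 b1 b2]] : exists b : R, [/\ 0 < b, b < a & b * vn y < d].
      exists (Num.min (a / 2) (d / (vn y + 1))).
      have m1 : Num.min (a / 2) (d / (vn y + 1)) <= a / 2 by rewrite ge_min lexx.
      have m2 : Num.min (a / 2) (d / (vn y + 1)) <= d / (vn y + 1) by rewrite ge_min lexx orbT.
      have m3 : 0 < Num.min (a / 2) (d / (vn y + 1)) by rewrite lt_min !divr_gt0 // ltr_wpDl.
      move: m2; rewrite ler_pdivlMr ?ltr_wpDl // => m2; clear - a0 y0 m1 m2 m3; split; lra.
    have nb : nm (b%:C%C : C) = b by rewrite nm_real gtr0_norm.
    have bn : b%:C%C != 0 :> C by rewrite -[0]/(0%:C%C) (inj_eq (@complexI R)) gt_eqF.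
    have hb : vn (z + b%:C%C *: y - z) < d by rewrite addrAC subrr add0r vnZ nb.
    have [Ub _ [n nn0 nE]] := hG _ hb.
    have pb : phi b%:C%C = 0.
      have := parZr (b%:C%C)^-1 (parZl n (hL _ Ub)); rewrite scalemxAl -nE mulmxDl zL add0r.
      rewrite -scalemxAl scalerA mulVf // scale1r => H.
      by rewrite /phi H subrr.
    by have := ha b%:C%C; rewrite nb add0r pb sub0r nmN ltxx => /(_ b1).
  have r1 : (0 < r)%N by exact: leq_trans r2.
  have [_ w00 _] := hw 0%N r1; have [_ w11 _] := hw 1%N r2; have w01 := hww 0%N 1%N r1 r2 isT.
  have [a aE] := par_collinear (parh (w 0%N)) Gz; have [b bE] := par_collinear (parh (w 1%N)) Gz.
  have Kn : K%:C%C != 0 :> C by rewrite -[0]/(0%:C%C) (inj_eq (@complexI R)) gt_eqF.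
  have := isoL (w 0%N) (w 0%N); have := isoL (w 1%N) (w 1%N); have := isoL (w 0%N) (w 1%N).
  rewrite aE bE !hformZl !hformZr w01 mulr0.
  move/eqP; rewrite !mulf_eq0 conjC_eq0 => /or3P[/eqP->|/eqP->|/eqP->] E1 E2.
  - by move: E2; rewrite mul0r => /esym/eqP; rewrite mulf_eq0 (negbTE Kn) (gt_eqF w00).
  - by move: E1; rewrite mul0r => /esym/eqP; rewrite mulf_eq0 (negbTE Kn) (gt_eqF w11).
  - by move: E2; rewrite !mulr0 => /esym/eqP; rewrite mulf_eq0 (negbTE Kn) (gt_eqF w00).
have sK : 0 < Num.sqrt K by rewrite sqrtr_gt0.
(* Rescaling by [1 / sqrt K] turns the multiple of an isometry into an isometry. *)
have [a [a0 aE]] : exists a : C, a != 0 /\ a * a^* * K%:C%C = 1.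
  exists (Num.sqrt K)^-1%:C%C; split.
    by rewrite -[0]/(0%:C%C) (inj_eq (@complexI R)) invr_eq0 gt_eqF.
  have -> : ((Num.sqrt K)^-1%:C%C)^* = (Num.sqrt K)^-1%:C%C :> C by exact: conjc_real.
  rewrite -!realCM -[1]/(1%:C%C); congr (_%:C)%C.
  by rewrite -{3}(sqr_sqrtr (ltW K0)); field; rewrite gt_eqF.
exists (a *: L); split.
- move=> x y; rewrite -!scalemxAr hformZl hformZr isoL !mulrA aE mul1r //.
- by rewrite -scalemxAl LE -mulmxA rproj_idem.
- have r1 : (0 < r)%N by exact: leq_trans r2.
  have [wp ww _] := hw 0%N r1; have [Uw [m m0 mE]] := hF _ (sm _ wp).
  exists (w 0%N) => //; apply: contra_neq (Fneq _ (sm _ wp) ww) => E.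
  by rewrite mE E scaler0.
- move=> z Uz fz; have [m mE] := par_collinear (hL z Uz) fz.
  have zL := nz z Uz fz.
  have m0 : m != 0 by apply: contraNneq zL => E; rewrite mE E scale0r.
  exists (a * m)^-1; split; first by rewrite invr_eq0 mulf_neq0.
  by rewrite -scalemxAr mE !scalerA -mulrA mulVf ?scale1r // mulf_neq0.
Qed.

End Germ.

Unset Implicit Arguments.
Set Strict Implicit.

Theorem mainTheorem15 (R : realType) (r s t s' t' : nat)
  (U : 'rV[complex R]_(r + s + t) -> Prop)
  (f : 'rV[complex R]_(r + s + t) -> 'rV[complex R]_(r + s' + t')) :
  (2 <= r)%N -> (2 <= s)%N ->
  local_proper U f ->
  quasi_standard U f /\ (t' = 0%N -> standard U f).
Proof.
move=> r2 s2 Hf.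
have [L [iso LP [z0 Uz0 fz0] hL]] := isometry_exists Hf r2 s2.
set P := rproj R r s' t' in LP fz0 hL.
have std : t' = 0%N -> standard U f.
  move=> t0; have P1 : P = 1%:M.
    apply/matrixP => i j; rewrite !mxE; case: (altP (i =P j)) => //= _.
    by case: j => j /= hj; rewrite t0 addn0 in hj; rewrite hj.
  exists L; split=> // z Uz; have := hL z Uz; rewrite P1 mulmx1; apply.
  by case: Hf => _ [_ [_ [_ [[fn0 _] _]]]]; exact: fn0.
(* For [t' = 0] the radical is zero and cannot serve as a summand; the first alternative of the
   definition holds instead. *)
split=> //; have [t0|t0] := eqVneq t' 0%N; first by left; exact: std.
(* [A] consists of the first [r + s'] coordinates and [B] is the radical, so the component in [B] is
   automatically null. *)
right; exists P, (1%:M - P).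
have PP : P *m P = P by exact: rproj_idem.
have PQ : P *m (1%:M - P) = 0 by rewrite mulmxBr mulmx1 PP subrr.
have QP : (1%:M - P) *m P = 0 by rewrite mulmxBl mul1mx PP subrr.
have subP n (x : 'M[complex R]_(n, _)) : (x <= P)%MS -> x *m P = x.
  by move=> /submxP[y ->]; rewrite -mulmxA PP.
have subQ n (x : 'M[complex R]_(n, _)) : (x <= 1%:M - P)%MS -> x *m P = 0.
  by move=> /submxP[y ->]; rewrite -mulmxA QP mulmx0.
have cap : (P :&: (1%:M - P))%MS = 0.
  have h1 := subP _ _ (capmxSl P (1%:M - P)); have h2 := subQ _ _ (capmxSr P (1%:M - P)).
  by rewrite -h1 h2.
have pA (x : 'rV_(r + s' + t')) : x *m proj_mx P (1%:M - P) = x *m P.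
  have {1}-> : x = x *m P + x *m (1%:M - P) by rewrite -mulmxDr addrC subrK mulmx1.
  rewrite mulmxDl (proj_mx_id cap) ?submxMl // (proj_mx_0 cap) ?submxMl //.
  by rewrite addr0.
split; first by apply: contraNneq fz0 => ->; rewrite mulmx0.
split.
  have lt : (r + s' < r + s' + t')%N by rewrite -[X in (X < _)%N]addn0 ltn_add2l lt0n.
  apply/eqP => /matrixP/(_ (Ordinal lt) (Ordinal lt)) /eqP.
  by rewrite !mxE eqxx /= ltnn subr0 oner_eq0.
split.
  apply/andP; split; first exact: submx1.
  have E : P + (1%:M - P) = 1%:M by rewrite addrC subrK.
  by rewrite -[X in (X <= _)%MS]E; apply: addmx_sub_adds; exact: submx_refl.
split; first by apply/mxdirect_addsP.
split.
  move=> a b /subP ha /subQ hb.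
  by rewrite -hform_rproj -/P hb hform0r.
split.
  exists L; split; [by rewrite -LP submxMl|exact: iso|by exists z0; rewrite pA|].
  by move=> z Uz; rewrite pA; exact: hL.
exists (1%:M - P); split=> //.
  by move=> u v /subQ hu _; rewrite -hform_rproj -/P hu hform0l.
by move=> z _; exact: proj_mx_sub.
Qed.
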